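(* Let $\diamondsuit\in\{\square,\mathsf h,\mathsf v\}$ and let $(\nu^\bullet,J^\bullet)\in\mathrm{RC}^{\diamondsuit}$ be such that the rank $n$ satisfies $a^{\diamondsuit}\ge\ell(\mathrm{wt}(\nu^\bullet,J^\bullet))+\ell(\nu^{(a^{\diamondsuit})})$. Then $\Psi$ gives a bijection between $\mathrm{RC}^\diamondsuit$ and a disjoint union of products of $\mathrm{RC}^{\varnothing}$ and sets of Littlewood-Richardson (LR) tableaux: writing $\Psi(\nu^\bullet,J^\bullet)=\{(\nu'^\bullet,J'^\bullet),T\}$, one has $$(\nu^\bullet,J^\bullet)\in\mathrm{RC}^{\diamondsuit}(\lambda,\mathbf L),\qquad \{(\nu'^\bullet,J'^\bullet),T\}\in\mathrm{RC}^{\varnothing}(\eta,\mathbf L)\times LR^{\eta}_{\lambda\mu},$$ with $\lambda=\mathrm{wt}(\nu^\bullet,J^\bullet)$, $\mu=\nu^{(a^{\diamondsuit})}$, $\eta=\mathrm{wt}(\nu'^\bullet,J'^\bullet)$. That is, for fixed $\lambda$ and $\mathbf L$ (with the rank condition satisfied by every element of $\mathrm{RC}^\diamondsuit(\lambda,\mathbf L)$ and $a^\diamondsuit\ge\ell(\lambda)+\ell(\mu)$ for every $\mu\in\mathcal P^\diamondsuit_{|\mathbf L|-|\lambda|}$, which holds for all large $n$), $\Psi$ defines a bijection $$\mathrm{RC}^{\diamondsuit}(\lambda,\mathbf L)\longrightarrow\bigsqcup_{\mu\in\mathcal P^{\diamondsuit}_{|\mathbf L|-|\lambda|},\ \eta\in\mathcal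 P^{\square}_{|\mathbf L|}}\mathrm{RC}^{\varnothing}(\eta,\mathbf L)\times LR^{\eta}_{\lambda\mu},$$ and its inverse is $\Psi^{-1}=\tilde\Psi$.
   Context: **Partitions.** Partitions are identified with Young diagrams; $\ell(\lambda)$ is the number of rows, $|\lambda|$ the size, $\lambda_1$ the largest part. $\square,\mathsf h,\mathsf v$ stand for a single box, a horizontal domino, a vertical domino. $\mathcal P_N^\diamondsuit$: partitions of $N$ tileable by $\diamondsuit$ (all; all rows even; all columns of even height, respectively). $LR^\eta_{\lambda\mu}$: set of semistandard skew tableaux of shape $\eta/\lambda$ and weight $\mu$ ($\mu_i$ letters $i$) whose reverse row word (rows read right to left, from top to bottom) is Yamanouchi (every prefix contains at least as many $i$'s as $(i+1)$'s for all $i$). **Rigged configurations.** Fix the rank $n$ and $\mathbf L=(L_i^{(a)})_{1\le a\le n,\,i\ge1}$, nonnegative integers, finitely many nonzero; $|\mathbf L|=\sum a\,i\,L_i^{(a)}$. The kinds $\square,\mathsf h,\mathsf v,\varnothing$ correspond to the affine types $D_{n+1}^{(2)},C_n^{(1)},D_n^{(1)},A_n^{(1)}$. Set $a^\square=a^{\mathsf h}=n-1$, $a^{\mathsf v}=n-2$. Assume $L_i^{(n)}=0$ for $\square,\mathsf h,\varnothing$, and $L_i^{(a)}=0$ for $a\ge n-2$ for $\mathsf v$. For partitions $\nu^{(1)},\dots,\nu^{(n)}$ ($\nu^{(0)}=\emptyset$) let $Q_i^{(a)}=\sum_j\min(i,\nu_j^{(a)})$ (number of boxes in the first $i$ columns).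 Vacancy numbers for rows of length $i$: $p_i^{(a)}=\sum_kL_k^{(a)}\min(i,k)+Q_i^{(a-1)}-2Q_i^{(a)}+Q_i^{(a+1)}$, except: $\square$: $p_i^{(n)}=2Q_i^{(n-1)}-2Q_i^{(n)}$; $\mathsf h$: $p_i^{(n)}=Q_i^{(n-1)}-Q_i^{(n)}$; $\mathsf v$: $p_i^{(n-2)}=Q_i^{(n-3)}-2Q_i^{(n-2)}+Q_i^{(n-1)}+Q_i^{(n)}$, $p_i^{(n-1)}=Q_i^{(n-2)}-2Q_i^{(n-1)}$, $p_i^{(n)}=Q_i^{(n-2)}-2Q_i^{(n)}$; $\varnothing$: $p_i^{(n)}=Q_i^{(n-1)}-2Q_i^{(n)}$. A rigged configuration $(\nu^\bullet,J^\bullet)$ is such a sequence (for $\mathsf h$ all parts of $\nu^{(n)}$ even) with all $p_i^{(a)}\ge0$ ($i\ge 1$; $i$ even if $\mathsf h$ and $a=n$), together with an integer (rigging) for each row, between $0$ and the vacancy number of the row; riggings of equal-length rows of $\nu^{(a)}$ form an unordered multiset. A row is singular if its rigging equals its vacancy number. $\mathrm{RC}^\diamondsuit(\lambda,\mathbf L)$ ($\diamondsuit\neq\varnothing$, $\ell(\lambda)\le a^\diamondsuit$) is the set of those with $\lambda_a=\sum_{b\ge a,i}iL_i^{(b)}+|\nu^{(a-1)}|-|\nu^{(a)}|$ for $1\le a\le n$, except that for $\mathsf v$ the conditions at $a=n-1,n$ are $|\nu^{(n-2)}|-|\nu^{(n-1)}|-|\nu^{(n)}|=0$ and $|\nu^{(n-1)}|=|\nu^{(n)}|$.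 $\mathrm{RC}^\varnothing(\eta,\mathbf L)$, $\eta\in\mathcal P_{|\mathbf L|}^\square$: the same formula for $1\le a\le n+1$ with $\nu^{(n+1)}=\emptyset$. We write $\lambda=\mathrm{wt}(\nu^\bullet,J^\bullet)$, and $\mathrm{RC}^\diamondsuit$ for the union over $\lambda$ and $\mathbf L$. A rigged configuration of kind $\diamondsuit$ with $\nu^{(a)}=\emptyset$ for $a\ge a^\diamondsuit$ is regarded as an element of $\mathrm{RC}^\varnothing$, and vice versa. **Conventions in the algorithms.** Removed/added boxes are unit boxes; for $\mathsf h$, intermediate $\nu^{(n)}$ may have odd rows. For $\mathsf v$, after an odd number of steps the vacancy number of the longest row of $\nu^{(n)}$ may be $-1$ with rigging $0$. **Map $\delta_l:(\nu^\bullet,J^\bullet)\mapsto\{(\nu'^\bullet,J'^\bullet),k\}$** ($l$ a row length of $\nu^{(n)}$). (i) For $\square,\mathsf h$ choose a length $l$ row of $\nu^{(n)}$; for $\mathsf v$ choose a length $l$ row of $\nu^{(n-1)}$ if $|\nu^{(n-1)}|=|\nu^{(n)}|$ and of $\nu^{(n)}$ if $|\nu^{(n-1)}|<|\nu^{(n)}|$. (ii) Choose a length $l$ row of $\nu^{(a^\diamondsuit)}$; then recursively, having chosen a row of $\nu^{(a)}$, choose a shortest singular row of $\nu^{(a-1)}$ of length at least that of the chosen row of $\nu^{(a)}$; if none exists (in particular if $a=1$) set $k=a$ and stop. (iii) Remove one box from the right end of each chosen row. (iv) Unchanged rows keep their riggings; changed rows get riggings equal to their new vacancy numbers (computed with $\nu'^\bullet$).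 **Map $\Psi:(\nu^\bullet,J^\bullet)\mapsto\{(\nu'^\bullet,J'^\bullet),T\}$.** Let $h_i$ be the height of the $i$-th column of the initial $\nu^{(a^\diamondsuit)}$ and $l=\nu_1^{(a^\diamondsuit)}$. Start with $T$ the empty skew tableau with inner and outer shape $\mathrm{wt}(\nu^\bullet,J^\bullet)$. Apply successively $\delta_l$ $h_l$ times, then $\delta_{l-1}$ $h_{l-1}$ times, ..., then $\delta_1$ $h_1$ times; at the $i$-th application of $\delta_j$ ($1\le i\le h_j$), with output integer $k$, add a box with letter $i$ at the right end of the $k$-th row of $T$. Output the final rigged configuration and $T$. **Map $\tilde\delta_k$** ($k\le a^\diamondsuit$). (i) Pretend an infinitely long row of $\nu^{(k-1)}$ is chosen; for $a=k,k+1,\dots,a^\diamondsuit$ choose a longest singular row of $\nu^{(a)}$ of length not exceeding that of the row chosen in $\nu^{(a-1)}$ (if none, choose a row of length $0$). (ii) If the chosen row of $\nu^{(a^\diamondsuit)}$ has length $l$: for $\square,\mathsf h$ choose a length $l$ row of $\nu^{(n)}$; for $\mathsf v$ choose a length $l$ row of $\nu^{(n)}$ if $|\nu^{(n-1)}|=|\nu^{(n)}|$, and of $\nu^{(n-1)}$ if $|\nu^{(n-1)}|<|\nu^{(n)}|$. (iii) Add one box to each chosen row (length $0$: create a new row). (iv) Riggings of $\nu'^{(a)}$, $a>a^\diamondsuit$, are $0$; otherwise unchanged rows keep riggings and changed rows get riggings equal to their new vacancy numbers. **Map $\tilde\Psi:\{(\nu^\bullet,J^\bullet),T\}\mapsto(\nu'^\bullet,J'^\bullet)$.**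 Let $h_1$ be the largest letter in $T$; the rightmost occurrences of $1,\dots,h_1$ in $T$ form the first group; remove them and repeat to get the second group, etc., until exhausted. Let there be $l$ groups with sizes $h_1,\dots,h_l$, the letter $j$ of group $i$ being in row $k_{i,j}$ of $T$. Output (rightmost operator acts first) $$\tilde\delta_{k_{l,1}}\cdots\tilde\delta_{k_{l,h_l}}\cdots\tilde\delta_{k_{2,1}}\cdots\tilde\delta_{k_{2,h_2}}\tilde\delta_{k_{1,1}}\cdots\tilde\delta_{k_{1,h_1}}(\nu^\bullet,J^\bullet).$$ *)

(* Defs.v *)
From HB Require Import structures.
From mathcomp Require Import all_boot all_order all_algebra finmap.

Set Implicit Arguments.
Unset Strict Implicit.
Unset Printing Implicit Defensive.

Import Order.TTheory GRing.Theory Num.Theory.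

(* Rows, columns, letters and Dynkin nodes are numbered from 1, as in the
   mathematics; nth, take, ... number from 0, hence the shifts by one. *)

(* A partition is the list of its nonzero parts, so that size la = l(la),
   sumn la = |la|, and equality of partitions is equality of lists. *)
Definition is_part (la : seq nat) : bool := sorted geq la && (0 \notin la).

Definition part (la : seq nat) (a : nat) : nat := nth 0 la a.-1.

(* height of the j-th column, for j >= 1 *)
Definition colh (la : seq nat) (j : nat) : nat := count (leq j) la.

Inductive domino : Type := Box | Hdom | Vdom.

(* None is the kind written as the empty set. *)
Definition kind : Type := option domino.

Definition tileable (d : domino) (mu : seq nat) : Prop :=
  match d with
  | Box => True
  | Hdom => forall x, x \in mu -> ~~ odd x
  | Vdom => forall j, 1 <= j -> ~~ odd (colh mu j)
  end.

(* N is an integer because it will be |L| - |la|; for N < 0 there is no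
   partition of N. *)
Definition partitions_of (d : domino) (N : int) (mu : seq nat) : Prop :=
  [/\ is_part mu, Posz (sumn mu) = N & tileable d mu].

(* T.1 is the inner shape; the r-th item of T.2 lists, from left to right, the
   letters in row r.+1. *)
Definition skewtab : Type := (seq nat * seq (seq nat))%type.

Definition trow (T : skewtab) (r : nat) : seq nat := nth [::] T.2 r.-1.

Definition outer (T : skewtab) : seq nat :=
  [seq part T.1 r + size (trow T r) | r <- iota 1 (size T.2)].

Definition in_skew (T : skewtab) (r c : nat) : bool :=
  (1 <= r) && (part T.1 r < c <= part T.1 r + size (trow T r)).

Definition entry (T : skewtab) (r c : nat) : nat :=
  nth 0 (trow T r) (c - (part T.1 r).+1).

Definition semistandard (T : skewtab) : Prop :=
  (forall r c, in_skew T r c -> in_skew T r c.+1 ->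
     entry T r c <= entry T r c.+1) /\
  (forall r c, in_skew T r c -> in_skew T r.+1 c ->
     entry T r c < entry T r.+1 c).

Definition has_shape (T : skewtab) (eta la : seq nat) : Prop :=
  [/\ is_part eta, is_part la, T.1 = la, outer T = eta
    & size la <= size eta].

(* The first condition says that all letters are positive. *)
Definition has_weight (T : skewtab) (mu : seq nat) : Prop :=
  0 \notin flatten T.2 /\
  forall i, 1 <= i -> count_mem i (flatten T.2) = part mu i.

Definition rev_row_word (T : skewtab) : seq nat :=
  flatten [seq rev r | r <- T.2].

Definition Yamanouchi (w : seq nat) : Prop :=
  forall m i, 1 <= i -> count_mem i.+1 (take m w) <= count_mem i (take m w).

Definition LR (eta la mu : seq nat) (T : skewtab) : Prop :=
  [/\ has_shape T eta la, is_part mu, semistandard T, has_weight T mu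
    & Yamanouchi (rev_row_word T)].

(* L (a, i) is L_i^(a). *)
Definition Ldata : Type := {fsfun nat * nat -> nat with 0}.

Definition Lsize (L : Ldata) : nat :=
  \sum_(x <- finsupp L) x.1 * x.2 * L x.

Definition anode (d : domino) (n : nat) : nat :=
  if d is Vdom then n.-2 else n.-1.

(* L_i^(a) is indexed by 1 <= a <= n and i >= 1, and vanishes for a >= n
   (for a >= n - 2 if the kind is v). *)
Definition L_ok (k : kind) (n : nat) (L : Ldata) : Prop :=
  forall a i, L (a, i) != 0 ->
    [/\ 1 <= a, 1 <= i & a < (if k is Some Vdom then n.-2 else n)].

(* sum over k of L_k^(a) min(i, k) *)
Definition LQ (L : Ldata) (a i : nat) : nat :=
  \sum_(x <- finsupp L | x.1 == a) L x * minn i x.2.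

(* sum over b >= a and over i of i L_i^(b) *)
Definition Lge (L : Ldata) (a : nat) : nat :=
  \sum_(x <- finsupp L | a <= x.1) x.2 * L x.

(* a row of length r.1 with rigging r.2 *)
Definition rrow : Type := (nat * int)%type.

Definition rord (r s : rrow) : bool :=
  (s.1 < r.1) || ((r.1 == s.1) && (s.2 <= r.2)%R).

(* The multiset of rows of a rigged partition is represented by the list of its
   rows sorted for rord, without rows of length 0; equality of such lists is
   equality of multisets. *)
Definition rpart : Type := seq rrow.

Definition rnorm (x : rpart) : rpart := sort rord [seq r <- x | 0 < r.1].

Definition is_rpart (x : rpart) : bool :=
  sorted rord x && all (fun r => 0 < r.1) x.

Definition lens (x : rpart) : seq nat := [seq r.1 | r <- x].

(* the list of nu^(1), ..., nu^(n) with their riggings *)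
Definition rc : Type := seq rpart.

(* nu^(a); it is empty for a = 0 and for a > n *)
Definition nu (x : rc) (a : nat) : rpart :=
  if a is b.+1 then nth [::] x b else [::].

Definition nusize (x : rc) (a : nat) : nat := sumn (lens (nu x a)).

Definition Q (x : rc) (a i : nat) : nat :=
  sumn [seq minn i r.1 | r <- nu x a].

Section Vacancy.
Local Open Scope ring_scope.

Definition vacancy (k : kind) (n : nat) (L : Ldata) (x : rc) (a i : nat) :
    int :=
  let q b : int := (Q x b i)%:Z in
  let gen := (LQ L a i)%:Z + q a.-1 - 2 * q a + q a.+1 in
  match k with
  | Some Box =>
      if a == n then 2 * q n.-1 - 2 * q n else gen
  | Some Hdom =>
      if a == n then q n.-1 - q n else gen
  | Some Vdom =>
      if a == n then q n.-2 - 2 * q n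
      else if a == n.-1 then q n.-2 - 2 * q n.-1
      else if a == n.-2 then q n.-2.-1 - 2 * q n.-2 + q n.-1 + q n
      else gen
  | None =>
      if a == n then q n.-1 - 2 * q n else gen
  end.

Definition singular (k : kind) (n : nat) (L : Ldata) (x : rc) (a : nat)
    (r : rrow) : bool :=
  r.2 == vacancy k n L x a r.1.

Definition is_rc (k : kind) (n : nat) (L : Ldata) (x : rc) : Prop :=
  [/\ L_ok k n L,
      size x = n /\ all is_rpart x,
      k = Some Hdom -> forall r, r \in nu x n -> ~~ odd r.1,
      forall a i, (1 <= a <= n)%N -> (1 <= i)%N ->
        (k = Some Hdom -> a = n -> ~~ odd i) -> 0 <= vacancy k n L x a i
    & forall a r, (1 <= a <= n)%N -> r \in nu x a ->
        0 <= r.2 <= vacancy k n L x a r.1].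

Definition wtcoef (L : Ldata) (x : rc) (a : nat) : int :=
  (Lge L a)%:Z + (nusize x a.-1)%:Z - (nusize x a)%:Z.

Definition wt_cond (k : kind) (n : nat) (L : Ldata) (x : rc) (la : seq nat) :
    Prop :=
  match k with
  | Some Vdom =>
      [/\ forall a, (1 <= a <= n.-2)%N -> (part la a)%:Z = wtcoef L x a,
          (nusize x n.-2)%:Z - (nusize x n.-1)%:Z - (nusize x n)%:Z = 0
        & nusize x n.-1 = nusize x n]
  | Some _ => forall a, (1 <= a <= n)%N -> (part la a)%:Z = wtcoef L x a
  | None => forall a, (1 <= a <= n.+1)%N -> (part la a)%:Z = wtcoef L x a
  end.

End Vacancy.

(* RC^k(la, L), at rank n *)
Definition RC (k : kind) (n : nat) (la : seq nat) (L : Ldata) (x : rc) : Prop :=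
  [/\ is_part la,
      match k with
      | Some d => size la <= anode d n
      | None => sumn la = Lsize L
      end,
      is_rc k n L x
    & wt_cond k n L x la].

(* The weight, read off from the configuration; wtcoef is nonnegative on rigged
   configurations, so that the absolute value is harmless there. *)
Definition wt (k : kind) (n : nat) (L : Ldata) (x : rc) : seq nat :=
  [seq b <- [seq absz (wtcoef L x a)
            | a <- iota 1 (if k is Some d then anode d n else n.+1)] | 0 < b].

(* The algorithms are partial functions: None means that a row which has to be
   chosen does not exist. *)

(* A row of length l of nu^(a). Under the rank condition of the theorem, rows of
   the same length have the same rigging whenever this is used, so that the
   choice of the row does not matter. *)
Definition row_of_length (x : rc) (a l : nat) : option rrow :=
  ohead [seq r <- nu x a | r.1 == l].

Definition put (x : rc) (a : nat) (y : rpart) : rc := set_nth [::] x a.-1 y.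

(* Replace each chosen row r of nu^(a) by f a r. A chosen row of length 0 does
   not occur in nu^(a): then f a r is a new row. *)
Definition replace_rows (sel : seq (nat * rrow)) (f : nat -> rrow -> rrow) (x : rc) :
    rc :=
  foldl (fun y s => put y s.1 (rnorm (f s.1 s.2 :: rem s.2 (nu y s.1)))) x sel.

(* Change the length of each chosen row by g, then give the changed rows their
   new vacancy numbers as riggings; the riggings in y are irrelevant. *)
Definition change_rows (k : kind) (n : nat) (L : Ldata) (g : nat -> nat)
    (sel : seq (nat * rrow)) (x : rc) : rc :=
  let y := replace_rows sel (fun _ r => (g r.1, 0%R)) x in
  replace_rows sel (fun a r => (g r.1, vacancy k n L y a (g r.1))) x.

Section Psi.
Variables (d : domino) (n : nat) (L : Ldata).

Local Notation A := (anode d n).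

(* Rows are sorted by decreasing length. *)
Definition shortest_singular (x : rc) (a m : nat) : option rrow :=
  ohead (rev [seq r <- nu x a | (m <= r.1) && singular (Some d) n L x a r]).

(* the rows chosen in nu^(a), nu^(a-1), ..., nu^(k), starting with r *)
Fixpoint chain (x : rc) (a : nat) (r : rrow) : seq (nat * rrow) :=
  (a, r) ::
  (if a is b.+1 then
     if shortest_singular x b r.1 is Some s then chain x b s else [::]
   else [::]).

Definition delta_end (x : rc) : option nat :=
  if d is Vdom then
    if nusize x n.-1 == nusize x n then Some n.-1
    else if nusize x n.-1 < nusize x n then Some n
    else None
  else Some n.

Definition delta (l : nat) (x : rc) : option (rc * nat) :=
  if delta_end x is Some b then
    if row_of_length x b l is Some r then
      if row_of_length x A l is Some s then
        let sel := chain x A s in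
        Some (change_rows (Some d) n L predn ((b, r) :: sel) x, (last (A, s) sel).1)
      else None
    else None
  else None.

Definition add_box (k i : nat) (T : skewtab) : skewtab :=
  (T.1, set_nth [::] T.2 k.-1 (rcons (trow T k) i)).

(* The pair (j, i) stands for the i-th application of delta j. *)
Definition Psi_steps (x : rc) : seq (nat * nat) :=
  let mu := lens (nu x A) in
  [seq (j, i) | j <- rev (iota 1 (head 0 mu)), i <- iota 1 (colh mu j)].

Definition Psi (x : rc) : option (rc * skewtab) :=
  let la := wt (Some d) n L x in
  foldl
    (fun (o : option (rc * skewtab)) (p : nat * nat) =>
       if o is Some (y, T) then
         if delta p.1 y is Some (z, k) then Some (z, add_box k p.2 T) else None
       else None)
    (Some (x, (la, nseq (size la) [::])))
    (Psi_steps x).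

(* m = None stands for an infinite length. *)
Definition longest_singular (x : rc) (a : nat) (m : option nat) : rrow :=
  head (0, 0%R)
    [seq r <- nu x a | (if m is Some l then r.1 <= l else true)
                       && singular (Some d) n L x a r].

(* the rows chosen in nu^(a), nu^(a+1), ..., nu^(a+c-1) *)
Fixpoint tchain (x : rc) (a c : nat) (m : option nat) : seq (nat * rrow) :=
  if c is c'.+1 then
    let r := longest_singular x a m in
    (a, r) :: tchain x a.+1 c' (Some r.1)
  else [::].

Definition tdelta_end (x : rc) : option nat :=
  if d is Vdom then
    if nusize x n.-1 == nusize x n then Some n
    else if nusize x n.-1 < nusize x n then Some n.-1
    else None
  else Some n.

Definition row_or_new (x : rc) (a l : nat) : option rrow :=
  if l == 0 then Some (0, 0%R) else row_of_length x a l.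

Definition zero_riggings (y : rpart) : rpart := [seq (r.1, 0%R) | r <- y].

Definition tdelta (k : nat) (x : rc) : option rc :=
  if 1 <= k <= A then
    let sel := tchain x k (A.+1 - k) None in
    let l := (last (0, (0, 0%R)) sel).2.1 in
    if tdelta_end x is Some b then
      if row_or_new x b l is Some r then
        let y := change_rows (Some d) n L succn (rcons sel (b, r)) x in
        Some [seq if A < a then zero_riggings (nu y a) else nu y a
             | a <- iota 1 n]
      else None
    else None
  else None.

End Psi.

(* a box of a tableau: (letter, (row, column)) *)
Definition cell : Type := (nat * (nat * nat))%type.

Definition cells (T : skewtab) : seq cell :=
  [seq (entry T r c, (r, c))
  | r <- iota 1 (size T.2), c <- iota (part T.1 r).+1 (size (trow T r))].

(* (0, (0, 0)), in the nonexistent row 0, stands for a missing letter. *)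
Definition rightmost (s : seq cell) (j : nat) : cell :=
  head (0, (0, 0))
    (sort (fun c c' : cell => c'.2.2 <= c.2.2) [seq c <- s | c.1 == j]).

(* rightmost occurrences of 1, ..., h, for h the largest letter *)
Definition first_group (s : seq cell) : seq cell :=
  [seq rightmost s j | j <- iota 1 (\max_(c <- s) c.1)].

(* fuel bounds the number of groups; size s is enough. *)
Fixpoint groups (fuel : nat) (s : seq cell) : seq (seq cell) :=
  if fuel is f.+1 then
    if s is [::] then [::]
    else first_group s :: groups f [seq c <- s | c \notin first_group s]
  else [::].

(* The indices of the operators in the order in which they act: within each
   group, the largest letter comes first. *)
Definition tPsi_steps (T : skewtab) : seq nat :=
  flatten [seq [seq c.2.1 | c <- rev g] | g <- groups (size (cells T)) (cells T)].

Definition tPsi (d : domino) (n : nat) (L : Ldata) (y : rc * skewtab) :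
    option rc :=
  foldl (fun (o : option rc) k => if o is Some x then tdelta d n L k x else None)
    (Some y.1) (tPsi_steps y.2).

(* The union over mu and eta is disjoint as a set of pairs: mu is the weight of
   the tableau and eta is its outer shape. *)
Definition target (d : domino) (n : nat) (la : seq nat) (L : Ldata)
    (y : rc * skewtab) : Prop :=
  exists mu eta : seq nat,
    [/\ partitions_of d ((Lsize L)%:Z - (sumn la)%:Z)%R mu,
        partitions_of Box (Lsize L)%:Z eta,
        RC None n eta L y.1
      & LR eta la mu y.2].

Definition partial_bij (X Y : Type) (D : X -> Prop) (E : Y -> Prop)
    (f : X -> option Y) : Prop :=
  [/\ forall x, D x -> exists2 y, f x = Some y & E y,
      forall x x', D x -> D x' -> f x = f x' -> x = x'
    & forall y, E y -> exists2 x, D x & f x = Some y].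

Definition rank_ok (d : domino) (n : nat) (la : seq nat) (x : rc) : Prop :=
  size la + size (nu x (anode d n)) <= anode d n.

Definition rank_ok_all (d : domino) (n : nat) (la : seq nat) (L : Ldata) :
    Prop :=
  (forall x, RC (Some d) n la L x -> rank_ok d n la x) /\
  (forall mu, partitions_of d ((Lsize L)%:Z - (sumn la)%:Z)%R mu ->
     size la + size mu <= anode d n).

(* Main.v *)
(* One application of delta_l removes a box from a chain of singular rows; the
   lengths s(a) of the chosen rows determine how all vacancy numbers change, so
   the step is described symmetrically by the configurations x before and y after
   it: vacancies drop by one only on s(a+1) <= i < s(a) and grow by one on
   s(a) <= i < s(a-1). Choosing shortest singular rows makes the rows of the first
   kind nonsingular in x, and then those of the second kind are nonsingular in y;
   the latter says that tdelta_k picks the same rows back. Concavity of the vacancy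
   numbers away from row lengths gives their nonnegativity in both directions.

   Within one column the chains interlace, s_i(a) <= s_(i+1)(a+1), so that letters
   1, 2, ... of a group go to strictly lower and lower rows; and the rows shortened
   for the column j+1 stay singular until they are needed, so that the i-th chain
   for the column j runs strictly below the i-th chain for the column j+1 and its
   letter ends in a weakly higher row. These two inequalities, with the fact that
   all intermediate weights are partitions, are exactly the Littlewood-Richardson
   condition. The mirrored argument for tdelta recovers the columns from a tableau.

   The rank condition enters twice. For a > l(lambda) the number of boxes of
   nu^(a) to the right of a given column is concave in a, and this forces nu^(n)
   (or its two halves, for vertical dominoes) to agree with nu^(A), A = anode d n.
   And it makes lambda too short to reach row A before the end of a group, so that
   the required row of nu^(A) is singular. *)
Require Import Defs.
From mathcomp Require Import all_boot all_order all_algebra finmap.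
From mathcomp Require Import zify.

Set Implicit Arguments.
Unset Strict Implicit.
Unset Printing Implicit Defensive.

Import Order.TTheory GRing.Theory Num.Theory.

(** * Rows, partitions and vacancy data *)

(** Equal rows of a multiset cannot be told apart, so chains of different steps cannot be compared
    row by row. The substitute is a count: [avail] says that at each node and length there are at
    least as many singular rows as pending chains that need one, and a step that uses up such a row
    also discharges a demand for it. Neither operator is inverted from its definition. Each is shown
    to realise a [link], and a [link] is determined by its chain and either of its ends; so each
    operator undoes the other once both selection rules hold, and the records for partial runs carry
    the equations for [Psi] and for [tPsi] together. Bijectivity is then formal. The three kinds
    differ only above node A. Since the shapes there are governed by node A and the riggings are
    zero, one vacancy function [vac] serves for all kinds. Nonnegativity in the direction of
    [tdelta] needs one outside input, a positive vacancy number for long rows at the last node of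
    the chain; the tableau supplies it, because removing a whole group leaves a partition. *)

Lemma rord_total : total rord.
Proof. by move=> [a b] [c d]; rewrite /rord /=; lia. Qed.

Lemma rord_trans : transitive rord.
Proof. by move=> [a b] [c d] [e f]; rewrite /rord /=; lia. Qed.

Lemma rord_anti : antisymmetric rord.
Proof.
move=> [a b] [c d]; rewrite /rord /= => h.
have [-> ->] // : a = c /\ b = d by lia.
Qed.

Lemma is_rpart_eq (u v : rpart) : is_rpart u -> is_rpart v -> perm_eq u v -> u = v.
Proof.
move=> /andP[su _] /andP[sv _]; exact: (sorted_eq rord_trans rord_anti).
Qed.

Lemma rnorm_rpart (u : rpart) : is_rpart (rnorm u).
Proof.
rewrite /is_rpart /rnorm sort_sorted ?all_sort ?filter_all //; exact: rord_total.
Qed.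

(** The row as a multiset: a row shortened from length 1 disappears. *)
Definition nz (r : rrow) : rpart := if r.1 == 0 then [::] else [:: r].

Lemma perm_rnorm (u : rpart) : perm_eq (rnorm u) [seq r <- u | 0 < r.1].
Proof. by rewrite /rnorm perm_sort. Qed.

Lemma perm_rnorm_cons (r : rrow) (u : rpart) :
  all (fun r => 0 < r.1) u -> perm_eq (rnorm (r :: u)) (nz r ++ u).
Proof.
move=> pu; apply: (perm_trans (perm_rnorm _)); rewrite /nz /= lt0n (all_filterP pu).
by case: (r.1 == 0) => /=.
Qed.

Lemma sorted_lens (u : rpart) : sorted rord u -> sorted geq (lens u).
Proof.
move=> su; rewrite /lens sorted_map; apply: sub_sorted su => r s; rewrite /rord /=; lia.
Qed.

Lemma is_rpart_lens (u : rpart) : is_rpart u -> is_part (lens u).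
Proof.
move=> /andP[/sorted_lens su pu]; rewrite /is_part su /=.
by apply/mapP => -[r ru r0]; move/allP/(_ r ru): pu; rewrite -r0.
Qed.

Definition Ql (u : seq nat) (i : nat) : nat := sumn [seq minn i b | b <- u].

Lemma QE (x : rc) a i : Q x a i = Ql (lens (nu x a)) i.
Proof. by rewrite /Q /Ql /lens -map_comp. Qed.

Lemma Ql0 u : Ql u 0 = 0.
Proof. by rewrite /Ql; elim: u => //= b u ->; rewrite min0n. Qed.

Lemma Ql_colh u i : Ql u i.+1 = Ql u i + colh u i.+1.
Proof. rewrite /Ql /colh; elim: u => //= b u ->; lia. Qed.

Lemma colhS u i : colh u i = colh u i.+1 + count_mem i u.
Proof. rewrite /colh; elim: u => //= b u ->. lia. Qed.

Lemma colh_homo u i j : i <= j -> colh u j <= colh u i.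
Proof. by move=> ij; apply: sub_count => b /=; lia. Qed.

Lemma colh_le u i : colh u i <= size u.
Proof. exact: count_size. Qed.

(** [Ql] has the column heights as slopes, so its second difference is minus the number of rows that
    end in the middle column. *)
Lemma Ql_sndiff u i : Ql u i + Ql u i.+2 + count_mem i.+1 u = 2 * Ql u i.+1.
Proof. rewrite !Ql_colh (colhS u i.+1); lia. Qed.

Lemma Ql_le u i : Ql u i <= sumn u.
Proof. by rewrite /Ql; elim: u => //= b u; lia. Qed.

Lemma Ql_ge u i : (forall b, b \in u -> b <= i) -> Ql u i = sumn u.
Proof.
rewrite /Ql; elim: u => //= b u IH h; rewrite IH; last by move=> c cu; apply: h; rewrite inE cu orbT.
by have := h b (mem_head _ _); lia.
Qed.

Lemma Ql_perm u v i : perm_eq u v -> Ql u i = Ql v i.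
Proof. by move=> uv; rewrite /Ql; apply/perm_sumn/perm_map. Qed.

Lemma Q_sndiff (x : rc) a i :
  Q x a i + Q x a i.+2 + count_mem i.+1 (lens (nu x a)) = 2 * Q x a i.+1.
Proof. by rewrite !QE Ql_sndiff. Qed.

Lemma mem_lens_le_sumn (u : seq nat) b : b \in u -> b <= sumn u.
Proof.
elim: u => //= c u IH; rewrite inE => /orP[/eqP ->|/IH]; first exact: leq_addr.
move=> h; exact: leq_trans h (leq_addl _ _).
Qed.

Lemma Q_large (x : rc) a i : nusize x a <= i -> Q x a i = nusize x a.
Proof.
rewrite QE /nusize => h; apply: Ql_ge => b bu; exact: leq_trans (mem_lens_le_sumn bu) h.
Qed.

Lemma geq_trans : transitive geq.
Proof. by move=> a b c /=; lia. Qed.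

(** Second differences recover all multiplicities, so shapes can be identified by their Q
    functions. *)
Lemma Ql_inj u v : is_part u -> is_part v -> (forall i, Ql u i = Ql v i) -> u = v.
Proof.
move=> /andP[su zu] /andP[sv zv] h.
apply: (sorted_eq geq_trans) => //; first by move=> a b /=; lia.
rewrite /perm_eq; apply/allP => -[|i] _.
  by apply/eqP; rewrite /= (count_memPn zu) (count_memPn zv).
apply/eqP; have := Ql_sndiff u i; have := Ql_sndiff v i; rewrite !h.
by move=> <- /addnI.
Qed.

Lemma part_nonincr u a : is_part u -> 0 < a -> part u a.+1 <= part u a.
Proof.
move=> /andP[su _]; case: a => // a _; rewrite /part /=.
case: (ltnP a.+1 (size u)) => h; last by rewrite nth_default.
by move/(sortedP 0)/(_ _ h): su.
Qed.

Lemma part_pos u a : is_part u -> 0 < a -> (0 < part u a) = (a <= size u).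
Proof.
move=> /andP[_ zu]; case: a => // a _; rewrite /part /=.
case: (ltnP a (size u)) => h; last by rewrite nth_default.
rewrite lt0n; apply: contraNneq zu => <-; exact: mem_nth.
Qed.

Lemma part_eq u v : is_part u -> is_part v ->
  (forall a, 0 < a -> part u a = part v a) -> u = v.
Proof.
move=> pu pv h; have sz : size u = size v.
  apply/eqP; rewrite eqn_leq; apply/andP; split.
    case su : (size u) => [//|m]; rewrite -su -part_pos // ?su // -h // part_pos // su //.
  case su : (size v) => [//|m]; rewrite -su -part_pos // ?su // h // part_pos // su //.
apply: (@eq_from_nth _ 0) => // i _; exact: (h i.+1).
Qed.

Lemma LQ_concave (L : Ldata) a i : LQ L a i + LQ L a i.+2 <= 2 * LQ L a i.+1.
Proof.
rewrite /LQ -big_split big_distrr /=; apply: leq_sum => x _; nia.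
Qed.

Lemma LQ0 (L : Ldata) a : LQ L a 0 = 0.
Proof. by rewrite /LQ big1 // => x _; rewrite min0n muln0. Qed.

(** [Lge L a] minus [Lge L a.+1] is the sum of the i L_i^(a), the value to which [LQ L a]
    increases. *)
Lemma LQ_le (L : Ldata) a i : LQ L a i + Lge L a.+1 <= Lge L a.
Proof.
rewrite [Lge L a]/Lge (bigID (fun x => x.1 == a)) /=; apply: leq_add.
  rewrite /LQ big_mkcond [X in _ <= X]big_mkcond /=; apply: leq_sum => x _.
  case: eqP => [->|_]; last by rewrite andbF.
  by rewrite leqnn /=; nia.
rewrite /Lge big_mkcond [X in _ <= X]big_mkcond /=; apply: leq_sum => x _.
by case: eqP; case: ifP; case: ifP; lia.
Qed.

Lemma LQ_large (L : Ldata) a : exists B, forall i, B <= i -> LQ L a i + Lge L a.+1 = Lge L a.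
Proof.
exists (\max_(x <- finsupp L) x.2) => i hi.
apply/eqP; rewrite eqn_leq LQ_le /=.
rewrite [Lge L a]/Lge (bigID (fun x => x.1 == a)) /=; apply: leq_add.
  rewrite /LQ big_seq_cond [X in _ <= X]big_seq_cond big_mkcond [X in _ <= X]big_mkcond /=.
  apply: leq_sum => x _; case: eqP => [->|_]; last by rewrite !andbF.
  rewrite leqnn !andbT; case: ifP => // xL.
  have : x.2 <= \max_(x <- finsupp L) x.2 by apply: leq_bigmax_seq.
  by nia.
rewrite /Lge big_mkcond [X in _ <= X]big_mkcond /=; apply: leq_sum => x _.
by case: eqP; case: ifP; case: ifP; lia.
Qed.

(** * One step: validity of the smaller and of the larger configuration *)

Section Low.
Variables (A : nat) (L : Ldata).

(* The nodes above [A] only enter through Q^(A): their total is always equal to it. *)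
Definition qq (x : rc) a i : nat := Q x (minn a A) i.

Definition vac (x : rc) a i : int :=
  ((LQ L a i)%:Z + (qq x a.-1 i)%:Z - 2 * (qq x a i)%:Z + (qq x a.+1 i)%:Z)%R.

Definition mm (x : rc) a m : nat := count_mem m (lens (nu x (minn a A))).

(* The box removed at node [a] from a row of length [s a] lies in one of the first
   [i] columns; [k] is the last node of the chain. *)
Definition act (k : nat) (s : nat -> nat) a i : bool :=
  (k <= a) && (s (minn a A) <= i).

(** The chosen rows are singular on both sides, with a common remainder [w], which makes the
    relation usable from either end. Nodes above A are left to [tops]. *)
Record link (k : nat) (s : nat -> nat) (x y : rc) : Prop := Link {
  lk_k : 1 <= k <= A;
  lk_pos : forall a, k <= a <= A -> 0 < s a;
  lk_mono : forall a, k <= a < A -> s a.+1 <= s a;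
  lk_out : forall a, 1 <= a < k -> nu y a = nu x a;
  lk_in : forall a, k <= a <= A -> exists w,
    perm_eq (nu x a) ((s a, vac x a (s a)) :: w) /\
    perm_eq (nu y a) (nz ((s a).-1, vac y a (s a).-1) ++ w) }.

(** Nonnegativity is required at every length, not only at row lengths: the propagation of zeros
    below passes through absent lengths. *)
Definition valid (x : rc) : Prop := forall a, 1 <= a <= A ->
  [/\ is_rpart (nu x a), forall i, (0 <= vac x a i)%R
    & forall r : rrow, r \in nu x a -> (0 <= r.2 <= vac x a r.1)%R].

(* The rows of [x] chosen by the chain are shortest singular ones; in [bwdc], the
   shortened rows of [y] are longest singular ones. *)
Definition fwdc (x : rc) k s : Prop := forall a (r : rrow), 1 <= a <= A -> r \in nu x a ->
  act k s a.+1 r.1 -> ~~ act k s a r.1 -> r.2 != vac x a r.1.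

Definition bwdc (y : rc) k s : Prop := forall a (r : rrow), 1 <= a <= A -> r \in nu y a ->
  act k s a r.1 -> ~~ act k s a.-1 r.1 -> r.2 != vac y a r.1.

(** Singular rows of one length are equal as pairs, so their number is a multiplicity. *)
Definition nsing (x : rc) a m : nat := count_mem (m, vac x a m) (nu x a).

Lemma vac0 x a : vac x a 0 = 0%R.
Proof. by rewrite /vac /qq LQ0 !QE !Ql0; lia. Qed.

Lemma act_mono k s x y a i : link k s x y -> act k s a i -> act k s a.+1 i.
Proof.
case=> /andP[k0 kA] _ mono _ _; rewrite /act => /andP[ka si].
rewrite (leqW ka) /=; apply: leq_trans si.
case: (ltnP a A) => h.
  by rewrite (minn_idPl h); apply: mono; rewrite ka h.
by rewrite (minn_idPr (leqW h)).
Qed.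

Lemma Ql_nz' m j j' i (w : rpart) : 0 < m ->
  Ql (lens ((m, j) :: w)) i = Ql (lens (nz (m.-1, j') ++ w)) i + (m <= i).
Proof. by case: m => // -[|m] _; rewrite /nz /Ql /=; lia. Qed.

Lemma link_Q k s x y a i : link k s x y -> qq x a i = qq y a i + act k s a i.
Proof.
case=> /andP[k0 kA] pos _ out inn; rewrite /qq /act.
case: (leqP k a) => ka.
  have h : k <= minn a A <= A by rewrite leq_min ka kA geq_minr.
  have [w [px py]] := inn _ h; rewrite !QE.
  rewrite (Ql_perm i (perm_map _ px)) (Ql_perm i (perm_map _ py)).
  exact: Ql_nz' (pos _ h).
case: a ka => [|a] ka; first by rewrite min0n addn0.
by rewrite !QE out ?addn0 // leq_min /= (leq_ltn_trans _ ka) ?geq_minl //=; lia.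
Qed.

(** The change is minus the second difference in a of a 0/1 function that is monotone in a, hence
    nonzero only next to its jump. *)
Lemma link_vac k s x y a i : link k s x y ->
  (vac y a i = vac x a i - (act k s a.+1 i)%:Z + 2 * (act k s a i)%:Z
              - (act k s a.-1 i)%:Z)%R.
Proof.
move=> lk; rewrite /vac !(link_Q _ _ lk); lia.
Qed.

Lemma qq_snd x a i : qq x a i + qq x a i.+2 + mm x a i.+1 = 2 * qq x a i.+1.
Proof. exact: Q_sndiff. Qed.

(** Termwise: [LQ] is concave, and second differences of Q are minus multiplicities. Thus [vac] is
    concave at lengths absent from node a, with a defect of at least the rows of the two
    neighbours. *)
Lemma vac_snd x a i : (vac x a i + vac x a i.+2 + (mm x a.-1 i.+1)%:Z + (mm x a.+1 i.+1)%:Z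
  <= 2 * vac x a i.+1 + 2 * (mm x a i.+1)%:Z)%R.
Proof.
rewrite /vac; have := LQ_concave L a i.
have := qq_snd x a i; have := qq_snd x a.+1 i; have := qq_snd x a.-1 i; lia.
Qed.

(** With value and multiplicity zero on the right of [vac_snd], the four nonnegative terms on its
    left vanish. *)
Lemma vac_flat x a i : valid x -> 1 <= a <= A -> vac x a i.+1 = 0%R -> mm x a i.+1 = 0 ->
  [/\ vac x a i = 0%R, vac x a i.+2 = 0%R, mm x a.-1 i.+1 = 0 & mm x a.+1 i.+1 = 0].
Proof.
move=> vx ha v0 m0; have := vac_snd x a i; rewrite v0 m0.
have [_ p _] := vx a ha; have := p i; have := p i.+2; split; lia.
Qed.

Lemma mm_lens x a m : a <= A -> (mm x a m == 0) = (m \notin lens (nu x a)).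
Proof. by move=> h; rewrite /mm (minn_idPl h) -has_pred1 has_count lt0n negbK. Qed.

Lemma mm_row x a r : a <= A -> r \in nu x a -> mm x a r.1 != 0.
Proof. by move=> h hr; rewrite mm_lens // negbK map_f. Qed.

Lemma row_mm x a m : a <= A -> mm x a m != 0 -> exists2 r, r \in nu x a & r.1 = m.
Proof. by move=> h; rewrite mm_lens // negbK => /mapP[r hr ->]; exists r. Qed.

(** Where the vacancy number is 0 every rigging is 0, so any row of that length would be
    singular. *)
Lemma no_row x a i : valid x -> 1 <= a <= A -> vac x a i = 0%R ->
  (forall r : rrow, r \in nu x a -> r.1 = i -> r.2 != vac x a r.1) -> mm x a i = 0.
Proof.
move=> vx ha v0 ns; have [_ _ q] := vx a ha.
apply/eqP/negPn/negP => /row_mm[|r hr r1]; first by lia.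
by have /negP := ns r hr r1; apply; rewrite r1 v0; have := q r hr; rewrite r1 v0 => hh; apply/eqP; lia.
Qed.

(** A zero at i.+1 meets no row of node a, since rows in this range are nonsingular; by [vac_flat]
    it spreads to i and excludes a row of length i.+1 at node a.+1. Moving left it reaches [s a.+1],
    where node a.+1 does have a row. *)
Lemma fwd_pos k s x y a i : link k s x y -> valid x -> fwdc x k s -> 1 <= a <= A ->
  act k s a.+1 i -> ~~ act k s a i -> (1 <= vac x a i)%R.
Proof.
move=> lk vx fw ha; elim: i => [|i IH] h1 h0.
  move: h1; rewrite /act leqn0 => /andP[ka /eqP s0]; have /andP[_ kA] := lk_k lk.
  by have := lk_pos lk (a := minn a.+1 A); rewrite s0 leq_min ka kA geq_minr => /(_ isT).
have [_ p q] := vx a ha; have := p i.+1; case: (ltrP 0 (vac x a i.+1)); first by lia.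
move=> le0 ge0; have v0 : vac x a i.+1 = 0%R by lia.
have aA : a < A.
  rewrite ltnNge; apply/negP => Aa; move: h1 h0; rewrite /act.
  have -> : a = A by lia.
  by case/andP: (lk_k lk) => _ kA; rewrite kA minnn (minn_idPr (leqnSn A)) (leqW kA) /= => ->.
have m0 : mm x a i.+1 = 0.
  by apply: (no_row vx ha v0) => r hr r1; apply: fw; rewrite ?r1.
have [vi _ _ ma] := vac_flat vx ha v0 m0.
case: (eqVneq (s a.+1) i.+1) => [si|si].
  have := lk_in lk (a := a.+1); case/andP: h1 => -> _; case=> // w [px _].
  have := @mm_row x a.+1 (s a.+1, vac x a.+1 (s a.+1)) aA.
  by rewrite (perm_mem px) mem_head si ma => /(_ isT).
have h1' : act k s a.+1 i by move: h1; rewrite /act (minn_idPl aA) => /andP[->] /=; lia.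
have h0' : ~~ act k s a i by move: h0; rewrite /act !negb_and => /orP[->//|]; lia.
by have := IH h1' h0'; rewrite vi.
Qed.

Lemma nz_mem r t : t \in nz r -> t = r.
Proof. by rewrite /nz; case: eqP => // h; rewrite inE => /eqP. Qed.

(* An unchanged row loses at most one unit of vacancy, and only when the
   choice of shortest singular rows makes it nonsingular. *)
Lemma fwd_valid k s x y : link k s x y -> (forall a, 1 <= a <= A -> is_rpart (nu y a)) ->
  valid x -> fwdc x k s -> valid y /\ bwdc y k s.
Proof.
move=> lk ry vx fw.
have vge a i : 1 <= a <= A -> (0 <= vac y a i)%R.
  move=> ha; have [_ p _] := vx a ha; have := p i; rewrite (link_vac _ _ lk).
  have := fwd_pos lk vx fw ha (i := i).
  have := @act_mono _ _ _ _ a i lk; have := @act_mono _ _ _ _ a.-1 i lk.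
  rewrite prednK; last by case/andP: ha.
  case: (act k s a i); case: (act k s a.+1 i); case: (act k s a.-1 i) => /= h1 h2 h3 h4;
    try (by have := h1 isT); try (by have := h2 isT); try (have := h3 isT isT); lia.
have old a (r : rrow) : 1 <= a <= A -> r \in nu x a ->
   (r.2 <= vac y a r.1)%R /\ (act k s a r.1 -> ~~ act k s a.-1 r.1 -> r.2 != vac y a r.1).
  move=> ha hr; have [_ _ /(_ r hr)] := vx a ha; rewrite (link_vac _ _ lk).
  have := fw a r ha hr.
  have := @act_mono _ _ _ _ a r.1 lk; have := @act_mono _ _ _ _ a.-1 r.1 lk.
  rewrite prednK; last by case/andP: ha.
  case: (act k s a r.1); case: (act k s a.+1 r.1); case: (act k s a.-1 r.1) => /= h1 h2 h3 h4;
    try (by have := h1 isT); try (by have := h2 isT); try (have := h3 isT isT); split=> //; lia.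
have spl a (r : rrow) : 1 <= a <= A -> r \in nu y a ->
    r \in nu x a \/ k <= a /\ r = ((s a).-1, vac y a (s a).-1).
  move=> ha; case: (ltnP a k) => ka hr; first by left; rewrite -(lk_out lk) //; lia.
  have [|w [px py]] := lk_in lk (a := a); first by lia.
  move: hr; rewrite (perm_mem py) mem_cat => /orP[/nz_mem ->|rw]; first by right.
  by left; rewrite (perm_mem px) inE rw orbT.
split.
  move=> a ha; split; [exact: ry | by move=> i; exact: vge |].
  move=> r hr; case: (spl a r ha hr) => [rx|[ka ->]] /=; last by rewrite vge // lexx.
  have [h _] := old a r ha rx; have [_ _ /(_ r rx)/andP[-> _]] := vx a ha; rewrite h; done.
move=> a r ha hr a1 a0; case: (spl a r ha hr) => [rx|[ka rE]].
  by have [_ ->] := old a r ha rx.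
have aA : a <= A by lia.
have := lk_pos lk (a := a) ltac:(lia); move: a1; rewrite /act rE /= (minn_idPl aA); lia.
Qed.

(** Mirror image of [fwd_pos]: a zero spreads to the right until the row of [y] shortened at node
    a.-1. For a = k the range has no right end, whence the assumption of positive values at all
    large lengths. *)
Lemma bwd_pos k s x y a i : link k s x y -> valid y -> bwdc y k s -> 1 <= a <= A ->
  (exists B, forall i, B <= i -> (1 <= vac y k i)%R) ->
  act k s a i -> ~~ act k s a.-1 i -> (1 <= vac y a i)%R.
Proof.
move=> lk vy bw ha [B hB]; have aA : a <= A by lia.
(* [d] is the distance from j to the right end: [B] for a = k, otherwise the length of the shortened
   row at node a.-1. *)
have base d j : j + d = (if a == k then B else (s a.-1).-1) -> act k s a j -> ~~ act k s a.-1 j ->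
    (1 <= vac y a j)%R.
  elim: d j => [|d IH] j.
    rewrite addn0; case: eqP => [-> jB _ _|ak jE h1 h0]; first by apply: hB; rewrite jB.
    have [_ p q] := vy a ha; have := p j; case: (ltrP 0 (vac y a j)); first by lia.
    move=> le0 ge0; have v0 : vac y a j = 0%R by lia.
    have m0 : mm y a j = 0.
      by apply: (no_row vy ha v0) => r hr r1; apply: bw; rewrite ?r1.
    have ka : k <= a.-1 <= A by case/andP: h1; lia.
    have sp := lk_pos lk (a := a) _; have [w [_ py]] := lk_in lk ka.
    have jp : 0 < j.
    by move: h1; rewrite /act (minn_idPl aA) => /andP[? ]; have := sp ltac:(lia); lia.
    case: j jp jE v0 m0 {le0 ge0 h1 h0} => // j _ jE v0 m0.
    have [_ _ ma _] := vac_flat vy ha v0 m0.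
    have := @mm_row y a.-1 ((s a.-1).-1, vac y a.-1 (s a.-1).-1).
    by rewrite (perm_mem py) /nz mem_cat /= -jE /= mem_head /= ma => /(_ ltac:(lia) isT).
  move=> jE h1 h0.
  have [_ p q] := vy a ha; have := p j; case: (ltrP 0 (vac y a j)); first by lia.
  move=> le0 ge0; have v0 : vac y a j = 0%R by lia.
  have m0 : mm y a j = 0.
    by apply: (no_row vy ha v0) => r hr r1; apply: bw; rewrite ?r1.
  have sp := lk_pos lk (a := a) _.
  have jp : 0 < j.
    by move: h1; rewrite /act (minn_idPl aA) => /andP[? ]; have := sp ltac:(lia); lia.
  case: j jp jE v0 m0 {le0 ge0} h1 h0 => // j _ jE v0 m0 h1 h0.
  have [_ vj _ _] := vac_flat vy ha v0 m0.
  suff : (1 <= vac y a j.+2)%R by rewrite vj.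
  apply: IH; first by rewrite -jE; lia.
    by move: h1; rewrite /act => /andP[->] /=; lia.
  move: h0 jE; rewrite /act; case: eqP => [->|ak]; first by case/andP: (lk_k lk); lia.
  move=> h0 jE; move: h1; rewrite /act => /andP[ka _].
  have e : minn a.-1 A = a.-1 by lia.
  rewrite e in h0 *; lia.
move=> h1 h0.
case: (leqP i (if a == k then B else (s a.-1).-1)) => hi.
  by apply: (base ((if a == k then B else (s a.-1).-1) - i)) => //; rewrite subnKC.
move: hi; case: eqP => [->|ak] hi; first by apply: hB; lia.
move: h0 h1; rewrite /act => h0 /andP[ka _]; move: h0.
have -> : minn a.-1 A = a.-1 by lia.
lia.
Qed.

(** For large i the vacancy number at k is a difference of consecutive parts of the weight (the part
    itself for k = A), so the assumption on [B] says that row k of the weight can lose a box. *)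
Lemma bwd_valid k s x y : link k s x y -> (forall a, 1 <= a <= A -> is_rpart (nu x a)) ->
  valid y -> bwdc y k s -> (exists B, forall i, B <= i -> (1 <= vac y k i)%R) ->
  valid x /\ fwdc x k s.
Proof.
move=> lk rx vy bw hB.
have lv a i : vac x a i = (vac y a i + (act k s a.+1 i)%:Z - 2 * (act k s a i)%:Z
              + (act k s a.-1 i)%:Z)%R by rewrite (link_vac a i lk); lia.
have vge a i : 1 <= a <= A -> (0 <= vac x a i)%R.
  move=> ha; have [_ p _] := vy a ha; have := p i; rewrite lv.
  have := bwd_pos lk vy bw ha hB (i := i).
  have := @act_mono _ _ _ _ a i lk; have := @act_mono _ _ _ _ a.-1 i lk.
  rewrite prednK; last by case/andP: ha.
  case: (act k s a i); case: (act k s a.+1 i); case: (act k s a.-1 i) => /= h1 h2 h3 h4;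
    try (by have := h1 isT); try (by have := h2 isT); try (have := h3 isT isT); lia.
have old a (r : rrow) : 1 <= a <= A -> r \in nu y a ->
   (r.2 <= vac x a r.1)%R /\ (act k s a.+1 r.1 -> ~~ act k s a r.1 -> r.2 != vac x a r.1).
  move=> ha hr; have [_ _ /(_ r hr)] := vy a ha; rewrite lv.
  have := bw a r ha hr.
  have := @act_mono _ _ _ _ a r.1 lk; have := @act_mono _ _ _ _ a.-1 r.1 lk.
  rewrite prednK; last by case/andP: ha.
  case: (act k s a r.1); case: (act k s a.+1 r.1); case: (act k s a.-1 r.1) => /= h1 h2 h3 h4;
    try (by have := h1 isT); try (by have := h2 isT); try (have := h3 isT isT); split=> //; lia.
have spl a (r : rrow) : 1 <= a <= A -> r \in nu x a ->
    r \in nu y a \/ k <= a /\ r = (s a, vac x a (s a)).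
  move=> ha; case: (ltnP a k) => ka hr; first by left; rewrite (lk_out lk) //; lia.
  have [|w [px py]] := lk_in lk (a := a); first by lia.
  move: hr; rewrite (perm_mem px) inE => /orP[/eqP ->|rw]; first by right.
  by left; rewrite (perm_mem py) mem_cat rw orbT.
split.
  move=> a ha; split; [exact: rx | by move=> i; exact: vge |].
  move=> r hr; case: (spl a r ha hr) => [ry|[ka ->]] /=; last by rewrite vge // lexx.
  have [h _] := old a r ha ry; have [_ _ /(_ r ry)/andP[-> _]] := vy a ha; rewrite h; done.
move=> a r ha hr a1 a0; case: (spl a r ha hr) => [ry|[ka rE]].
  by have [_ ->] := old a r ha ry.
have aA : a <= A by lia.
by move: a0; rewrite /act rE /= (minn_idPl aA) ka leqnn.
Qed.
End Low.

(** * The last nodes and the concrete operators *)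

Lemma nu_put (x : rc) a y b : 0 < a -> nu (put x a y) b = if b == a then y else nu x b.
Proof.
case: a => // a _; case: b => [|b] //=.
by rewrite /put nth_set_nth /= eqSS.
Qed.

Lemma size_put (x : rc) a y : 0 < a <= size x -> size (put x a y) = size x.
Proof. by move=> h; rewrite /put size_set_nth; apply/maxn_idPr; lia. Qed.

Lemma replace_rowsE (nodes : seq nat) rw f (x : rc) : uniq nodes ->
  all (fun a => 0 < a <= size x) nodes ->
  let y := replace_rows [seq (a, rw a) | a <- nodes] f x in
  size y = size x /\ forall b, nu y b =
    if b \in nodes then rnorm (f b (rw b) :: rem (rw b) (nu x b)) else nu x b.
Proof.
rewrite /replace_rows; elim: nodes x => //= a nodes IH x /andP[an un] /andP[ha hn].
have := IH (put x a (rnorm (f a (rw a) :: rem (rw a) (nu x a)))) un.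
rewrite size_put // => /(_ hn) [-> h]; split=> // b; rewrite h inE.
have [a0 _] := andP ha.
case: (eqVneq b a) => [->|ba] /=; first by rewrite (negbTE an) nu_put // eqxx.
by rewrite nu_put // (negbTE ba).
Qed.

Lemma vacancy_Q k n L (x y : rc) a i : (forall b i, Q x b i = Q y b i) ->
  vacancy k n L x a i = vacancy k n L y a i.
Proof. by move=> h; case: k => [[]|]; rewrite /vacancy !h. Qed.

Lemma Ql_pos u i : Ql [seq b <- u | 0 < b] i = Ql u i.
Proof. by rewrite /Ql; elim: u => //= -[|b] u /= <-; rewrite ?minn0. Qed.

Lemma Ql_rnorm (u : rpart) i : Ql (lens (rnorm u)) i = Ql (lens u) i.
Proof.
rewrite (Ql_perm i (perm_map _ (perm_rnorm u))) -[RHS]Ql_pos /lens filter_map.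
by [].
Qed.

(** Vacancy numbers depend on lengths only, so those of the intermediate configuration are those of
    the result; hence [y] may occur on both sides. *)
Lemma change_rowsE k n L g (nodes : seq nat) rw (x : rc) : uniq nodes ->
  all (fun a => 0 < a <= size x) nodes ->
  let y := change_rows k n L g [seq (a, rw a) | a <- nodes] x in
  size y = size x /\ forall b, nu y b =
    if b \in nodes then rnorm ((g (rw b).1, vacancy k n L y b (g (rw b).1)) :: rem (rw b) (nu x b))
    else nu x b.
Proof.
move=> un hn; rewrite /change_rows /=.
set y0 := replace_rows _ (fun _ r => (g r.1, 0%R)) x.
set y := replace_rows _ _ x.
have [sy0 h0] := replace_rowsE rw (fun _ r => (g r.1, 0%R)) un hn.
have [sy h1] := replace_rowsE rw (fun a r => (g r.1, vacancy k n L y0 a (g r.1))) un hn.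
rewrite -/y0 -/y in sy0 h0 sy h1; split=> // b; rewrite h1; case: ifP => // bn.
rewrite (@vacancy_Q _ _ _ y y0) // => c i; rewrite !QE h1 h0; case: ifP => // cn.
by rewrite !Ql_rnorm.
Qed.

Lemma rord_refl r : rord r r.
Proof. by rewrite /rord; lia. Qed.

Lemma rord_head (u : rpart) (h : rrow) v (t : rrow) : sorted rord u -> u = h :: v -> t \in u -> rord h t.
Proof.
move=> su uE; rewrite uE inE => /orP[/eqP ->|tv]; first exact: rord_refl.
move: su; rewrite uE /= => /(order_path_min rord_trans)/allP; exact.
Qed.

Lemma rord_last (u : rpart) (h : rrow) v (t : rrow) : sorted rord u -> rev u = h :: v -> t \in u -> rord t h.
Proof.
move=> su uE; rewrite -mem_rev uE inE => /orP[/eqP ->|tv]; first exact: rord_refl.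
move: su; rewrite -rev_sorted uE /= => su.
have tr : transitive (fun y x => rord x y) by move=> a b c h1 h2; exact: rord_trans h2 h1.
by have /allP/(_ t tv) := order_path_min tr su.
Qed.

(** [rord] lists longer rows first and, within one length, larger riggings first. *)
Lemma ohead_longest (u : rpart) (p : pred rrow) (t : rrow) : sorted rord u -> t \in u -> p t ->
  (forall r : rrow, r \in u -> p r -> r.1 <= t.1) -> (forall r : rrow, r \in u -> p r -> r.1 = t.1 -> (r.2 <= t.2)%R) ->
  ohead [seq r <- u | p r] = Some t.
Proof.
move=> su tu pt h1 h2; have sf := sorted_filter rord_trans p su.
have tf : t \in [seq r <- u | p r] by rewrite mem_filter pt.
case fE : [seq r <- u | p r] => [|h v]; first by rewrite fE in tf.
have := rord_head sf fE tf; have : h \in [seq r <- u | p r] by rewrite fE mem_head.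
rewrite mem_filter => /andP[ph hu] /=; have := h1 h hu ph; have := h2 h hu ph.
move: h t {tu pt h1 h2 tf fE hu ph} => [a b] [c e]; rewrite /rord /= => h2 h1 h3.
have ac : a = c by lia.
have := h2 ac; rewrite ac => h4; congr (Some (_, _)); lia.
Qed.

Lemma ohead_shortest (u : rpart) (p : pred rrow) (t : rrow) : sorted rord u -> t \in u -> p t ->
  (forall r : rrow, r \in u -> p r -> t.1 <= r.1) -> (forall r : rrow, r \in u -> p r -> r.1 = t.1 -> r = t) ->
  ohead (rev [seq r <- u | p r]) = Some t.
Proof.
move=> su tu pt h1 h2; have sf := sorted_filter rord_trans p su.
have tf : t \in [seq r <- u | p r] by rewrite mem_filter pt.
case fE : (rev [seq r <- u | p r]) => [|h v]; first by rewrite -mem_rev fE in tf.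
have := rord_last sf fE tf; have : h \in [seq r <- u | p r] by rewrite -mem_rev fE mem_head.
rewrite mem_filter => /andP[ph hu] /= th; congr Some; apply: h2 => //.
by have := h1 h hu ph; move: th; rewrite /rord; lia.
Qed.

Lemma head_ohead (T : Type) (x0 : T) s : head x0 s = odflt x0 (ohead s).
Proof. by case: s. Qed.

Lemma is_rpart_zero u : is_rpart u -> is_rpart (zero_riggings u).
Proof.
case/andP => su pu; apply/andP; split; last by rewrite all_map; exact: pu.
by rewrite sorted_map; apply: sub_sorted su => r s; rewrite /rord /=; lia.
Qed.

Lemma lens_zero u : lens (zero_riggings u) = lens u.
Proof. by rewrite /lens -map_comp. Qed.

Lemma LQ_eq0 (L : Ldata) a i : (forall j, L (a, j) = 0) -> LQ L a i = 0.
Proof.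
move=> h; rewrite /LQ big1 // => -[b j] /eqP /= ->; by rewrite h.
Qed.

(** * Configurations at the nodes above A *)

Section Delta.
Variables (d : domino) (n : nat) (L : Ldata).
Local Notation A := (anode d n).
Hypothesis Lok : L_ok (Some d) n L.

Definition zr (u : rpart) : Prop := is_rpart u /\ forall r : rrow, r \in u -> r.2 = 0%R.

(** For vertical dominoes the two last nodes are served alternately; the Boolean will be computed
    from the parity of |nu^(A)|. *)
Definition topnode (e : bool) : nat := if d is Vdom then (if e then n else n.-1) else n.

(* For vertical dominoes the columns of nu^(A) are halved between the two last
   nodes; an odd number of steps leaves one box too many in column [j] of the
   last one. *)
Definition topsQ (j : nat) (x : rc) : Prop :=
  size x = n /\
  match d with
  | Vdom => (forall i, Q x n.-1 i + Q x n i = Q x n.-2 i) /\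
            forall i, Q x n i = Q x n.-1 i + (odd (nusize x n.-2) && (j <= i))
  | _ => forall i, Q x n i = Q x n.-1 i
  end.

Definition tops (j : nat) (x : rc) : Prop :=
  topsQ j x /\ forall e, zr (nu x (topnode e)).

Definition topQ (x : rc) : Prop :=
  forall i, (if d is Vdom then Q x n.-1 i + Q x n i else Q x n i) = Q x A i.

Lemma topsQ_topQ j x : topsQ j x -> topQ x.
Proof. by rewrite /topsQ /topQ /anode; case: d => -[_] // []. Qed.

Lemma vacancyE x a i : topQ x -> 1 <= a <= A ->
  vacancy (Some d) n L x a i = vac A L x a i.
Proof.
rewrite /topQ /vacancy /vac /qq => tq ha; move: tq Lok ha; case: d => /= tq lo ha.
- have -> : a == n = false by lia.
  have [-> ->] : minn a n.-1 = a /\ minn a.-1 n.-1 = a.-1 by lia.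
  case: (eqVneq a n.-1) => [->|an]; last by have -> : minn a.+1 n.-1 = a.+1 by lia.
  have [-> ->] : minn n.-1.+1 n.-1 = n.-1 /\ n.-1.+1 = n by lia.
  by rewrite tq.
- have -> : a == n = false by lia.
  have [-> ->] : minn a n.-1 = a /\ minn a.-1 n.-1 = a.-1 by lia.
  case: (eqVneq a n.-1) => [->|an]; last by have -> : minn a.+1 n.-1 = a.+1 by lia.
  have [-> ->] : minn n.-1.+1 n.-1 = n.-1 /\ n.-1.+1 = n by lia.
  by rewrite tq.
have [-> ->] : (a == n) = false /\ (a == n.-1) = false by lia.
have [-> ->] : minn a n.-2 = a /\ minn a.-1 n.-2 = a.-1 by lia.
case: (eqVneq a n.-2) => [->|an]; last by have -> : minn a.+1 n.-2 = a.+1 by lia.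
have -> : minn n.-2.+1 n.-2 = n.-2 by lia.
(* The formula of [vacancy] at n.-2 contains no L, in agreement with [L_ok], which makes [LQ] vanish
   there. *)
rewrite LQ_eq0; first by rewrite -tq; lia.
move=> j; apply/eqP/negPn/negP => /lo[_ _]; lia.
Qed.

Lemma tops_size j x : d = Vdom -> topsQ j x -> nusize x n = nusize x n.-1 + odd (nusize x n.-2).
Proof.
rewrite /topsQ => -> [_ [_ h]].
have := h (j + nusize x n + nusize x n.-1); rewrite !Q_large; [|lia|lia].
by move=> ->; congr (_ + _); case: odd => //=; lia.
Qed.

Lemma delta_endE j x : topsQ j x -> delta_end d n x = Some (topnode (odd (nusize x A))).
Proof.
move=> t; have := @tops_size j x; rewrite /delta_end /topnode /anode; move: t; case: d => // t /(_ erefl t) ->.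
by case: odd; rewrite /= ?addn0 ?addn1 ?eqxx ?ltnSn //; case: eqP => //; lia.
Qed.

Lemma tdelta_endE j x : topsQ j x -> tdelta_end d n x = Some (topnode (~~ odd (nusize x A))).
Proof.
move=> t; have := @tops_size j x; rewrite /tdelta_end /topnode /anode; move: t; case: d => // t /(_ erefl t) ->.
by case: odd; rewrite /= ?addn0 ?addn1 ?eqxx ?ltnSn //; case: eqP => //; lia.
Qed.

Lemma topnode_gt e : 1 <= A -> A < topnode e <= n.
Proof. by rewrite /topnode /anode; case: d; case: e; lia. Qed.

Lemma zr_row u m : zr u -> m \in lens u -> (m, 0%R) \in u.
Proof. by case=> _ h /mapP[[a b] hr ->] /=; have /= e := h _ hr; rewrite e in hr. Qed.

Lemma zr_ohead u m : zr u -> m \in lens u -> ohead [seq r <- u | r.1 == m] = Some (m, 0%R).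
Proof.
move=> zu mu; have h := zr_row zu mu; case: zu => /andP[su _] z.
apply: ohead_longest => //; first by move=> r _ /eqP ->.
by move=> r ru _ _; rewrite z.
Qed.

Lemma count_lens (x : rc) a m : m \in lens (nu x a) = (0 < count_mem m (lens (nu x a))).
Proof. by rewrite -has_count has_pred1. Qed.

(** Second differences of the relations in [topsQ]: for vertical dominoes the multiplicities of j at
    the last nodes agree in the even case, and node n has one row more in the odd case. *)
Lemma top_row_fwd j x : 1 <= A -> topsQ j x -> 0 < j -> j \in lens (nu x A) ->
  j \in lens (nu x (topnode (odd (nusize x A)))).
Proof.
case: j => // i A1; rewrite /topsQ /topnode /anode !count_lens; case: d => -[_ h] _.
- have := Q_sndiff x n i; have := Q_sndiff x n.-1 i; rewrite !h; lia.
- have := Q_sndiff x n i; have := Q_sndiff x n.-1 i; rewrite !h; lia.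
case: h => h1 h2.
have := Q_sndiff x n i; have := Q_sndiff x n.-1 i; have := Q_sndiff x n.-2 i.
rewrite -!h1 !h2 ltnn leqnn leqnSn; case: odd => /=; lia.
Qed.

(** The threshold j.+1 puts the odd box into the next column, so in the odd case node n.-1 now has
    one row of length j more than node n. *)
Lemma top_row_bwd j x : 1 <= A -> topsQ j.+1 x -> 0 < j -> j \in lens (nu x A) ->
  j \in lens (nu x (topnode (~~ odd (nusize x A)))).
Proof.
case: j => // i A1; rewrite /topsQ /topnode /anode !count_lens; case: d => -[_ h] _.
- have := Q_sndiff x n i; have := Q_sndiff x n.-1 i; rewrite !h; lia.
- have := Q_sndiff x n i; have := Q_sndiff x n.-1 i; rewrite !h; lia.
case: h => h1 h2.
have := Q_sndiff x n i; have := Q_sndiff x n.-1 i; have := Q_sndiff x n.-2 i.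
rewrite -!h1 !h2 !ltnS ltnn leqnn; have -> : i.+1 < i = false by lia.
by case: odd => /=; lia.
Qed.

End Delta.

Arguments vacancy : simpl never.

Section Delta.
Variables (d : domino) (n : nat) (L : Ldata).
Local Notation A := (anode d n).
Hypothesis Lok : L_ok (Some d) n L.
Local Notation vac := (vac A L).
Local Notation valid := (valid A L).
Local Notation fwdc := (fwdc A L).
Local Notation bwdc := (bwdc A L).
Local Notation link := (link A L).
Local Notation tops := (tops d n).
Local Notation topsQ := (topsQ d n).

Record fchain (x : rc) (k : nat) (s : nat -> nat) : Prop := FChain {
  fc_k : 1 <= k <= A;
  fc_pos : forall a, k <= a <= A -> 0 < s a;
  fc_mono : forall a, k <= a < A -> s a.+1 <= s a;
  fc_in : forall a, k <= a <= A -> (s a, vac x a (s a)) \in nu x a;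
  fc_fwd : fwdc x k s }.

(** As in [fchain], [s] gives lengths in the larger configuration: a chosen row of [y] has length
    [(s a).-1], and is a row still to be created when this is 0. *)
Record bchain (y : rc) (k : nat) (s : nat -> nat) : Prop := BChain {
  bc_k : 1 <= k <= A;
  bc_pos : forall a, k <= a <= A -> 0 < s a;
  bc_mono : forall a, k <= a < A -> s a.+1 <= s a;
  bc_in : forall a, k <= a <= A -> 1 < s a -> ((s a).-1, vac y a (s a).-1) \in nu y a;
  bc_bwd : bwdc y k s }.

Lemma chainE x k s c : topQ d n x -> valid x -> fchain x k s -> k + c <= A ->
  chain d n L x (k + c) (s (k + c), vac x (k + c) (s (k + c))) =
  [seq (b, (s b, vac x b (s b))) | b <- rev (iota k c.+1)].
Proof.
move=> tx vx [kA pos mono inn fw].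
elim: c => [|c IH] h.
  rewrite addn0; case: k kA pos mono inn fw {h} => [|a] //= aA pos mono inn fw.
  have -> : shortest_singular d n L x a (s a.+1) = None.
    rewrite /shortest_singular; case fE : [seq r <- nu x a | _] => [//|r f].
    have : r \in [seq r <- nu x a | (s a.+1 <= r.1) && singular (Some d) n L x a r].
      by rewrite fE mem_head.
    rewrite mem_filter => /andP[/andP[sr sg] rx].
    have a0 : 0 < a by case: (a) rx.
    have ha : 1 <= a <= A by lia.
    have := fw a r ha rx; rewrite /act leqnn (minn_idPl aA) sr ltnn => /(_ isT isT).
    by move: sg; rewrite /singular vacancyE // => ->.
  by [].
rewrite addnS [LHS]/=.
have ha : 1 <= k + c <= A by lia.
have kc : k <= k + c < A by lia.
have [srt _] := vx _ ha; case/andP: (srt) => so _.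
have -> : shortest_singular d n L x (k + c) (s (k + c).+1) =
          Some (s (k + c), vac x (k + c) (s (k + c))).
  apply: ohead_shortest => //.
  - by apply: inn; lia.
  - by rewrite /= /singular vacancyE // eqxx andbT; apply: mono.
  - move=> r rx /andP[sr]; rewrite /singular vacancyE // => sg; rewrite leqNgt; apply/negP => rs.
    have := fw _ r ha rx; rewrite /act.
    have -> : minn (k + c).+1 A = (k + c).+1 by lia.
    have -> : minn (k + c) A = k + c by lia.
    rewrite sr leq_addr /= -ltnNge rs /= => hh.
    by move: (hh ltac:(lia) isT); rewrite (eqP sg) eqxx.
  - by move=> [r1 r2] rx /andP[sr]; rewrite /singular vacancyE //= => /eqP -> ->.
rewrite IH; last by lia.
by rewrite -[in RHS](addn1 c.+1) iotaD cats1 rev_rcons /= addnS.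
Qed.

Lemma last_map_rev_iota (T : Type) (f : nat -> T) k c x0 :
  last x0 [seq f b | b <- rev (iota k c.+1)] = f k.
Proof. by rewrite /= rev_cons map_rcons last_rcons. Qed.

Lemma Q_change (x y : rc) a r g w i : perm_eq (nu x a) (r :: w) ->
  perm_eq (nu y a) (nz g ++ w) -> Q y a i + minn i r.1 = Q x a i + minn i g.1.
Proof.
move=> px py; rewrite !QE (Ql_perm i (perm_map _ px)) (Ql_perm i (perm_map _ py)).
by rewrite /nz; case: eqP => /= [->|_]; rewrite /Ql /=; lia.
Qed.

Lemma Q_rnorm_rem (x y : rc) a r g i : is_rpart (nu x a) -> r \in nu x a ->
  nu y a = rnorm (g :: rem r (nu x a)) -> Q y a i + minn i r.1 = Q x a i + minn i g.1.
Proof.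
move=> /andP[_ px] rx yE; apply: Q_change (perm_to_rem rx) _.
rewrite yE; apply: perm_rnorm_cons; by apply/allP => t /mem_rem; move/allP: px; apply.
Qed.

Lemma minn_pred i m : 0 < m -> minn i m = minn i m.-1 + (m <= i).
Proof. by lia. Qed.

(** An equivalence, because [delta] and [tdelta] preserve the same invariant. For vertical dominoes
    the parity of |nu^(A)| flips while a box of column j leaves the node selected by that parity. *)
Lemma topsQ_step j x y : 1 <= A -> size x = n -> size y = n ->
  nusize x A = (nusize y A).+1 ->
  (forall i, Q x A i = Q y A i + (j <= i)) ->
  let b := topnode d n (odd (nusize x A)) in
  (forall i, Q x b i = Q y b i + (j <= i)) ->
  (forall a, A < a <= n -> a != b -> nu y a = nu x a) ->
  topsQ j x <-> topsQ j y.
Proof.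
rewrite /topsQ /topnode /anode => A1 sx sy.
move: A1; case: (d) => /= A1 nsz QA Qb oth.
- by split=> -[_ h]; split=> // i; have := h i; have := QA i; have := Qb i; lia.
- by split=> -[_ h]; split=> // i; have := h i; have := QA i; have := Qb i; lia.
have n1 : n.-1 != n by lia.
have n1' : n != n.-1 by lia.
move: Qb oth; rewrite nsz /=; case: odd => /= Qb oth.
  have eQ i : Q y n i = Q x n i by rewrite !QE oth //; lia.
  split=> -[_ [h1 h2]]; split=> //; split=> i; have := h1 i; have := h2 i;
    have := QA i; have := Qb i; have := eQ i; lia.
have eQ i : Q y n.-1 i = Q x n.-1 i by rewrite !QE oth //; lia.
split=> -[_ [h1 h2]]; split=> //; split=> i; have := h1 i; have := h2 i;
  have := QA i; have := Qb i; have := eQ i; lia.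
Qed.

Lemma nusize_change (x y : rc) a j : (forall i, Q x a i = Q y a i + (j <= i)) ->
  nusize x a = (nusize y a).+1.
Proof.
move=> h; have := h (nusize x a + nusize y a + j).
rewrite !Q_large; [|lia|lia]; lia.
Qed.

(** Below length j the two halves agree even in the odd state, so the changed row, of length j.-1,
    gets rigging 0. In the odd state the vacancy number at n is -1 from length j on. *)
Lemma vacancy_top j y : 1 <= A -> 0 < j -> topsQ j y ->
  vacancy (Some d) n L y (topnode d n (~~ odd (nusize y A))) j.-1 = 0%R.
Proof.
rewrite /topsQ /topnode /vacancy /anode => A1 j0 [sy ty]; move: A1 ty; case: d => /= A1.
- by move=> h; rewrite eqxx h; lia.
- by move=> h; rewrite eqxx h; lia.
case=> h1 h2.
have := h1 j.-1; have := h2 j.-1; have -> : j <= j.-1 = false by lia.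
rewrite andbF.
case: odd => /=; rewrite eqxx; last by lia.
have -> : n.-1 == n = false by lia.
lia.
Qed.

Lemma delta_lift j k s x : tops j x -> valid x -> fchain x k s -> s A = j ->
  exists y, [/\ delta d n L j x = Some (y, k), tops j y, link k s x y
    & forall a, 1 <= a <= A -> is_rpart (nu y a)].
Proof.
case=> tx zx vx fc sA; have [kA pos mono inn fw] := fc.
have A1 : 1 <= A by lia.
have j0 : 0 < j by rewrite -sA; apply: pos; lia.
have AA : k <= A <= A by lia.
have rowA := inn A AA; rewrite sA in rowA.
have [/andP[soA _] _ leA] := vx A ltac:(lia).
rewrite /delta (delta_endE tx).
set b := topnode d n _.
have zb : zr (nu x b) by exact: zx.
have jA : j \in lens (nu x A) by apply/mapP; exists (j, vac x A j).
have jb : j \in lens (nu x b) by apply: top_row_fwd.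
have -> : row_of_length x b j = Some (j, 0%R) by exact: zr_ohead.
(* Among rows of length j the largest rigging comes first, and no rigging exceeds the vacancy
   number: the row found is the singular one. *)
have -> : row_of_length x A j = Some (j, vac x A j).
  apply: ohead_longest => //.
    by move=> r _ /eqP ->.
  by move=> r rx /eqP rj _; have /andP[_] := leA r rx; rewrite rj.
have tq := topsQ_topQ tx.
have kAe : k + (A - k) = A by lia.
have -> : chain d n L x A (j, vac x A j) = [seq (b, (s b, vac x b (s b))) | b <- rev (iota k (A - k).+1)].
  by have := @chainE x k s (A - k) tq vx fc; rewrite kAe sA => ->.
rewrite last_map_rev_iota.
pose rw a : rrow := if a == b then (j, 0%R) else (s a, vac x a (s a)).
have bA := topnode_gt (odd (nusize x A)) A1; rewrite -/b in bA.
pose nodes := b :: rev (iota k (A - k).+1).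
have memn a : a \in nodes = (a == b) || (k <= a <= A).
  by rewrite inE mem_rev mem_iota; congr (_ || _); lia.
have -> : (b, (j, 0%R)) :: [seq (b, (s b, vac x b (s b))) | b <- rev (iota k (A - k).+1)] =
          [seq (a, rw a) | a <- nodes].
  rewrite /nodes map_cons {1}/rw eqxx; congr (_ :: _); apply/eq_in_map => a.
  rewrite mem_rev mem_iota /rw => ha; have -> // : a == b = false by lia.
have un : uniq nodes.
  by rewrite cons_uniq rev_uniq iota_uniq andbT mem_rev mem_iota; lia.
have [sx _] := tx.
have alln : all (fun a => 0 < a <= size x) nodes.
  by apply/allP => a; rewrite memn sx => /orP[/eqP ->|]; lia.
have [sy yE] := change_rowsE (Some d) n L predn rw un alln.
set y := change_rows _ _ _ _ _ _ in sy yE *.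
exists y.
have nb a : k <= a <= A -> (a == b) = false by lia.
have yout a : 1 <= a < k -> nu y a = nu x a.
  by move=> ha; rewrite yE memn; case: ifP => // /orP[/eqP|]; lia.
have yin a : k <= a <= A -> nu y a =
    rnorm (((s a).-1, vacancy (Some d) n L y a (s a).-1) :: rem (s a, vac x a (s a)) (nu x a)).
  by move=> ha; rewrite yE memn ha orbT /rw nb.
have yb : nu y b = rnorm ((j.-1, vacancy (Some d) n L y b j.-1) :: rem (j, 0%R) (nu x b)).
  by rewrite yE memn eqxx /= /rw eqxx.
have Qin a i : k <= a <= A -> Q x a i = Q y a i + (s a <= i).
  move=> ha; have [ra _ _] := vx a ltac:(lia).
  have /= := Q_rnorm_rem i ra (inn a ha) (yin a ha); have := minn_pred i (pos a ha); lia.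
have QA i : Q x A i = Q y A i + (j <= i) by rewrite Qin // sA.
have jrow : (j, 0%R) \in nu x b by exact: zr_row.
have Qb i : Q x b i = Q y b i + (j <= i).
  have /= := Q_rnorm_rem i (proj1 zb) jrow yb; have := minn_pred i j0; lia.
have nsz := nusize_change QA.
have oth a : A < a -> a != b -> nu y a = nu x a.
  by move=> ha /negbTE ab; rewrite yE memn ab /=; case: ifP => //; lia.
have ty : topsQ j y.
  by apply/(topsQ_step A1 sx _ nsz QA Qb) => //; [rewrite sy|move=> a /andP[ha _]; exact: oth].
have vE a i : 1 <= a <= A -> vacancy (Some d) n L y a i = vac y a i.
  by move=> ha; apply: vacancyE => //; exact: topsQ_topQ ty.
have v0 : vacancy (Some d) n L y b j.-1 = 0%R.
  by have := vacancy_top A1 j0 ty; rewrite /b nsz.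
split=> //.
- split=> // e; case: (eqVneq (topnode d n e) b) => [->|eb]; last first.
    by rewrite oth //; case/andP: (topnode_gt (d := d) (n := n) e A1).
  rewrite yb; split; first exact: rnorm_rpart.
  move=> r; rewrite (perm_mem (perm_rnorm _)) mem_filter inE => /andP[_ /orP[/eqP ->|/mem_rem]].
    by rewrite v0.
  by case: zb => _; apply.
- split=> //.
  move=> a ha; exists (rem (s a, vac x a (s a)) (nu x a)); split; first exact/perm_to_rem/inn.
  rewrite yin // vE; last by lia.
  apply: perm_rnorm_cons; have [/andP[_ pa] _ _] := vx a ltac:(lia).
  by apply/allP => t /mem_rem; move/allP: pa; apply.
- move=> a ha; case: (ltnP a k) => ak; first by rewrite yout; [case: (vx a ha)|lia].
  by rewrite yin; [exact: rnorm_rpart|lia].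
Qed.

Lemma tchainE y k s c m : topQ d n y -> valid y -> bchain y k s -> k <= m -> m + c <= A.+1 ->
  tchain d n L y m c (if m == k then None else Some (s m.-1).-1) =
  [seq (b, ((s b).-1, vac y b (s b).-1)) | b <- iota m c].
Proof.
move=> ty vy [kA pos mono inn bw].
elim: c m => [|c IH] m km hm //=.
have ha : 1 <= m <= A by lia.
have kmA : k <= m <= A by lia.
have pm := pos m kmA.
have -> : longest_singular d n L y m (if m == k then None else Some (s m.-1).-1) =
          ((s m).-1, vac y m (s m).-1).
  have [/andP[so po] _ _] := vy m ha.
  have small r : r \in nu y m -> r.2 = vac y m r.1 ->
      (if (if m == k then None else Some (s m.-1).-1) is Some l then r.1 <= l else true) ->
      r.1 <= (s m).-1.
    move=> ry sg hr; rewrite leqNgt; apply/negP => rs.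
    have mA : minn m A = m by lia.
    have sr : s m <= r.1 by lia.
    have := bw m r ha ry; rewrite /act mA sg eqxx km sr /=.
    move=> /(_ isT) hh; have /hh // : ~~ ((k <= m.-1) && (s (minn m.-1 A) <= r.1)).
    have mA' : minn m.-1 A = m.-1 by lia.
    move: hr; rewrite mA'; case: (eqVneq m k) => [->|mk hr]; first by rewrite negb_and; lia.
    by have := pos m.-1 ltac:(lia); lia.
  rewrite /longest_singular head_ohead.
  case: (ltnP 1 (s m)) => s1.
    rewrite (@ohead_longest _ _ ((s m).-1, vac y m (s m).-1)) //.
    - exact: inn.
    - rewrite /= /singular vacancyE //= eqxx andbT; case: eqP => [//|mk].
      have := mono m.-1 ltac:(lia); rewrite prednK; lia.
    - by move=> r ry /andP[h1]; rewrite /singular vacancyE // => /eqP sg; apply: small.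
    - by move=> r ry /andP[h1]; rewrite /singular vacancyE // => /eqP -> -> /=.
  (* No singular row qualifies; the default [(0, 0)] of [longest_singular] is the right row of
     length 0, as [vac] vanishes at length 0. *)
  have -> : (s m).-1 = 0 by lia.
  rewrite vac0; case fE : [seq r <- nu y m | _] => [//|r f].
  set p := (fun r : rrow => _) in fE.
  have : r \in [seq r <- nu y m | p r] by rewrite fE mem_head.
  rewrite mem_filter => /andP[/andP[h1]]; rewrite /singular vacancyE // => /eqP sg ry.
  have r0 : 0 < r.1 := allP po r ry; have r1 : r.1 <= (s m).-1 := small r ry sg h1.
  by exfalso; move: r0 r1 s1; clear; lia.
congr (_ :: _); have := IH m.+1 ltac:(lia) ltac:(lia).
by have -> : m.+1 == k = false by lia.
Qed.

Lemma tdelta_lift j k s y : tops j y -> valid y -> bchain y k s -> s A = j ->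
  exists x, [/\ tdelta d n L k y = Some x, tops j x, link k s x y
    & forall a, 1 <= a <= A -> is_rpart (nu x a)].
Proof.
case=> ty zy vy bc sA; have [kA pos mono inn bw] := bc.
have A1 : 1 <= A by lia.
have j0 : 0 < j by rewrite -sA; apply: pos; lia.
have AA : k <= A <= A by lia.
have tq := topsQ_topQ ty.
rewrite /tdelta kA (tdelta_endE ty).
set b := topnode d n _.
have zb : zr (nu y b) by exact: zy.
have -> : tchain d n L y k (A.+1 - k) None =
    [seq (b, ((s b).-1, vac y b (s b).-1)) | b <- iota k (A.+1 - k)].
  by have := @tchainE y k s (A.+1 - k) k tq vy bc (leqnn k); rewrite eqxx => -> //; lia.
have iE : iota k (A.+1 - k) = rcons (iota k (A - k)) A.
  by rewrite subSn; [rewrite -addn1 iotaD cats1; congr (rcons _ _); lia|lia].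
have -> : (last (0, (0, 0%R)) [seq (b, ((s b).-1, vac y b (s b).-1)) | b <- iota k (A.+1 - k)]).2.1 = j.-1.
  by rewrite iE map_rcons last_rcons /= sA.
have jb : j.-1 != 0 -> j.-1 \in lens (nu y b).
  move=> jn0; apply: top_row_bwd => //; rewrite ?prednK //; last first.
    by apply/mapP; exists (j.-1, vac y A j.-1) => //; rewrite -sA; apply: inn => //; lia.
  lia.
have -> : row_or_new y b j.-1 = Some (j.-1, 0%R).
  by rewrite /row_or_new; case: eqP => [->//|/eqP jn0]; apply: zr_ohead => //; exact: jb.
pose rw a : rrow := if a == b then (j.-1, 0%R) else ((s a).-1, vac y a (s a).-1).
have bA := topnode_gt (~~ odd (nusize y A)) A1; rewrite -/b in bA.
pose nodes := rcons (iota k (A.+1 - k)) b.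
have memn a : a \in nodes = (a == b) || (k <= a <= A).
  by rewrite mem_rcons inE mem_iota; congr (_ || _); lia.
have -> : rcons [seq (b, ((s b).-1, vac y b (s b).-1)) | b <- iota k (A.+1 - k)] (b, (j.-1, 0%R)) =
          [seq (a, rw a) | a <- nodes].
  rewrite /nodes map_rcons {2}/rw eqxx; congr (rcons _ _); apply/eq_in_map => a.
  rewrite mem_iota /rw => ha; have -> // : a == b = false by lia.
have un : uniq nodes by rewrite rcons_uniq iota_uniq andbT mem_iota; lia.
have [sy _] := ty.
have alln : all (fun a => 0 < a <= size y) nodes.
  by apply/allP => a; rewrite memn sy => /orP[/eqP ->|]; lia.
have [sx0 xE0] := change_rowsE (Some d) n L succn rw un alln.
set x0 := change_rows _ _ _ _ _ _ in sx0 xE0 *.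
set x := [seq _ | a <- _].
have xE a : nu x a = if A < a <= n then zero_riggings (nu x0 a) else nu x0 a.
  case: a => [|a] //=; case: (ltnP a n) => an; last first.
    by rewrite andbF !nth_default // ?size_map ?size_iota // sx0 sy.
  by rewrite (nth_map 0) ?size_iota // nth_iota // add1n /= andbT.
have lx a i : Q x0 a i = Q x a i.
  by rewrite !QE xE; case: ifP => // _; rewrite lens_zero.
have Svac a : vacancy (Some d) n L x0 a =1 vacancy (Some d) n L x a.
  by move=> i; apply: vacancy_Q => c l; exact: lx.
have nb a : k <= a <= A -> (a == b) = false by lia.
have xout a : 1 <= a < k -> nu x a = nu y a.
  move=> ha; rewrite xE (_ : A < a <= n = false); last by lia.
  by rewrite xE0 memn; case: ifP => // /orP[/eqP|]; lia.
have xin a : k <= a <= A -> nu x a =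
    rnorm ((s a, vacancy (Some d) n L x a (s a)) :: rem ((s a).-1, vac y a (s a).-1) (nu y a)).
  move=> ha; rewrite xE (_ : A < a <= n = false); last by lia.
  by rewrite xE0 memn ha orbT /rw nb //= prednK ?pos // Svac.
have xb0 : nu x0 b = rnorm ((j, vacancy (Some d) n L x0 b j) :: rem (j.-1, 0%R) (nu y b)).
  by rewrite xE0 memn eqxx /= /rw eqxx prednK.
have xb : nu x b = zero_riggings (nu x0 b) by rewrite xE bA.
have oth a : A < a <= n -> a != b -> nu x a = zero_riggings (nu y a).
  move=> ha /negbTE ab; rewrite xE ha xE0 memn ab /=; case: ifP => //; lia.
have pin a : k <= a <= A ->
    perm_eq (nu y a) (nz ((s a).-1, vac y a (s a).-1) ++ rem ((s a).-1, vac y a (s a).-1) (nu y a)) /\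
    perm_eq (nu x a) ((s a, vacancy (Some d) n L x a (s a)) :: rem ((s a).-1, vac y a (s a).-1) (nu y a)).
  move=> ha; have [/andP[_ pa] _ _] := vy a ltac:(lia); have ps := pos a ha; split.
    rewrite /nz /=; case: eqP => [s0|/eqP s0] /=; last by apply: perm_to_rem; apply: inn => //; lia.
    by rewrite rem_id //; apply/negP => /(allP pa) /=; lia.
  rewrite xin //; apply: (perm_trans (perm_rnorm_cons _ _)).
    by apply/allP => t /mem_rem; move/allP: pa; apply.
  by rewrite /nz /=; case: eqP => //; lia.
have Qin a i : k <= a <= A -> Q x a i = Q y a i + (s a <= i).
  move=> ha; have [p1 p2] := pin a ha; rewrite !QE.
  rewrite (Ql_perm i (perm_map _ p1)) (Ql_perm i (perm_map _ p2)).
  exact: Ql_nz' (pos a ha).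
have QA i : Q x A i = Q y A i + (j <= i) by rewrite Qin // sA.
have Qb i : Q x b i = Q y b i + (j <= i).
  rewrite -lx !QE xb0 Ql_rnorm.
  have pb : perm_eq (nu y b) (nz (j.-1, 0%R) ++ rem (j.-1, 0%R) (nu y b)).
    rewrite /nz /=; case: eqP => [s0|/eqP s0] /=.
      by rewrite rem_id //; case: zb => /andP[_ pb] _; apply/negP => /(allP pb) /=; lia.
    by apply: perm_to_rem; apply: zr_row => //; exact: jb.
  rewrite (Ql_perm i (perm_map _ pb)).
  exact: Ql_nz'.
have nsz := nusize_change QA.
have sx : size x = n by rewrite size_map size_iota.
have zz u : zr u -> zero_riggings u = u.
  by case=> _ h; rewrite -[RHS]map_id; apply/eq_in_map => -[r1 r2] /h /= ->.
have tx : topsQ j x.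
  (* Adding a box flips the parity, so [delta] on [x] selects the same last node. *)
  have bE : b = topnode d n (odd (nusize x A)) by rewrite nsz.
  apply/(topsQ_step A1 sx _ nsz QA); rewrite -?bE // => a ha ab; rewrite oth // zz //.
  have e := zy true; have e' := zy false; move: ha e e'; rewrite /topnode /anode; case: (d) => ha e e'.
  - by have -> : a = n by lia.
  - by have -> : a = n by lia.
  by have [->|->] : a = n \/ a = n.-1 by lia.
have vE a i : 1 <= a <= A -> vacancy (Some d) n L x a i = vac x a i.
  by move=> ha; apply: vacancyE => //; exact: topsQ_topQ tx.
exists x; split=> //.
- split=> // e; case: (eqVneq (topnode d n e) b) => [->|eb]; last first.
    by rewrite oth ?zz //; case/andP: (topnode_gt (d := d) (n := n) e A1) => -> ->.
  rewrite xb xb0; split; first exact/is_rpart_zero/rnorm_rpart.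
  by move=> r /mapP[t _ ->].
- split=> //; first by move=> a ha; rewrite xout.
  by move=> a ha; have [p1 p2] := pin a ha; eexists; split; last exact: p1; rewrite -vE //; lia.
- move=> a ha; case: (ltnP a k) => ak; first by rewrite xout; [case: (vy a ha)|lia].
  by rewrite xin; [exact: rnorm_rpart|lia].
Qed.

End Delta.

(** * Existence and uniqueness of steps *)

Section Chains.
Variables (d : domino) (n : nat) (L : Ldata).
Local Notation A := (anode d n).
Local Notation vac := (vac A L).
Local Notation valid := (valid A L).
Local Notation link := (link A L).
Local Notation fchain := (fchain d n L).
Local Notation bchain := (bchain d n L).

Lemma pick_shortest x a t : (exists2 m, (m, vac x a m) \in nu x a & t <= m) ->
  exists m, [/\ (m, vac x a m) \in nu x a, t <= m &
    forall r : rrow, r \in nu x a -> r.2 = vac x a r.1 -> t <= r.1 -> m <= r.1].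
Proof.
move=> [m0 h0 t0]; pose P m := ((m, vac x a m) \in nu x a) && (t <= m).
have exP : exists m, P m by exists m0; rewrite /P h0.
case: (ex_minnP exP) => m /andP[h1 h2] hm; exists m; split=> // -[r1 r2] /= hr rE tr.
by apply: hm; rewrite /P tr -rE hr.
Qed.

Lemma pick_longest x a t : exists m, [/\ m <= t, 0 < m -> (m, vac x a m) \in nu x a &
    forall r : rrow, r \in nu x a -> r.2 = vac x a r.1 -> r.1 <= t -> r.1 <= m].
Proof.
pose P m := ((m == 0) || ((m, vac x a m) \in nu x a)) && (m <= t).
have exP : exists m, P m by exists 0.
have bP m : P m -> m <= t by case/andP.
case: (ex_maxnP exP bP) => m /andP[h1 h2] hm; exists m; split=> //.
  by move: h1; case: eqP => //; lia.
by move=> -[r1 r2] /= hr rE tr; apply: hm; rewrite /P tr -rE hr orbT.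
Qed.

(** Greedy descent from node A, stopped at the first node without a long enough singular row. *)
Lemma fchain_ex x j : valid x -> 1 <= A -> (j, vac x A j) \in nu x A ->
  exists k s, fchain x k s /\ s A = j.
Proof.
move=> vx A1 jx.
(* Induction on the highest node a still to be treated, [t] being the length chosen at a.+1;
   [k = a.+1] means that no row of nu^(a) qualifies. *)
have ex a t : a < A -> exists k s, [/\ 1 <= k <= a.+1,
    forall b, k <= b <= a -> (s b, vac x b (s b)) \in nu x b,
    forall b, k <= b < a -> s b.+1 <= s b,
    k <= a -> t <= s a &
    forall b (r : rrow), 1 <= b <= a -> r \in nu x b -> r.2 = vac x b r.1 ->
      (if b == a then t <= r.1 else (k <= b.+1) && (s b.+1 <= r.1)) -> (k <= b) && (s b <= r.1)].
  elim: a t => [|a IH] t aA; first by exists 1, id; split=> // *; exfalso; lia.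
  case: (boolP (has (fun r => (t <= r.1) && (r.2 == vac x a.+1 r.1)) (nu x a.+1))) => hs; last first.
    exists a.+2, id; split; try (by move=> *; exfalso; lia); first by lia.
    move=> b r hb hr rE; case: eqP => [ba tr|ba]; last by lia.
    by case/negP: hs; apply/hasP; exists r; rewrite -?ba // tr rE eqxx.
  have /pick_shortest[m [mi tm mm]] : exists2 m, (m, vac x a.+1 m) \in nu x a.+1 & t <= m.
    by case/hasP: hs => -[r1 r2] hr /andP[/= tr /eqP rE]; exists r1; rewrite // -rE.
  have [k [s [hk hi hm ht hn]]] := IH m ltac:(lia).
  exists k, (fun b => if b == a.+1 then m else s b); split; first by lia.
  - move=> b hb; case: eqP => [->//|ba]; apply: hi; lia.
  - move=> b hb; have -> : b == a.+1 = false by lia.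
    by case: eqP => [ba|ba]; [have -> : b = a by lia|]; [apply: ht|apply: hm]; lia.
  - by rewrite eqxx.
  move=> b r hb hr rE; case: (eqVneq b a.+1) => [ba tr|ba].
    by rewrite ba in hr rE; rewrite mm // andbT; lia.
  move=> hh; apply: hn => //; first by lia.
  move: hh; rewrite eqSS; case: (b == a) => //; lia.
have [a AE] : exists a, A = a.+1 by exists A.-1; lia.
have [k [s [hk hi hm ht hn]]] := ex a j ltac:(lia).
exists k, (fun b => if b == a.+1 then j else s b); split; last by rewrite AE eqxx.
have hi' b : k <= b <= A -> ((if b == a.+1 then j else s b), vac x b (if b == a.+1 then j else s b)) \in nu x b.
  by move=> hb; case: eqP => [->|ba]; [rewrite -AE|apply: hi; lia].
split; first by rewrite AE.
- move=> b hb; have [/andP[_ pb] _ _] := vx b ltac:(lia).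
  by have /(allP pb) := hi' b ltac:(lia).
- move=> b hb; have -> : b == a.+1 = false by lia.
  by case: eqP => [ba|ba]; [have -> : b = a by lia|]; [apply: ht|apply: hm]; lia.
- by [].
move=> b r hb hr; rewrite /act [in minn _ _]AE [in minn b _]AE => a1 a0; apply/eqP => rE.
case: (eqVneq b a.+1) => [ba|ba].
  by move: a1 a0; rewrite ba (minn_idPr (leqnSn a.+1)) minnn eqxx; lia.
have bE : minn b a.+1 = b by lia.
have bE' : minn b.+1 a.+1 = b.+1 by lia.
move: a1 a0; rewrite bE bE' (negbTE ba) eqSS => a1 /negP; apply.
apply: (hn b r) => //; first by lia.
by move: a1; case: eqP => // _ /andP[].
Qed.

Lemma bchain_ex y k : valid y -> 1 <= k <= A -> exists s, bchain y k s.
Proof.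
move=> vy hk.
have ex c : k + c <= A -> exists s, [/\ forall a, k <= a <= k + c -> 0 < s a,
    forall a, k <= a < k + c -> s a.+1 <= s a,
    forall a, k <= a <= k + c -> 1 < s a -> ((s a).-1, vac y a (s a).-1) \in nu y a &
    forall a (r : rrow), k <= a <= k + c -> r \in nu y a -> r.2 = vac y a r.1 ->
      (k < a -> r.1 < s a.-1) -> r.1 < s a].
  elim: c => [|c IH] hc.
    (* [nusize y k] bounds every row of nu^(k) and so serves as the infinite length. *)
    have [m [_ m1 m2]] := pick_longest y k (nusize y k).
    exists (fun=> m.+1); split=> //.
      by move=> a ha /=; have -> : a = k by lia.
    move=> a r ha; have -> : a = k by lia.
    move=> hr rE _; apply: m2 => //; apply: mem_lens_le_sumn; exact: map_f.
  have [s [s1 s2 s3 s4]] := IH ltac:(lia).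
  have [m [m0 m1 m2]] := pick_longest y (k + c.+1) (s (k + c)).-1.
  exists (fun a => if a == k + c.+1 then m.+1 else s a); split.
  - by move=> a ha; case: eqP => // ac; apply: s1; lia.
  - move=> a ha; have -> : a == k + c.+1 = false by lia.
    case: eqP => [ac|ac]; last by apply: s2; lia.
    have -> : a = k + c by lia.
    by have := s1 (k + c) ltac:(lia); lia.
  - by move=> a ha; case: eqP => [->|ac]; [apply: m1|apply: s3; lia].
  move=> a r ha hr rE; case: (eqVneq a (k + c.+1)) => [ac|ac].
    have -> : a.-1 == k + c.+1 = false by lia.
    have -> : a.-1 = k + c by lia.
    move=> h; rewrite ltnS; rewrite ac in hr rE; apply: m2 => //; have := h ltac:(lia); lia.
  have -> : a.-1 == k + c.+1 = false by lia.
  by apply: s4 => //; lia.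
have [s [s1 s2 s3 s4]] := ex (A - k) ltac:(lia).
have e : k + (A - k) = A by lia.
rewrite e in s1 s2 s3 s4.
exists s; split=> //.
move=> a r ha hr; rewrite /act => /andP[ka]; have -> : minn a A = a by lia.
have e' : minn a.-1 A = a.-1 by lia.
rewrite e' => sr h; apply/eqP => rE; have := s4 a r ltac:(lia) hr rE; move: h; rewrite negb_and; lia.
Qed.

Lemma link_bchain k s x y : link k s x y -> bwdc A L y k s -> bchain y k s.
Proof.
move=> [hk hp hm ho hi] bw; split=> // a ha sa.
have [w [_ py]] := hi a ha; rewrite (perm_mem py) mem_cat /nz /=.
by case: eqP; [lia|rewrite mem_head].
Qed.

Lemma link_fchain k s x y : link k s x y -> fwdc A L x k s -> fchain x k s.
Proof.
move=> [hk hp hm ho hi] fw; split=> // a ha.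
by have [w [px _]] := hi a ha; rewrite (perm_mem px) mem_head.
Qed.

Lemma link_uniql k s x x' y : link k s x y -> link k s x' y ->
  (forall a, 1 <= a <= A -> is_rpart (nu x a)) -> (forall a, 1 <= a <= A -> is_rpart (nu x' a)) ->
  forall a, 1 <= a <= A -> nu x a = nu x' a.
Proof.
move=> l1 l2 r1 r2 a ha; case: (ltnP a k) => ka.
  by rewrite -(lk_out l1) ?(lk_out l2) //; lia.
apply: is_rpart_eq; [exact: r1|exact: r2|].
have [|w1 [p1 q1]] := lk_in l1 (a := a); first by lia.
have [|w2 [p2 q2]] := lk_in l2 (a := a); first by lia.
have vE i : vac x a i = vac x' a i by have := link_vac a i l1; rewrite (link_vac a i l2); lia.
apply: (perm_trans p1); rewrite perm_sym; apply: (perm_trans p2); rewrite vE perm_cons.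
by rewrite -(perm_cat2l (nz ((s a).-1, vac y a (s a).-1))) -(permPl q2).
Qed.

Lemma link_uniqr k s x y y' : link k s x y -> link k s x y' ->
  (forall a, 1 <= a <= A -> is_rpart (nu y a)) -> (forall a, 1 <= a <= A -> is_rpart (nu y' a)) ->
  forall a, 1 <= a <= A -> nu y a = nu y' a.
Proof.
move=> l1 l2 r1 r2 a ha; case: (ltnP a k) => ka.
  by rewrite (lk_out l1) ?(lk_out l2) //; lia.
apply: is_rpart_eq; [exact: r1|exact: r2|].
have [|w1 [p1 q1]] := lk_in l1 (a := a); first by lia.
have [|w2 [p2 q2]] := lk_in l2 (a := a); first by lia.
have vE i : vac y a i = vac y' a i by rewrite (link_vac a i l1) (link_vac a i l2).
apply: (perm_trans q1); rewrite perm_sym; apply: (perm_trans q2); rewrite vE perm_cat2l.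
by rewrite -(perm_cons (s a, vac x a (s a))) -(permPl p2).
Qed.

Lemma zr_eq u v : zr u -> zr v -> (forall i, Ql (lens u) i = Ql (lens v) i) -> u = v.
Proof.
move=> [pu zu] [pv zv] h.
have e : lens u = lens v by apply: Ql_inj => //; exact: is_rpart_lens.
have zE w : (forall r : rrow, r \in w -> r.2 = 0%R) -> w = [seq (m, 0%R) | m <- lens w].
  by move=> hw; rewrite /lens -map_comp -[LHS]map_id; apply/eq_in_map => -[r1 r2] /hw /= ->.
by rewrite (zE u) // (zE v) // e.
Qed.

(** Nodes above A carry zero riggings, and their Q functions are determined by j, Q^(A) and the
    parity of |nu^(A)|. *)
Lemma tops_uniq j x x' : tops d n j x -> tops d n j x' ->
  (forall a, 1 <= a <= A -> nu x a = nu x' a) -> x = x'.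
Proof.
move=> [[sx tx] zx] [[sx' tx'] zx'] h.
apply: (@eq_from_nth _ [::]); first by rewrite sx.
move=> i; rewrite sx => hi; change (nu x i.+1 = nu x' i.+1).
case: (leqP i.+1 A) => iA; first by apply: h; lia.
have hA : nu x A = nu x' A by case: (posnP A) => [->//|A0]; apply: h; lia.
have QA m : Q x A m = Q x' A m by rewrite !QE hA.
have sA : nusize x A = nusize x' A by rewrite /nusize hA.
move: (zx true) (zx false) (zx' true) (zx' false) hi iA tx tx' hA QA sA.
rewrite /topnode /anode; case: (d) => z1 z2 z3 z4 hi iA.
- move=> t1 t2 _ QA _; have -> : i.+1 = n by lia.
  by apply: zr_eq => // m; rewrite -!QE t1 t2.
- move=> t1 t2 _ QA _; have -> : i.+1 = n by lia.
  by apply: zr_eq => // m; rewrite -!QE t1 t2.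
move=> [t1 t2] [t3 t4] _ QA sA.
have [->|->] : i.+1 = n \/ i.+1 = n.-1 by lia.
  apply: zr_eq => // m; rewrite -!QE.
  by have := t1 m; have := t2 m; have := t3 m; have := t4 m; have := QA m; rewrite sA; lia.
apply: zr_eq => // m; rewrite -!QE.
by have := t1 m; have := t2 m; have := t3 m; have := t4 m; have := QA m; rewrite sA; lia.
Qed.

Hypothesis Lok : L_ok (Some d) n L.

(** The lengths of the [link] form a [bchain] of [y], so [tdelta] yields some [x'] linked to [y] by
    the same chain; cancelling the common rows gives [x' = x]. *)
Lemma tdelta_delta j k s x y : tops d n j x -> tops d n j y -> valid x -> link k s x y -> s A = j ->
  valid y -> bwdc A L y k s -> tdelta d n L k y = Some x.
Proof.
move=> tx ty vx lk sA vy bw.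
have [x' [-> tx' lk' rx']] := tdelta_lift Lok ty vy (link_bchain lk bw) sA.
congr Some; apply: (tops_uniq tx' tx); apply: (link_uniql lk' lk rx') => a /vx[] //.
Qed.

Lemma delta_tdelta j k s x y : tops d n j x -> tops d n j y -> valid y -> link k s x y -> s A = j ->
  valid x -> fwdc A L x k s -> delta d n L j x = Some (y, k).
Proof.
move=> tx ty vy lk sA vx fw.
have [y' [-> ty' lk' ry']] := delta_lift Lok tx vx (link_fchain lk fw) sA.
congr (Some (_, _)); apply: (tops_uniq ty' ty); apply: (link_uniqr lk' lk ry') => a /vy[] //.
Qed.

End Chains.

(** * Comparison of successive steps *)

Section Avail.
Variables (A : nat) (L : Ldata).
Local Notation vac := (vac A L).
Local Notation valid := (valid A L).
Local Notation link := (link A L).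
Local Notation act := (act A).
Local Notation nsing := (nsing A L).

(** At length m the chain acts on none of the nodes a.-1, a, a.+1, so the vacancy number stays and
    only the shortened row can be new. *)
Lemma nsing_low k s x y a m : link k s x y -> 1 <= a <= A -> 0 < m ->
  ~~ act k s a.+1 m -> nsing y a m = nsing x a m + ((k <= a) && (m == (s a).-1)).
Proof.
move=> lk ha m0 h1; have h0 : ~~ act k s a m by apply: contra h1; exact: act_mono lk.
have hm : ~~ act k s a.-1 m.
  by apply: contra h0 => /(act_mono lk); rewrite prednK //; case/andP: ha.
have vE : vac y a m = vac x a m.
  by rewrite (link_vac a m lk) (negbTE h1) (negbTE h0) (negbTE hm); lia.
case: (leqP k a) => ka; last by rewrite /nsing vE (lk_out lk) ?addn0 //; lia.
have [|w [px py]] := lk_in lk (a := a); first by lia.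
have aA : minn a A = a by lia.
have ms : m < s a by move: h0; rewrite /act ka aA /= -ltnNge.
rewrite /nsing (permP px) (permP py) count_cat /= vE !xpair_eqE /nz /=.
have -> : (s a == m) = false by lia.
case: (eqVneq m (s a).-1) => [<-|ne] /=.
  have -> : m == 0 = false by lia.
  by rewrite /= vE !eqxx /= addnC addn0.
case: eqP => [//|_] /=; first by rewrite addn0.
by rewrite xpair_eqE eq_sym (negbTE ne) !addn0.
Qed.

(** Here the chain acts on all three nodes, which also keeps the vacancy number; only the chosen row
    can be lost. *)
Lemma nsing_high k s x y a m : link k s x y -> 1 <= a <= A -> 0 < m ->
  act k s a.-1 m -> nsing x a m = nsing y a m + (m == s a).
Proof.
move=> lk ha m0 hm; have h0 : act k s a m.
  by move: (act_mono lk hm); rewrite prednK //; case/andP: ha.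
have h1 := act_mono lk h0.
have vE : vac y a m = vac x a m by rewrite (link_vac a m lk) h1 h0 hm; lia.
have ka : k <= a by case/andP: h0.
have [|w [px py]] := lk_in lk (a := a); first by lia.
have aA : minn a A = a by lia.
have ms : s a <= m by move: h0; rewrite /act ka aA.
have sp := lk_pos lk (a := a) ltac:(lia).
have n0 : count_mem (m, vac y a m) (nz ((s a).-1, vac y a (s a).-1)) = 0.
  rewrite /nz; case: eqP => //= _; rewrite xpair_eqE.
  by have -> : (s a).-1 == m = false by lia.
rewrite /nsing (permP px) (permP py) count_cat n0 /= vE xpair_eqE.
case: (eqVneq m (s a)) => [<-|ne]; first by rewrite !eqxx /= addnC.
by rewrite /= addn0.
Qed.

Lemma sing_row x a (m : nat) : (0 < nsing x a m) = ((m, vac x a m) \in nu x a).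
Proof. by rewrite /nsing -has_count has_pred1. Qed.

Lemma link_newl k s x y a : link k s x y -> k <= a <= A -> 0 < nsing x a (s a).
Proof.
move=> lk ha; have [w [px _]] := lk_in lk ha.
by rewrite sing_row (perm_mem px) mem_head.
Qed.

Lemma link_newr k s x y a : link k s x y -> k <= a <= A -> 1 < s a -> 0 < nsing y a (s a).-1.
Proof.
move=> lk ha sa; have [w [_ py]] := lk_in lk ha.
rewrite sing_row (perm_mem py) mem_cat /nz /=.
by case: eqP; [lia|rewrite mem_head].
Qed.

(* Chains are numbered from 0; [K i] is the last node of chain [i] and [S i a]
   the length, in the larger configuration, of its row at node [a]. *)
Definition need (e : nat) (K : nat -> nat) (S : nat -> nat -> nat) lo hi a m : nat :=
  count (fun i => (K i <= a) && (S i a == m + e)) (index_iota lo hi).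

(** e = 1 reserves rows shortened by earlier removals, e = 0 rows lengthened by earlier additions.
    Counting with multiplicity lets several chains share a length. *)
Definition avail e K S lo hi (x : rc) : Prop := forall a m, 1 <= a <= A -> 0 < m ->
  need e K S lo hi a m <= nsing x a m.

Definition inter (K : nat -> nat) (S : nat -> nat -> nat) lo hi : Prop :=
  forall i i', lo <= i < i' -> i' < hi -> K i < K i' /\
    forall a, K i' <= a.+1 <= A -> S i a <= S i' a.+1.

Definition mono (K : nat -> nat) (S : nat -> nat -> nat) lo hi : Prop :=
  forall i a, lo <= i < hi -> K i <= a < A -> S i a.+1 <= S i a.

Lemma needP e K S lo hi a m : 0 < need e K S lo hi a m ->
  exists i, [/\ lo <= i < hi, K i <= a & S i a = m + e].
Proof.
rewrite /need -has_count => /hasP[i]; rewrite mem_index_iota => hi' /andP[h1 /eqP h2].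
by exists i.
Qed.

Lemma need_recl e K S lo hi a m : lo < hi ->
  need e K S lo hi a m = ((K lo <= a) && (S lo a == m + e)) + need e K S lo.+1 hi a m.
Proof. by move=> h; rewrite /need /index_iota -(prednK (n := hi - lo)) ?subn_gt0 //= subnS. Qed.

Lemma need_recr e K S lo hi a m : lo <= hi ->
  need e K S lo hi.+1 a m = need e K S lo hi a m + ((K hi <= a) && (S hi a == m + e)).
Proof.
move=> h; rewrite /need /index_iota subSn // -addn1 iotaD count_cat /= addn0.
by rewrite subnKC.
Qed.

Lemma need_mem e K S lo hi a m i : lo <= i < hi -> K i <= a -> S i a = m + e ->
  0 < need e K S lo hi a m.
Proof.
move=> hi' h1 h2; rewrite /need -has_count; apply/hasP; exists i; first by rewrite mem_index_iota.
by rewrite h1 h2 eqxx.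
Qed.

(** The rows reserved by later chains lie in the range of [nsing_high]. At most one singular row is
    lost there, of length [s a]; if it is reserved, [S i a] is squeezed to [(s a).+1], so the demand
    of chain i disappears with it. *)
Lemma avail_fpop K S i hi k s x y : link k s x y ->
  avail 1 K S i hi x -> i < hi -> inter K S i hi -> mono K S i hi -> k <= K i ->
  (forall a, K i <= a <= A -> s a < S i a) -> avail 1 K S i.+1 hi y.
Proof.
move=> lk av ih il mo kK sS a m ha m0.
case: (posnP (need 1 K S i.+1 hi a m)) => [->//|/needP[i' [hi' Ka Sa]]].
have [KK SS] := il i i' ltac:(lia) ltac:(lia).
have := SS a.-1; rewrite prednK; last by case/andP: ha.
move=> /(_ ltac:(lia)) Sle; have sl := sS a.-1 ltac:(lia).
have am : act k s a.-1 m.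
  rewrite /act; have -> : minn a.-1 A = a.-1 by lia.
  lia.
have nE := nsing_high lk ha m0 am.
have := av a m ha m0; rewrite need_recl // nE.
case: (eqVneq m (s a)) => [ms|ne] /=; last by lia.
have Sm := mo i a.-1 ltac:(lia) ltac:(lia); rewrite prednK in Sm; last by case/andP: ha.
have sl2 := sS a ltac:(lia).
have -> : K i <= a by lia.
have -> : S i a == m + 1 by lia.
by rewrite /=; lia.
Qed.

(** Interlacing puts the rows of earlier chains to the left of the length chosen at a.+1, in the
    range of [nsing_low], so the new singular row adds to them. *)
Lemma avail_fpush K S i k s x y j : link k s x y ->
  avail 1 K S 0 i x -> inter K S 0 i.+1 -> K i = k ->
  (forall a, k <= a <= A -> S i a = s a) -> (forall i', i' <= i -> S i' A = j) ->
  avail 1 K S 0 i.+1 y.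
Proof.
move=> lk av il Kk Ss SA a m ha m0.
have [k0 kA] := andP (lk_k lk).
rewrite need_recr // Kk.
have -> : (k <= a) && (S i a == m + 1) = (k <= a) && (m == (s a).-1).
  by case: (leqP k a) => //= ka; have := lk_pos lk (a := a) ltac:(lia); rewrite Ss; lia.
case: (posnP (need 1 K S 0 i a m)) => [->|/needP[i' [hi' Ka Sa]]].
  case: (leqP k a) => //= ka; case: eqP => //= mE.
  by rewrite mE; apply: link_newr lk _ _; lia.
rewrite (nsing_low lk ha m0) ?leq_add2r; first exact: av.
have [KK SS] := il i' i ltac:(lia) ltac:(lia).
rewrite /act; apply/negP => /andP[ka]; case: (ltnP a A) => aA.
  have -> : minn a.+1 A = a.+1 by lia.
  have := SS a ltac:(lia); rewrite Ss; lia.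
have -> : minn a.+1 A = A by lia.
have aE : a = A by lia.
by rewrite -Ss ?SA //; move: Sa; rewrite aE SA; lia.
Qed.

(** Mirror image of [avail_fpop]: the only singular row lost by lengthening has length [(s a).-1],
    and another demand for it forces [S i a] to equal this length. *)
Lemma avail_bpop K S lo i k s x y : link k s x y ->
  avail 0 K S lo i.+1 y -> lo <= i -> inter K S lo i.+1 -> mono K S lo i.+1 -> K i <= k ->
  (forall a, k <= a <= A -> S i a < s a) -> (forall i', lo <= i' <= i -> S i' A = S i A) ->
  avail 0 K S lo i x.
Proof.
move=> lk av loi il mo Kk Ss SA a m ha m0.
have [k0 kA] := andP (lk_k lk).
case: (posnP (need 0 K S lo i a m)) => [->//|/needP[i' [hi' Ka Sa]]].
have [KK SS] := il i' i ltac:(lia) ltac:(lia).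
have na : ~~ act k s a.+1 m.
  rewrite /act; apply/negP => /andP[ka]; case: (ltnP a A) => aA.
    have -> : minn a.+1 A = a.+1 by lia.
    by have := SS a ltac:(lia); have := Ss a.+1 ltac:(lia); lia.
  have -> : minn a.+1 A = A by lia.
  have aE : a = A by lia.
  by have := Ss A ltac:(lia); move: Sa; rewrite aE (SA i'); lia.
have := av a m ha m0; rewrite need_recr // (nsing_low lk ha m0 na).
case: (leqP k a) => ka /=; last by lia.
case: (eqVneq m (s a).-1) => [ms|ne] /=; last by lia.
have -> : K i <= a by lia.
have -> : S i a == m + 0.
  have := Ss a ltac:(lia); case: (ltnP a A) => aA.
    by have := mo i a ltac:(lia) ltac:(lia); have := SS a ltac:(lia); lia.
  have aE : a = A by lia.
  by move: Sa; rewrite aE (SA i'); lia.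
by rewrite /=; lia.
Qed.

Lemma avail_bpush K S i hi k s x y : link k s x y ->
  avail 0 K S i.+1 hi y -> i < hi -> inter K S i hi -> K i = k ->
  (forall a, k <= a <= A -> S i a = s a) -> avail 0 K S i hi x.
Proof.
move=> lk av ih il Kk Ss a m ha m0.
have [k0 kA] := andP (lk_k lk).
rewrite need_recl // Kk.
have -> : (k <= a) && (S i a == m + 0) = (k <= a) && (m == s a).
  by case: (leqP k a) => //= ka; rewrite Ss; lia.
case: (posnP (need 0 K S i.+1 hi a m)) => [->|/needP[i' [hi' Ka Sa]]].
  rewrite addn0; case: (leqP k a) => //= ka; case: eqP => //= mE.
  by rewrite mE; apply: link_newl lk _; lia.
have [KK SS] := il i i' ltac:(lia) ltac:(lia).
have am : act k s a.-1 m.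
  rewrite /act; have -> : minn a.-1 A = a.-1 by lia.
  by have := SS a.-1 ltac:(lia); rewrite Ss ?prednK; lia.
rewrite (nsing_high lk ha m0 am) addnC; apply: leq_add; first exact: av.
by case: (k <= a).
Qed.

(** At each node of the old chain a singular row of length [(S0 a).-1] is a candidate, so the new
    chain cannot stop before [K0] and its shortest choice has at most that length. *)
Lemma fchain_below d n k s x K0 S0 : A = anode d n -> fchain d n L x k s ->
  1 <= K0 <= A -> (forall a, K0 <= a < A -> S0 a.+1 <= S0 a) ->
  (forall a, K0 <= a <= A -> 0 < nsing x a (S0 a).-1) -> (forall a, K0 <= a <= A -> 0 < S0 a) ->
  s A < S0 A -> k <= K0 /\ forall a, K0 <= a <= A -> s a < S0 a.
Proof.
move=> AE fc hK mo ns S0p sA; case: fc; rewrite -AE => hk pos smo inn fw.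
have claim c : K0 <= A - c -> c <= A -> k <= A - c /\ s (A - c) < S0 (A - c).
  elim: c => [|c IH] hc cA; first by rewrite subn0; split=> //; lia.
  have [kc sc] := IH ltac:(lia) ltac:(lia).
  have aE : (A - c.+1).+1 = A - c by lia.
  have ha : 1 <= A - c.+1 <= A by lia.
  have hK' : K0 <= A - c.+1 <= A by lia.
  have := ns _ hK'; rewrite sing_row => row.
  have sp := S0p _ hK'.
  have smo' := mo (A - c.+1) ltac:(lia); rewrite aE in smo'.
  have := fw _ _ ha row; rewrite /= eqxx /act aE.
  have -> : minn (A - c) A = A - c by lia.
  have -> : minn (A - c.+1) A = A - c.+1 by lia.
  move=> hf; case: (boolP ((k <= A - c.+1) && (s (A - c.+1) <= (S0 (A - c.+1)).-1))) => [|hn].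
    by case/andP; lia.
  by have := hf ltac:(lia) hn.
split; first by have [] := claim (A - K0) ltac:(lia) ltac:(lia); lia.
by move=> a ha; have [] := claim (A - a) ltac:(lia) ltac:(lia); have -> : A - (A - a) = a by lia.
Qed.

(** [bwdc] leaves no singular row at node a.+1 with length from [s0 a.+1] up to, but excluding,
    [s0 a]. A chain that starts above this window stays above it, and at [k0] the window is
    unbounded, so the chain stops earlier. *)
Lemma fchain_next d n k s x k0 s0 : A = anode d n -> fchain d n L x k s ->
  bwdc A L x k0 s0 -> k0 < A -> s0 A.-1 <= s A ->
  k0 < k /\ forall a, k <= a.+1 <= A -> s0 a <= s a.+1.
Proof.
move=> AE fc bw kA0 s0A; case: fc; rewrite -AE => hk pos smo inn fw.
have claim c : c < A -> k <= A - c -> k0 <= (A - c).-1 /\ s0 (A - c).-1 <= s (A - c).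
  elim: c => [|c IH] hc kc; first by rewrite subn0; split=> //; lia.
  have [k0c s0c] := IH ltac:(lia) ltac:(lia).
  have aE : (A - c).-1 = A - c.+1 by lia.
  have aE' : (A - c.+1).+1 = A - c by lia.
  have smo' := smo (A - c.+1) ltac:(lia); rewrite aE' in smo'.
  have := bw (A - c.+1) _ ltac:(lia) (inn (A - c.+1) ltac:(lia)).
  rewrite /= eqxx /act; have -> : minn (A - c.+1) A = A - c.+1 by lia.
  have -> : minn (A - c.+1).-1 A = (A - c.+1).-1 by lia.
  move=> hf; case: (boolP ((k0 <= (A - c.+1).-1) && (s0 (A - c.+1).-1 <= s (A - c.+1)))) => [/andP//|hn].
  by have := hf ltac:(rewrite aE in k0c s0c; lia) hn.
split; first by have [] := claim (A - k) ltac:(lia) ltac:(lia); lia.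
move=> a ha; have [_] := claim (A - a.+1) ltac:(lia) ltac:(lia).
by have -> : A - (A - a.+1) = a.+1 by lia.
Qed.

(** The reserved rows of length [S0 a] are candidates at each node, and [s] is the longest choice
    plus one. *)
Lemma bchain_above d n k s y K0 S0 : A = anode d n -> bchain d n L y k s ->
  K0 <= k -> (forall a, K0 <= a < A -> S0 a.+1 <= S0 a) ->
  (forall a, K0 <= a <= A -> 0 < nsing y a (S0 a)) ->
  forall a, k <= a <= A -> S0 a < s a.
Proof.
move=> AE bc Kk mo ns; case: bc; rewrite -AE => hk pos smo inn bw a /andP[ka].
rewrite -(subnKC ka); elim: (a - k) => [|c IH] cA.
  rewrite addn0 ltnNge; apply/negP => sS.
  have := ns k ltac:(lia); rewrite sing_row => row.
  have := bw k _ hk row; rewrite /= eqxx /act.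
  have -> : minn k A = k by lia.
  rewrite leqnn sS => /(_ isT) hh; have /hh // : ~~ ((k <= k.-1) && (s (minn k.-1 A) <= S0 k)) by lia.
have SS := IH ltac:(lia).
have mo' := mo (k + c) ltac:(lia); rewrite -addnS in mo'.
rewrite ltnNge; apply/negP => sS.
have := ns (k + c.+1) ltac:(lia); rewrite sing_row => row.
have := bw (k + c.+1) _ ltac:(lia) row; rewrite /= eqxx /act.
have -> : minn (k + c.+1) A = k + c.+1 by lia.
have -> : minn (k + c.+1).-1 A = k + c by lia.
rewrite sS leq_addr => /(_ isT) hh; have /hh // : ~~ ((k <= (k + c.+1).-1) && (s (k + c) <= S0 (k + c.+1))) by lia.
Qed.

(** [fwdc] of the addition just made excludes singular rows of node a with length from [s0 a.+1] on
    and below [s0 a]; this confines the next chain. *)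
Lemma bchain_next d n k s x k0 s0 : A = anode d n -> bchain d n L x k s ->
  fwdc A L x k0 s0 -> (forall a, k0 <= a <= A -> 0 < s0 a) -> k < k0 ->
  forall a, k0 <= a.+1 <= A -> s a <= s0 a.+1.
Proof.
move=> AE bc fw p0 kk0; case: bc; rewrite -AE => hk pos smo inn bw a ha.
have [c aE] : exists c, a = k0.-1 + c by exists (a - k0.-1); lia.
elim: c a ha aE => [|c IH] a ha aE.
  have s0p := p0 a.+1 ltac:(lia); have sp := pos a ltac:(lia).
  case: (leqP (s a) 1) => s1; first by lia.
  rewrite leqNgt; apply/negP => ss.
  have := fw a _ ltac:(lia) (inn a ltac:(lia) s1); rewrite /= eqxx /act.
  have -> : minn a.+1 A = a.+1 by lia.
  have -> : k0 <= a = false by lia.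
  by move=> hh; have := hh ltac:(lia) isT.
have := IH a.-1 ltac:(lia) ltac:(lia); rewrite prednK; last by lia.
move=> IHa; have smo' := smo a.-1 ltac:(lia); rewrite prednK in smo'; last by lia.
have s0p := p0 a.+1 ltac:(lia); have sp := pos a ltac:(lia).
case: (leqP (s a) 1) => s1; first by lia.
rewrite leqNgt; apply/negP => ss.
have := fw a _ ltac:(lia) (inn a ltac:(lia) s1); rewrite /= eqxx /act.
have -> : minn a.+1 A = a.+1 by lia.
have -> : minn a A = a by lia.
by move=> hh; have := hh ltac:(lia) ltac:(lia).
Qed.

End Avail.

(** * A whole column *)

Lemma Ql_lt u b i : b \in u -> i < b -> Ql u i < sumn u.
Proof.
rewrite /Ql; elim: u => //= c u IH; rewrite inE => /orP[/eqP ->|bu] ib.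
  by have := Ql_le u i; rewrite /Ql; lia.
by have := IH bu ib; lia.
Qed.

Lemma L_ok_Lge d n L a : L_ok (Some d) n L -> anode d n < a -> Lge L a = 0.
Proof.
move=> Lo ha; rewrite /Lge big1_seq // => -[b j] /= /andP[ab bL].
by move: bL; rewrite mem_finsupp => /Lo[_ _]; move: ha; rewrite /anode; case: (d); lia.
Qed.

(** * Weights as limits of vacancy numbers *)

Section Weights.
Variables (d : domino) (n : nat) (L : Ldata).
Local Notation A := (anode d n).
Hypothesis Lok : L_ok (Some d) n L.
Local Notation vac := (vac A L).
Local Notation valid := (valid A L).
Local Notation link := (link A L).
Local Notation wtc := (wtcoef L).

(** Beyond all row lengths every term of [vac] is a size; the clipped node index turns the
    difference at A into the last coefficient alone. *)
Lemma vac_inf x a : 1 <= a <= A -> exists B, forall i, B <= i ->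
  vac x a i = (wtc x a - (if a == A then 0 else wtc x a.+1))%R.
Proof.
move=> ha; have [B hB] := LQ_large L a.
exists (B + nusize x a.-1 + nusize x a + nusize x a.+1) => i hi.
have := hB i ltac:(lia); rewrite /vac /qq /wtcoef.
have -> : minn a A = a by lia.
have -> : minn a.-1 A = a.-1 by lia.
have -> : Q x a i = nusize x a by apply: Q_large; lia.
have -> : Q x a.-1 i = nusize x a.-1 by apply: Q_large; lia.
case: (eqVneq a A) => aA.
  have -> : minn a.+1 A = a by lia.
  have -> : Q x a i = nusize x a by apply: Q_large; lia.
  have := @L_ok_Lge d n L a.+1 Lok ltac:(lia); lia.
have -> : minn a.+1 A = a.+1 by lia.
have -> : Q x a.+1 i = nusize x a.+1 by apply: Q_large; lia.
rewrite /=; lia.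
Qed.

Lemma wtc_mono x a : valid x -> 1 <= a < A -> (wtc x a.+1 <= wtc x a)%R.
Proof.
move=> vx ha; have [|B hB] := @vac_inf x a; first by lia.
have [_ p _] := vx a ltac:(lia); have := p B; rewrite hB //.
have -> : a == A = false by lia.
lia.
Qed.

Lemma wtc_A x : valid x -> 1 <= A -> (0 <= wtc x A)%R.
Proof.
move=> vx ha; have [|B hB] := @vac_inf x A; first by lia.
have [_ p _] := vx A ltac:(lia); have := p B; rewrite hB // eqxx; lia.
Qed.

Lemma wtc_anti x a b : valid x -> 1 <= a -> a <= b <= A -> (wtc x b <= wtc x a)%R.
Proof.
move=> vx a1 /andP[/subnK <-]; elim: (b - a) => [|c IH] cA; first by rewrite add0n lexx.
have := wtc_mono vx (a := c + a) ltac:(lia); have := IH ltac:(lia).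
by rewrite addSn; lia.
Qed.

Lemma wtc_ge0 x a : valid x -> 1 <= a <= A -> (0 <= wtc x a)%R.
Proof.
move=> vx ha; have := wtc_anti vx (a := a) (b := A) ltac:(lia) ltac:(lia).
by have := wtc_A vx ltac:(lia); lia.
Qed.

Lemma link_nusize k s x y a : link k s x y -> a <= A -> nusize x a = nusize y a + (k <= a).
Proof.
move=> lk aA; have := @link_Q _ _ _ _ _ _ a (nusize x a + nusize y a + s a) lk.
rewrite /qq /act (minn_idPl aA) !Q_large; lia.
Qed.

Lemma link_wtc k s x y a : link k s x y -> 1 <= a <= A ->
  wtc y a = (wtc x a + (a == k)%:Z)%R.
Proof.
move=> lk ha; rewrite /wtcoef !(link_nusize lk); lia.
Qed.

(** With no row of nu^(A) longer than j, its terms have reached their limit, and the remaining terms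
    of [vac] only grow with the length. *)
Lemma vac_end x j : 1 <= A -> nusize x A = Q x A j -> (vac x A j <= wtc x A)%R.
Proof.
move=> A1 h; rewrite /vac /qq minnn (minn_idPr (leqnSn A)) (minn_idPl (leq_pred A)) -h /wtcoef.
by have := LQ_le L A j; have := @Ql_le (lens (nu x A.-1)) j; rewrite -QE -/(nusize x A.-1); lia.
Qed.

(** A longer row of nu^(A-1) would leave a box outside the first j columns and, the weight at A
    being 0, make the vacancy number at A negative. *)
Lemma rows_end x j : valid x -> 1 <= A -> nusize x A = Q x A j -> wtc x A = 0%R ->
  forall r : rrow, r \in nu x A.-1 -> r.1 <= j.
Proof.
move=> vx A1 h w0 r hr; rewrite leqNgt; apply/negP => jr.
have := @Ql_lt (lens (nu x A.-1)) r.1 j (map_f _ hr) jr; rewrite -QE -/(nusize x A.-1).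
have [_ p _] := vx A ltac:(lia); have := p j; move: w0.
rewrite /vac /qq minnn (minn_idPr (leqnSn A)) (minn_idPl (leq_pred A)) -h /wtcoef.
by have := LQ_le L A j; lia.
Qed.
End Weights.

Definition psi_step d n L (o : option (rc * skewtab)) (p : nat * nat) :=
  if o is Some (y, T) then
    if delta d n L p.1 y is Some (z, k) then Some (z, add_box k p.2 T) else None
  else None.

Definition tpsi_step d n L (o : option rc) (k : nat) :=
  if o is Some x then tdelta d n L k x else None.

Definition add_boxes (ps : seq (nat * nat)) (T : skewtab) : skewtab :=
  foldl (fun T p => add_box p.1 p.2 T) T ps.

Lemma mono_anti A K S lo hi i a b : mono A K S lo hi -> lo <= i < hi -> K i <= a -> a <= b <= A ->
  S i b <= S i a.
Proof.
move=> mo hi' Ka /andP[/subnK <-]; elim: (b - a) => [//|c IH] cA.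
by rewrite addSn; apply: leq_trans (mo i (c + a) hi' _) (IH _); lia.
Qed.

Lemma interlace_push A K S (k : nat) (s : nat -> nat) i : inter A K S 0 i ->
  mono A K S 0 i ->
  (0 < i -> K i.-1 < k /\ forall a, k <= a.+1 <= A -> S i.-1 a <= s a.+1) ->
  inter A (fun i' => if i' == i then k else K i') (fun i' => if i' == i then s else S i') 0 i.+1.
Proof.
move=> il mo h p q /= pq qi.
have -> : p == i = false by lia.
case: (eqVneq q i) => [qE|qi']; last by apply: il; lia.
have [Kk Ss] := h ltac:(lia).
case: (eqVneq p i.-1) => [->|pi]; first by split.
have [h1 h2] := il p i.-1 ltac:(lia) ltac:(lia).
split; first by lia.
move=> a ha; have := h2 a ltac:(lia); have := Ss a ha.
by have := mo i.-1 a ltac:(lia) ltac:(lia); lia.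
Qed.

(** * The steps of one column, in both directions *)

Section Groups.
Variables (d : domino) (n : nat) (L : Ldata).
Local Notation A := (anode d n).
Hypothesis Lok : L_ok (Some d) n L.
Local Notation vac := (vac A L).
Local Notation valid := (valid A L).
Local Notation link := (link A L).
Local Notation wtc := (wtcoef L).
Local Notation tops := (tops d n).
Local Notation avail := (avail A L).
Local Notation inter := (inter A).
Local Notation mono := (mono A).

(** State after i of the h steps for column j. Primes mark the chains of column j.+1, of height c; N
    will be l(lambda). [fs_base] prepares the start of the next chain, [fs_shape] confines the
    weight, and [fs_psi] and [fs_tpsi] keep the runs in both directions. *)
Record fstate (x0 : rc) (j h c N : nat) (K' : nat -> nat) (S' : nat -> nat -> nat)
    (i : nat) (x : rc) (K : nat -> nat) (S : nat -> nat -> nat) : Prop := FState {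
  fs_valid : valid x;
  fs_tops : tops j x;
  fs_Q : forall m, Q x0 A m = Q x A m + i * (j <= m);
  fs_prev : avail 1 K' S' i c x;
  fs_cur : avail 1 K S 0 i x;
  fs_inter : inter K S 0 i;
  fs_mono : mono K S 0 i;
  fs_K : forall i', i' < i -> 1 <= K i' <= N + maxn i c /\ K i' <= A;
  fs_S : forall i' a, i' < i -> K i' <= a <= A -> 0 < S i' a;
  fs_SA : forall i', i' < i -> S i' A = j;
  fs_le : forall i', i' < i -> i' < c -> K i' <= K' i';
  fs_bwd : 0 < i -> bwdc A L x (K i.-1) (S i.-1);
  fs_base : 0 < i < h -> K i.-1 < A /\ S i.-1 A.-1 <= j;
  fs_shape : forall a, N + maxn i c < a <= A -> wtc x a = 0%R;
  fs_wt : forall a, 1 <= a <= A -> wtc x a = (wtc x0 a + (count (fun i' => K i' == a) (iota 0 i))%:Z)%R;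
  fs_psi : forall T, foldl (psi_step d n L) (Some (x0, T)) [seq (j, i'.+1) | i' <- iota 0 i] =
     Some (x, add_boxes [seq (K i', i'.+1) | i' <- iota 0 i] T);
  fs_tpsi : foldl (tpsi_step d n L) (Some x) (rev [seq K i' | i' <- iota 0 i]) = Some x0 }.

Section Column.
Variables (x0 : rc) (j h c N c1 : nat) (K' : nat -> nat) (S' : nat -> nat -> nat).
Hypotheses (A1 : 1 <= A) (j0 : 0 < j) (ch : c <= h) (hc1 : h <= c1) (NA : N + c1 <= A).
Hypothesis hj : colh (lens (nu x0 A)) j = h.
Hypothesis hj1 : colh (lens (nu x0 A)) j.+1 = 0.
Hypotheses (il' : inter K' S' 0 c) (mo' : mono K' S' 0 c).
Hypothesis K'b : forall i', i' < c -> 1 <= K' i' <= N + c /\ K' i' <= A.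
Hypothesis S'p : forall i' a, i' < c -> K' i' <= a <= A -> 0 < S' i' a.
Hypothesis S'A : forall i', i' < c -> S' i' A = j.+1.

Arguments il' : clear implicits.
Arguments mo' : clear implicits.
Arguments K'b : clear implicits.
Arguments S'p : clear implicits.
Arguments S'A : clear implicits.

Lemma fstep i x K S : i < h -> fstate x0 j h c N K' S' i x K S ->
  exists y k s, fstate x0 j h c N K' S' i.+1 y (fun i' => if i' == i then k else K i')
       (fun i' => if i' == i then s else S i').
Proof.
move=> ih [vx tx QA pr cu il mo Kb Sp SA le bw bs sh wt psi tpsi].
have cj : colh (lens (nu x A)) j = h - i.
  have := QA j; have := QA j.-1; rewrite -(prednK j0) !QE !Ql_colh prednK // hj.
  have -> : j <= j.-1 = false by lia.
  by rewrite leqnn; lia.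
have cj1 : colh (lens (nu x A)) j.+1 = 0.
  by have := QA j; have := QA j.+1; rewrite !QE !Ql_colh hj1 leqnn leqnSn; lia.
have jrow : j \in lens (nu x A).
  by rewrite count_lens; have := colhS (lens (nu x A)) j; rewrite cj cj1; lia.
have QAj : nusize x A = Q x A j.
  rewrite /nusize QE; apply/esym/Ql_ge => b bx; rewrite leqNgt; apply/negP => jb.
  by move/eqP: cj1; rewrite eqn0Ngt -has_count => /hasP[]; exists b.
(* For i < c this row is reserved by the i-th chain of column j.+1. Afterwards the rank bound makes
   the weight vanish at A, which forces vacancy 0 there, so every row of length j is singular. *)
have jsing : (j, vac x A j) \in nu x A.
  case: (ltnP i c) => ic.
    rewrite -sing_row; apply: leq_trans (pr A j ltac:(lia) j0).
    by apply: (@need_mem _ _ _ _ _ _ _ i); [lia|have := K'b i ic; lia|rewrite S'A // addn1].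
  have w0 : wtc x A = 0%R by apply: sh; lia.
  have [_ p q] := vx A ltac:(lia).
  have v0 : vac x A j = 0%R by have := vac_end L A1 QAj; have := p j; rewrite w0; lia.
  case/mapP: jrow => -[r1 r2] hr /= jE; have := q _ hr; rewrite /= -jE v0 => h0.
  by have r20 : r2 = 0%R by [lia]; rewrite -r20 jE.
have [k [s [fc sA]]] := fchain_ex vx A1 jsing.
have [y [dE ty lk ry]] := delta_lift Lok tx vx fc sA.
have [vy bwy] := fwd_valid lk ry vx (fc_fwd fc).
have kA := fc_k fc.
have prevle : i < c -> k <= K' i /\ forall a, K' i <= a <= A -> s a < S' i a.
  move=> ic; apply: (fchain_below erefl fc) => //; first by have := K'b i ic; lia.
  - by move=> a ha; apply: mo' => //; lia.
  - move=> a ha; have S1 : S' i A <= S' i a.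
      by apply: (mono_anti mo'); lia.
    rewrite S'A // in S1.
    apply: leq_trans (pr a (S' i a).-1 ltac:(have := K'b i ic; lia) ltac:(lia)).
    by apply: (@need_mem _ _ _ _ _ _ _ i); lia.
  - by move=> a ha; apply: S'p.
  - by rewrite sA S'A.
have next : 0 < i -> K i.-1 < k /\ forall a, k <= a.+1 <= A -> S i.-1 a <= s a.+1.
  move=> i0; have [b1 b2] := bs ltac:(lia).
  by apply: (fchain_next erefl fc (bw i0)) => //; rewrite sA.
have ily := interlace_push il mo next.
(* A box further down would sit under an empty row of the weight, which is a partition. *)
have kN : k <= N + maxn i.+1 c.
  case: (ltnP i c) => ic; first by have [] := prevle ic; have := K'b i ic; lia.
  rewrite leqNgt; apply/negP => kN.
  have k1 : 1 <= k.-1 < A by lia.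
  have := wtc_mono Lok vy k1; rewrite prednK; last by lia.
  rewrite !(link_wtc lk) ?eqxx; try lia.
  rewrite (sh k.-1); last by lia.
  have := wtc_ge0 Lok vx kA; lia.
have shy a : N + maxn i.+1 c < a <= A -> wtc y a = 0%R.
  move=> ha; rewrite (link_wtc lk) ?(sh a); lia.
(* Either the weight at A is 0 and [rows_end] applies, or column j.+1 has a chain i.+1, whose length
   j.+1 at A bounds that of chain i at A.-1. *)
have bsy : i.+1 < h -> k < A /\ s A.-1 <= j.
  move=> ih'; case: (ltnP (maxn i.+1 c) h) => hm.
    have kA' : k < A by lia.
    split=> //; have w0 : wtc x A = 0%R by apply: sh; lia.
    by have := rows_end vx A1 QAj w0 (fc_in fc (a := A.-1) ltac:(lia)).
  have ic : i.+1 < c by lia.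
  have [k1 k2] := prevle ltac:(lia).
  have [i1 i2] := il' i i.+1 ltac:(lia) ltac:(lia).
  have [_ i3] := K'b i.+1 ic.
  have := i2 A.-1 ltac:(lia); rewrite prednK // (S'A i.+1 ic).
  by have := k2 A.-1 ltac:(lia); lia.
pose Ky i' := if i' == i then k else K i'.
pose Sy i' := if i' == i then s else S i'.
have mapK (T : Type) (f : nat -> nat -> T) :
    [seq f (Ky i') i' | i' <- iota 0 i.+1] = rcons [seq f (K i') i' | i' <- iota 0 i] (f k i).
  rewrite -addn1 iotaD map_cat /= cats1 {2}/Ky add0n eqxx; congr (rcons _ _).
  by apply/eq_in_map => i'; rewrite mem_iota /Ky => hi'; rewrite (_ : i' == i = false) //; lia.
exists y, k, s; split=> //.
- move=> m; rewrite QA; have := link_Q A m lk; rewrite /qq /act minnn sA.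
  by case/andP: kA => _ -> ->; rewrite mulSn; lia.
- case: (ltnP i c) => ic; last first.
    move=> a m _ _; rewrite /need /index_iota; have -> : c - i.+1 = 0 by lia.
    by [].
  have [k1 k2] := prevle ic.
  apply: (avail_fpop lk pr ic) => //.
    by move=> p q hpq hq; apply: il' => //; lia.
  by move=> p a hp; apply: mo'; lia.
- apply: (@avail_fpush _ _ _ _ _ _ _ _ _ j lk _ ily); rewrite ?eqxx //.
    move=> a m ha m0; apply: leq_trans (cu a m ha m0); rewrite /need.
    apply: eq_leq; apply: eq_in_count => i'; rewrite mem_index_iota => hi'.
    by have -> : i' == i = false by lia.
  by move=> i' hi'; case: eqP => // hne; apply: SA; lia.
- by move=> p a hp /=; case: eqP => [_|hne] h1; [apply: (fc_mono fc)|apply: mo]; lia.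
- move=> i' hi'; case: eqP => hne; first by lia.
  by have := Kb i' ltac:(lia); lia.
- by move=> i' a hi'; case: eqP => hne h1; [apply: (fc_pos fc)|apply: Sp; lia].
- by move=> i' hi'; case: eqP => // hne; apply: SA; lia.
- move=> i' hi' hc; case: eqP => [e|hne]; last by apply: le => //; lia.
  by rewrite e in hc *; have [] := prevle hc.
- by move=> _; rewrite /= eqxx.
- by move=> hh; rewrite /= eqxx; apply: bsy; lia.
- move=> a ha; rewrite (link_wtc lk) // wt //.
  have -> : count (fun i' => (if i' == i then k else K i') == a) (iota 0 i.+1) =
    count_mem a [seq Ky i' | i' <- iota 0 i.+1] by rewrite count_map.
  have -> : count (fun i' => K i' == a) (iota 0 i) = count_mem a [seq K i' | i' <- iota 0 i]
    by rewrite count_map.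
  rewrite (mapK _ (fun k _ => k)).
  by rewrite -cats1 count_cat /= eq_sym; lia.
- move=> T; rewrite -[add_boxes _ _]/(add_boxes [seq (Ky i', i'.+1) | i' <- iota 0 i.+1] T).
  rewrite (mapK _ (fun k i => (k, i.+1))) /add_boxes foldl_rcons.
  by rewrite -addn1 iotaD map_cat foldl_cat psi /= dE add0n addn1.
- rewrite -[map _ _]/[seq Ky i' | i' <- iota 0 i.+1] (mapK _ (fun k _ => k)) rev_rcons /=.
  by rewrite (tdelta_delta Lok tx ty vx lk sA vy bwy).
Qed.

Lemma fgroup : valid x0 -> tops j x0 -> avail 1 K' S' 0 c x0 ->
  (forall a, N + c < a <= A -> wtc x0 a = 0%R) ->
  exists y K S, fstate x0 j h c N K' S' h y K S.
Proof.
move=> vx tx av sh.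
suff ex i : i <= h -> exists y K S, fstate x0 j h c N K' S' i y K S by exact: ex.
elim: i => [|i IH] ih.
  exists x0, id, (fun _ => id); split=> //; try by move=> *; exfalso; lia.
  - by move=> m; rewrite mul0n addn0.
  - by move=> a ha; apply: sh; lia.
  - by move=> a ha; rewrite /= addr0.
have [x [K [S st]]] := IH (ltnW ih).
have [y [k [s st']]] := fstep ih st.
by exists y; eexists; eexists; exact: st'.
Qed.

End Column.

(** Here i runs down from h; [K] is prescribed by the tableau and only [S] is built. Primes mark the
    chains of column j.-1, present for j > 1. *)
Record bstate (y0 : rc) (j h : nat) (K' : nat -> nat) (S' : nat -> nat -> nat) (K : nat -> nat)
    (i : nat) (x : rc) (S : nat -> nat -> nat) : Prop := BState {
  bs_valid : valid x;
  bs_tops : tops j x;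
  bs_Q : forall m, Q x A m = Q y0 A m + (h - i) * (j <= m);
  bs_prev : 1 < j -> avail 0 K' S' 0 i x;
  bs_cur : avail 0 K S i h x;
  bs_inter : inter K S i h;
  bs_mono : mono K S i h;
  bs_S : forall i' a, i <= i' < h -> K i' <= a <= A -> 0 < S i' a;
  bs_SA : forall i', i <= i' < h -> S i' A = j;
  bs_fwd : i < h -> fwdc A L x (K i) (S i);
  bs_wt : forall a, 1 <= a <= A ->
    wtc y0 a = (wtc x a + (count (fun i' => K i' == a) (index_iota i h))%:Z)%R;
  bs_psi : forall T, foldl (psi_step d n L) (Some (x, T)) [seq (j, i'.+1) | i' <- index_iota i h] =
     Some (y0, add_boxes [seq (K i', i'.+1) | i' <- index_iota i h] T);
  bs_tpsi : foldl (tpsi_step d n L) (Some y0) (rev [seq K i' | i' <- index_iota i h]) = Some x }.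

Lemma index_iota_cons i h : i < h -> index_iota i h = i :: index_iota i.+1 h.
Proof. by move=> ih; rewrite /index_iota -(prednK (n := h - i)) ?subn_gt0 //= subnS. Qed.

Section ReverseColumn.
Variables (y0 : rc) (j h c : nat) (K' : nat -> nat) (S' : nat -> nat -> nat) (K : nat -> nat).
Hypotheses (A1 : 1 <= A) (j0 : 0 < j) (cj : colh (lens (nu y0 A)) j = 0).
Hypothesis Kinc : forall p q, p < q < h -> K p < K q.
Hypothesis Kb : forall p, p < h -> 1 <= K p <= A.
Hypothesis prev : 1 < j -> [/\ h <= c, inter K' S' 0 c, mono K' S' 0 c,
  forall p, p < h -> K' p <= K p & forall p, p < c -> S' p A = j.-1].
Hypothesis S'p : 1 < j -> forall i', i' < c ->
  1 <= K' i' /\ forall a, K' i' <= a <= A -> 0 < S' i' a.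
Hypothesis wm : forall a, 1 <= a < A ->
  (wtc y0 a.+1 - (count (fun p => K p == a.+1) (iota 0 h))%:Z <=
   wtc y0 a - (count (fun p => K p == a) (iota 0 h))%:Z)%R.
Hypothesis wA : (0 <= wtc y0 A - (count (fun p => K p == A) (iota 0 h))%:Z)%R.

Arguments Kinc : clear implicits.
Arguments Kb : clear implicits.
Arguments prev : clear implicits.
Arguments S'p : clear implicits.
Arguments wm : clear implicits.

Lemma bstep i x S : i < h -> bstate y0 j h K' S' K i.+1 x S ->
  exists w s, bstate y0 j h K' S' K i w (fun i' => if i' == i then s else S i').
Proof.
move=> ih [vx tx QA pr cu il mo Sp SA fw wt psi tpsi].
have kA := Kb i ih.
have [s bc] := bchain_ex vx kA.
have next : i.+1 < h -> forall a, K i.+1 <= a.+1 <= A -> s a <= S i.+1 a.+1.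
  move=> ih'; apply: (bchain_next erefl bc (fw ih')); last by apply: Kinc; lia.
  by move=> a ha; apply: Sp => //; lia.
(* Bounded by chain i.+1; for i.+1 = h there is none, but column j of nu^(A) is still empty. *)
have sA_le : s A <= j.
  case: (ltnP i.+1 h) => ih'.
    have h1 := next ih' A.-1; rewrite prednK // SA in h1; last by lia.
    have Kl := Kinc i i.+1 ltac:(lia); have Ki := Kb i.+1 ih'.
    have := bc_mono bc (a := A.-1) ltac:(lia); rewrite prednK // => h2.
    by apply: leq_trans h2 (h1 _); lia.
  case: (leqP (s A) 1) => s1; first by lia.
  have := bc_in bc (a := A) ltac:(lia) s1 => /(map_f (fun r : rrow => r.1)) /= hr.
  rewrite -ltnS -(prednK (n := s A)) ?ltnS //; last by lia.
  rewrite ltnNge; apply/negP => js.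
  have : 0 < colh (lens (nu x A)) j by rewrite /colh -has_count; apply/hasP; exists (s A).-1.
  have := QA j; have := QA j.-1; rewrite -(prednK j0) !QE !Ql_colh prednK // cj.
  have -> : h - i.+1 = 0 by lia.
  lia.
have above : 1 < j -> forall a, K i <= a <= A -> S' i a < s a.
  move=> j1; have [hc il' mo' Kle SA'] := prev j1.
  have m1 a : K' i <= a < A -> S' i a.+1 <= S' i a by move=> ha; apply: mo' => //; lia.
  apply: (bchain_above erefl bc (Kle i ih) m1) => a ha.
  have [K1 Sa] := S'p j1 i ltac:(lia).
  apply: leq_trans (pr j1 a (S' i a) ltac:(lia) (Sa a ha)).
  by apply: (@need_mem _ _ _ _ _ _ _ i); rewrite ?addn0 //; lia.
have sA : s A = j.
  apply/eqP; rewrite eqn_leq sA_le /=.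
  case: (leqP j 1) => j1; first by have := bc_pos bc (a := A) ltac:(lia); lia.
  have [hc _ _ _ SA'] := prev j1.
  by have := above j1 A ltac:(lia); rewrite SA'; lia.
have [w [dE tw lk rw]] := tdelta_lift Lok tx vx bc sA.
have cnt a : 1 <= a <= A -> (wtc y0 a - (count (fun p => K p == a) (iota 0 h))%:Z)%R =
    (wtc x a - (count (fun p => K p == a) (iota 0 i.+1))%:Z)%R.
  move=> ha; rewrite (wt a ha); have -> : h = i.+1 + (h - i.+1) by lia.
  rewrite iotaD count_cat /index_iota add0n.
  have -> : i.+1 + (h - i.+1) - i.+1 = h - i.+1 by lia.
  lia.
have cntk : 0 < count (fun p => K p == K i) (iota 0 i.+1).
  by rewrite -has_count; apply/hasP; exists i; rewrite ?mem_iota ?eqxx //; lia.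
(* [wm] and [wA] say that the weight is a partition once the whole group is removed. The letters
   before i.+1 lie in higher rows, so the present part at [K i] exceeds the next one: this is the
   positivity at infinity. *)
have [vw fww] : valid w /\ fwdc A L w (K i) s.
  apply: (bwd_valid lk rw vx (bc_bwd bc)).
  have [B hB] := vac_inf Lok x kA; exists B => m hm; rewrite hB //.
  case: eqP => [kE|kE].
    by move: wA cntk; rewrite -kE cnt //; lia.
  have := wm (K i) ltac:(lia); rewrite !cnt; try lia.
  have -> : count (fun p => K p == (K i).+1) (iota 0 i.+1) = 0.
    apply/eqP; rewrite eqn0Ngt -has_count; apply/hasP => -[p]; rewrite mem_iota => hp /eqP Kp.
    case: (eqVneq p i) => [pi|pi]; first by rewrite pi in Kp; lia.
    by have := Kinc p i ltac:(lia); lia.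
  lia.
pose Sw i' := if i' == i then s else S i'.
have Swi : Sw i = s by rewrite /Sw eqxx.
have Swn p : p != i -> Sw p = S p by rewrite /Sw => /negbTE ->.
have ilw : inter K Sw i h.
  move=> p q pq qh; rewrite (Swn q); last by lia.
  case: (eqVneq p i) => [pi|pi]; last by rewrite Swn //; apply: il; lia.
  rewrite pi Swi; split; first by apply: Kinc; lia.
  move=> a ha; have ih' : i.+1 < h by lia.
  case: (eqVneq q i.+1) => [qE|qi]; first by rewrite qE in ha *; apply: next.
  have [h1 h2] := il i.+1 q ltac:(lia) qh.
  have n1 := next ih' a ltac:(lia).
  have n2 := mo i.+1 a ltac:(lia) ltac:(lia).
  by have := h2 a ha; lia.
have mow : mono K Sw i h.
  move=> p a hp ha; case: (eqVneq p i) => [pi|pi]; last by rewrite Swn //; apply: mo => //; lia.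
  by rewrite pi in ha *; rewrite Swi; apply: (bc_mono bc).
exists w, s; split=> //.
- move=> m; have := link_Q A m lk; rewrite /qq /act minnn sA QA.
  case/andP: kA => _ -> ->; have -> : h - i = (h - i.+1).+1 by lia.
  by rewrite mulSn /=; lia.
- move=> j1; have [hc il' mo' Kle SA'] := prev j1.
  apply: (avail_bpop lk (pr j1)) => //.
  + by move=> p q pq qi; apply: il'; lia.
  + by move=> p a hp; apply: mo'; lia.
  + exact: Kle.
  + exact: above.
  + by move=> p hp; rewrite !SA' //; lia.
- apply: (@avail_bpush _ _ K Sw i h _ _ _ _ lk) => //; last by move=> a _; rewrite Swi.
  move=> a m ha m0; apply: leq_trans (cu a m ha m0); rewrite /need.
  apply: eq_leq; apply: eq_in_count => i'; rewrite mem_index_iota => hi'.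
  by rewrite Swn //; lia.
- move=> p a hp ha; case: (eqVneq p i) => [pi|pi].
    by rewrite pi in ha; apply: (bc_pos bc).
  by apply: Sp => //; lia.
- by move=> p hp; case: eqP => // pi; apply: SA; lia.
- by rewrite eqxx.
- move=> a ha; rewrite (wt a ha) (link_wtc lk ha) [index_iota i h]index_iota_cons //=; lia.
- move=> T; rewrite index_iota_cons //=.
  by rewrite (delta_tdelta Lok tw tx vx lk sA vw fww) psi.
- rewrite index_iota_cons //= rev_cons foldl_rcons tpsi /=.
  exact: dE.
Qed.

Lemma bgroup : valid y0 -> tops j y0 -> (1 < j -> avail 0 K' S' 0 h y0) ->
  exists x S, bstate y0 j h K' S' K 0 x S.
Proof.
move=> vy ty av.
suff ex e : e <= h -> exists x S, bstate y0 j h K' S' K (h - e) x S.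
  by have := ex h (leqnn h); rewrite subnn.
elim: e => [|e IH] eh.
  rewrite subn0; exists y0, (fun _ => id); split=> //; try by move=> *; exfalso; lia.
  - by move=> m; rewrite subnn mul0n addn0.
  - by move=> a m _ _; rewrite /need /index_iota subnn.
  - by move=> a ha; rewrite /index_iota subnn /= addr0.
  - by move=> T; rewrite /index_iota subnn.
  - by rewrite /index_iota subnn.
have [x [S st]] := IH (ltnW eh).
have e1 : h - e = (h - e.+1).+1 by lia.
rewrite e1 in st.
have ih : h - e.+1 < h by lia.
have [w [s st']] := bstep ih st.
by exists w; eexists; exact: st'.
Qed.

End ReverseColumn.

End Groups.

(** * Letter counts and lattice words *)

Definition cnt (T : skewtab) r v : nat := \sum_(1 <= a < r.+1) count_mem v (trow T a).

Lemma cnt0 T v : cnt T 0 v = 0.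
Proof. by rewrite /cnt big_geq. Qed.

Lemma cntS T r v : cnt T r.+1 v = cnt T r v + count_mem v (trow T r.+1).
Proof. by rewrite /cnt big_nat_recr. Qed.

Lemma cnt_row T r v : 0 < r -> v \in trow T r -> 0 < cnt T r v.
Proof. by case: r => // r _; rewrite cntS -has_pred1 has_count; lia. Qed.

Lemma trow_default T r : size T.2 < r -> trow T r = [::].
Proof. by case: r => // r h; rewrite /trow nth_default. Qed.

Lemma cnt_flatten T r v : cnt T r v = count_mem v (flatten (take r T.2)).
Proof.
elim: r => [|r IH]; first by rewrite cnt0 take0.
rewrite cntS IH; case: (ltnP r (size T.2)) => h.
  by rewrite (take_nth [::]) // flatten_rcons count_cat.
by rewrite trow_default // addn0 !take_oversize //; lia.
Qed.

Lemma cnt_all T r v : size T.2 <= r -> cnt T r v = count_mem v (flatten T.2).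
Proof. by move=> h; rewrite cnt_flatten take_oversize. Qed.

Lemma take_flatten (ss : seq (seq nat)) m :
  exists r m', take m (flatten ss) = flatten (take r ss) ++ take m' (nth [::] ss r).
Proof.
elim: ss m => [|s ss IH] m; first by exists 0, 0.
case: (leqP m (size s)) => h.
  by exists 0, m; rewrite /= take_cat; case: ltngtP h => // -> _; rewrite subnn take0 cats0 take_size.
have [r [m' e]] := IH (m - size s); exists r.+1, m'.
by rewrite /= take_cat ltnNge (ltnW h) /= e catA.
Qed.

Lemma count_flatten_rev v (ss : seq (seq nat)) :
  count_mem v (flatten [seq rev s | s <- ss]) = count_mem v (flatten ss).
Proof. by elim: ss => //= s ss IH; rewrite !count_cat count_rev IH. Qed.

(** A prefix that ends in row r contains all letters i of the rows above r and at most the letters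
    i.+1 of the rows up to r. *)
Lemma Yam_of T : (forall r i, 1 <= i -> cnt T r i.+1 <= cnt T r.-1 i) -> Yamanouchi (rev_row_word T).
Proof.
move=> h m i i1; rewrite /rev_row_word.
have [r [m' ->]] := take_flatten [seq rev r | r <- T.2] m.
rewrite -map_take !count_cat !count_flatten_rev -!cnt_flatten.
apply: leq_trans (leq_addr _ _); apply: leq_trans (h r.+1 i i1); rewrite cntS leq_add2l.
case: (ltnP r (size T.2)) => hr; last by rewrite nth_default ?size_map.
rewrite (nth_map [::]) // -[X in _ <= X]count_rev.
by rewrite -[X in _ <= count _ X](cat_take_drop m') count_cat leq_addr.
Qed.

Lemma sorted_split i w : sorted leq w ->
  w = [seq v <- w | v <= i] ++ [seq v <- w | i < v].
Proof.
elim: w => //= v w IH pw; have := IH (path_sorted pw) => {}IH.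
case: leqP => vi /=; first by rewrite -IH.
have : all (fun u => i < u) w.
  by apply/allP => u uw; move/(order_path_min leq_trans)/allP/(_ u uw): pw; lia.
move=> hw; have -> : [seq v <- w | v <= i] = [::].
  apply/eqP; rewrite -(negbK (_ == _)) -has_filter; apply/hasP => -[u uw].
  by move/allP/(_ u uw): hw => /=; lia.
by rewrite (all_filterP hw).
Qed.

(** In a row read from right to left every i.+1 precedes every i; the prefix that stops between them
    is the extremal one. *)
Lemma Yam_to T : (forall r, sorted leq (trow T r)) -> Yamanouchi (rev_row_word T) ->
  forall r i, 1 <= i -> cnt T r i.+1 <= cnt T r.-1 i.
Proof.
move=> so ya [|r] i i1; first by rewrite !cnt0.
have E : rev_row_word T = flatten [seq rev s | s <- take r T.2] ++ flatten [seq rev s | s <- drop r T.2].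
  by rewrite -flatten_cat -map_cat cat_take_drop.
have word m : m <= size (trow T r.+1) -> exists m', take m' (rev_row_word T) =
    flatten [seq rev s | s <- take r T.2] ++ take m (rev (trow T r.+1)).
  move=> hm; exists (size (flatten [seq rev s | s <- take r T.2]) + m).
  rewrite E take_cat ltnNge leq_addr /= addKn; congr (_ ++ _).
  case: (ltnP r (size T.2)) => hr.
    rewrite (drop_nth [::]) //= take_cat -[nth _ _ _]/(trow T r.+1) size_rev; case: ltnP => // h.
    by have -> : m = size (trow T r.+1); [lia|rewrite subnn take0 cats0 -[in RHS]size_rev take_size].
  by move: hm; rewrite trow_default // drop_oversize // leqn0 => /eqP ->.
have wE := sorted_split i (so r.+1).
set w := trow T r.+1 in word wE *.
have [|m' e] := word (size [seq v <- w | i < v]); first by rewrite {2}wE size_cat leq_addl.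
have := ya m' i i1; rewrite e !count_cat !count_flatten_rev -!cnt_flatten cntS /=.
rewrite {2 4}wE rev_cat take_size_cat ?size_rev // !count_rev.
have -> : count_mem i [seq v <- w | i < v] = 0.
  by apply/count_memPn; rewrite mem_filter ltnn.
rewrite addn0; apply: leq_trans; rewrite leq_add2l -/w [X in count _ X <= _]wE count_cat.
rewrite (_ : count_mem i.+1 [seq v <- w | v <= i] = 0) //.
by apply/count_memPn; rewrite mem_filter ltnn.
Qed.

Lemma LR_rows eta la mu T : LR eta la mu T ->
  [/\ forall r, sorted leq (trow T r),
      forall r, part eta r.+1 = part la r.+1 + size (trow T r.+1),
      size eta = size T.2 &
      forall r v, v \in trow T r -> 1 <= v <= size mu].
Proof.
case=> -[pe pl Tla oe sz] pm [s1 s2] [w0 w1] ya.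
have szT : size eta = size T.2 by rewrite -oe size_map size_iota.
have vin r v : v \in trow T r -> v \in flatten T.2.
  move=> h; apply/flattenP; exists (trow T r) => //.
  by rewrite /trow mem_nth // ltnNge; apply/negP => hh; move: h; rewrite /trow nth_default.
split=> //.
- case=> [|r]; last first.
    apply/(sortedP 0) => i hi.
    have := s1 r.+1 (part T.1 r.+1 + i.+1); rewrite /in_skew /entry /=.
    have -> : part T.1 r.+1 + i.+1 - (part T.1 r.+1).+1 = i by lia.
    have -> : (part T.1 r.+1 + i.+1).+1 - (part T.1 r.+1).+1 = i.+1 by lia.
    by apply; lia.
  (* Index 0 reads the first row, because [r.-1] is truncated. *)
  have -> : trow T 0 = trow T 1 by [].
  apply/(sortedP 0) => i hi.
  have := s1 1 (part T.1 1 + i.+1); rewrite /in_skew /entry /=.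
  have -> : part T.1 1 + i.+1 - (part T.1 1).+1 = i by lia.
  have -> : (part T.1 1 + i.+1).+1 - (part T.1 1).+1 = i.+1 by lia.
  by apply; lia.
- move=> r; rewrite -Tla; case: (ltnP r (size T.2)) => hr.
    by rewrite -oe /part /= (nth_map 0) ?size_iota // nth_iota.
  rewrite trow_default // /part /= !nth_default ?szT // Tla; lia.
- move=> r v /vin vT; have v1 : 0 < v by rewrite lt0n; apply: contraNneq w0 => <-.
  by rewrite v1 /= -(part_pos pm v1) -w1 // -has_count has_pred1.
Qed.

Lemma in_skewE eta la mu T r c : LR eta la mu T ->
  in_skew T r.+1 c = (part la r.+1 < c <= part eta r.+1).
Proof.
by move=> lr; have [_ e _ _] := LR_rows lr; case: lr => -[_ _ Tla _ _] _ _ _ _; rewrite /in_skew Tla -e.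
Qed.

Lemma part_anti u a b : is_part u -> 0 < a -> a <= b -> part u b <= part u a.
Proof.
move=> pu a0 /subnK <-; elim: (b - a) => // c IH; rewrite addSn.
by apply: leq_trans (part_nonincr pu _) IH; lia.
Qed.

(** A column of a skew shape is an interval of rows, so strictness between adjacent rows
    composes. *)
Lemma col_lt eta la mu T r r' c : LR eta la mu T -> 0 < r < r' ->
  in_skew T r c -> in_skew T r' c -> entry T r c < entry T r' c.
Proof.
move=> lr /andP[r0 rr']; have [e _] := (lr, tt); have [[pe pl Tla oe sz] pm [s1 s2] _ _] := lr.
have [k ->] : exists k, r' = r.+1 + k by exists (r' - r.+1); lia.
elim: k => [|k IH] h1 h2; first by rewrite addn0 in h2 *; apply: s2.
apply: leq_trans (IH h1 _) _.
  move: h1 h2; case: r r0 {rr' IH} => // r _; rewrite addnS addSn !(in_skewE _ _ lr).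
  have := @part_anti la r.+1 (r.+1 + k).+1 pl isT ltac:(lia).
  by have := @part_nonincr eta (r.+1 + k).+1 pe isT; lia.
apply: ltnW; rewrite addnS; apply: s2; last by rewrite -addnS.
move: h1 h2; case: r r0 {rr' IH} => // r _; rewrite addnS addSn !(in_skewE _ _ lr).
have := @part_anti la r.+1 (r.+1 + k).+1 pl isT ltac:(lia).
by have := @part_nonincr eta (r.+1 + k).+1 pe isT; lia.
Qed.

Lemma LR_intro la mu T : is_part la -> T.1 = la -> size la <= size T.2 -> is_part (outer T) ->
  is_part mu -> (forall r, sorted leq (trow T r)) ->
  (forall r c, in_skew T r c -> in_skew T r.+1 c -> entry T r c < entry T r.+1 c) ->
  (forall r v, v \in trow T r -> 0 < v) ->
  (forall v, 0 < v -> cnt T (size T.2) v = part mu v) ->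
  (forall r i, 1 <= i -> cnt T r i.+1 <= cnt T r.-1 i) -> LR (outer T) la mu T.
Proof.
move=> pl Tla sz po pm so cs vp ct yc; split=> //; last exact: Yam_of.
- by split=> //; rewrite size_map size_iota.
- split=> // r c; rewrite /in_skew => /andP[r0 h1] /andP[_ h2]; rewrite /entry.
  have -> : c.+1 - (part T.1 r).+1 = (c - (part T.1 r).+1).+1 by lia.
  by move/(sortedP 0): (so r); apply; lia.
- split; last by move=> i i0; rewrite -ct // cnt_all.
  apply/negP => /flattenP[w /(nthP [::])[r hr <-]] h0.
  by have := vp r.+1 0 h0.
Qed.

(** * Adding and removing a group of boxes *)

Lemma trow_add_box k v T r : 0 < k -> 0 < r ->
  trow (add_box k v T) r = if r == k then rcons (trow T k) v else trow T r.
Proof.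
case: k => // k _; case: r => // r _.
by rewrite /trow /add_box /= nth_set_nth /= eqSS.
Qed.

Lemma size_add_box k v T : 0 < k -> size (add_box k v T).2 = maxn k (size T.2).
Proof. by case: k => // k _; rewrite /add_box /= size_set_nth. Qed.

Lemma add_boxes_inner ps T : (add_boxes ps T).1 = T.1.
Proof. by rewrite /add_boxes; elim: ps T => //= p ps IH T; rewrite IH. Qed.

Lemma trow_add_boxes ps T r : all (fun p => 0 < p.1) ps -> 0 < r ->
  trow (add_boxes ps T) r = trow T r ++ [seq p.2 | p <- ps & p.1 == r].
Proof.
rewrite /add_boxes; elim: ps T => [|p ps IH] T /=; first by rewrite cats0.
case/andP => p0 hp r0; rewrite IH // trow_add_box // eq_sym; case: (eqVneq p.1 r) => //= ->.
by rewrite cat_rcons.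
Qed.

Lemma size_add_boxes ps T : all (fun p => 0 < p.1) ps ->
  size (add_boxes ps T).2 = maxn (size T.2) (\max_(p <- ps) p.1).
Proof.
rewrite /add_boxes; elim: ps T => [|p ps IH] T /=; first by rewrite big_nil maxn0.
case/andP => p0 hp; rewrite IH // size_add_box // big_cons; lia.
Qed.

(* pairs (row, letter) *)
Definition strip (h : nat) (K : nat -> nat) : seq (nat * nat) := [seq (K i, i.+1) | i <- iota 0 h].

Definition hits (h : nat) (K : nat -> nat) (a : nat) : nat := count (fun i => K i == a) (iota 0 h).

Lemma iota_filter_inj (h : nat) (K : nat -> nat) i :
  (forall p q, p < q < h -> K p < K q) -> i < h ->
  [seq p.2 | p <- strip h K & p.1 == K i] = [:: i.+1].
Proof.
move=> Kinc ih; rewrite /strip filter_map -map_comp.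
have -> : [seq x <- iota 0 h | (preim (fun i0 => (K i0, i0.+1)) (fun p => p.1 == K i)) x] =
          [seq x <- iota 0 h | pred1 i x].
  apply: eq_in_filter => p; rewrite mem_iota => hp /=.
  case: (ltngtP p i) => [pi|pi|->]; last exact: eqxx.
    by have := Kinc p i ltac:(lia); lia.
  by have := Kinc i p ltac:(lia); lia.
by rewrite filter_pred1_uniq ?iota_uniq ?mem_iota //; lia.
Qed.

Lemma strip_out h K r : (forall i, i < h -> K i != r) -> [seq p.2 | p <- strip h K & p.1 == r] = [::].
Proof.
move=> hr; rewrite /strip filter_map -map_comp (_ : [seq x <- iota 0 h | _] = [::]) //.
apply/eqP; rewrite -(negbK (_ == _)) -has_filter; apply/hasP => -[i]; rewrite mem_iota => hi /= hK.
by have := hr i ltac:(lia); rewrite hK.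
Qed.

Section Strip.
Variables (h : nat) (K : nat -> nat) (T : skewtab).
Hypothesis Kinc : forall p q, p < q < h -> K p < K q.
Hypothesis Kpos : forall i, i < h -> 0 < K i.

Local Notation T' := (add_boxes (strip h K) T).

Lemma strip_pos : all (fun p : nat * nat => 0 < p.1) (strip h K).
Proof. by apply/allP => p /mapP[i]; rewrite mem_iota => hi -> /=; apply: Kpos; lia. Qed.

Lemma trow_strip_in i : i < h -> trow T' (K i) = rcons (trow T (K i)) i.+1.
Proof.
by move=> ih; rewrite trow_add_boxes ?strip_pos ?Kpos // iota_filter_inj // cats1.
Qed.

Lemma trow_strip_out r : 0 < r -> (forall i, i < h -> K i != r) -> trow T' r = trow T r.
Proof. by move=> r0 hr; rewrite trow_add_boxes ?strip_pos // strip_out // cats0. Qed.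

Lemma strip_cases r : (exists2 i, i < h & K i = r) \/ (forall i, i < h -> K i != r).
Proof.
case: (boolP (has (fun i => K i == r) (iota 0 h))) => [/hasP[i]|/hasPn hn].
  by rewrite mem_iota => hi /eqP hK; left; exists i => //; lia.
by right => i ih; apply: hn; rewrite mem_iota.
Qed.

Lemma hits_in i : i < h -> hits h K (K i) = 1.
Proof.
move=> ih; rewrite /hits (_ : count _ _ = count_mem i (iota 0 h)).
  by rewrite count_uniq_mem ?iota_uniq // mem_iota; have -> : 0 <= i < 0 + h by lia.
apply: eq_in_count => p; rewrite mem_iota => hp /=.
case: (ltngtP p i) => [pi|pi|->]; last exact: eqxx.
  by have := Kinc (p := p) (q := i) ltac:(lia); lia.
by have := Kinc (p := i) (q := p) ltac:(lia); lia.
Qed.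

Lemma hits_out r : (forall i, i < h -> K i != r) -> hits h K r = 0.
Proof.
move=> hr; apply/eqP; rewrite eqn0Ngt -has_count; apply/hasP => -[i]; rewrite mem_iota => hi.
by apply/negP; apply: hr; lia.
Qed.

Lemma size_trow_strip r : 0 < r -> size (trow T' r) = size (trow T r) + hits h K r.
Proof.
move=> r0; case: (strip_cases r) => [[i ih <-]|hr].
  by rewrite trow_strip_in // size_rcons hits_in // addn1.
by rewrite trow_strip_out // hits_out // addn0.
Qed.

Lemma count_strip v r : 0 < v -> 0 < r ->
  count_mem v (trow T' r) = count_mem v (trow T r) + ((v <= h) && (K v.-1 == r)).
Proof.
case: v => // v _ r0 /=; case: (strip_cases r) => [[i ih <-]|hr].
  rewrite trow_strip_in // -cats1 count_cat /= addn0 eqSS; congr (_ + nat_of_bool _).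
  case: (ltngtP i v) => [iv|iv|<-]; last by rewrite ih eqxx.
    case: (ltnP v h) => //= vh; have := Kinc (p := i) (q := v) ltac:(lia); lia.
  by have := Kinc (p := v) (q := i) ltac:(lia); lia.
rewrite trow_strip_out //; case: (ltnP v h) => vh; last by rewrite addn0.
by rewrite (negbTE (hr v vh)) addn0.
Qed.

Lemma cnt_strip v r : 0 < v -> cnt T' r v = cnt T r v + ((v <= h) && (K v.-1 <= r)).
Proof.
move=> v0; elim: r => [|r IH].
  rewrite !cnt0; case: (leqP v h) => //= vh; have := Kpos (i := v.-1) ltac:(lia); lia.
by rewrite !cntS IH count_strip //; lia.
Qed.

Lemma size_strip : size T'.2 = maxn (size T.2) (\max_(p <- strip h K) p.1).
Proof. exact: size_add_boxes strip_pos. Qed.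

Lemma size_strip_ge i : i < h -> K i <= size T'.2.
Proof.
move=> ih; rewrite size_strip leq_max; apply/orP; right.
have hin : (K i, i.+1) \in strip h K by apply: map_f; rewrite mem_iota; lia.
exact: (@leq_bigmax_seq _ _ (fun=> true) (fun p : nat * nat => p.1) (K i, i.+1) hin isT).
Qed.

Lemma size_strip_cases r : 0 < r <= size T'.2 -> r <= size T.2 \/ exists2 i, i < h & r <= K i.
Proof.
rewrite size_strip leq_max => /andP[r0 /orP[hr|hr]]; first by left.
right; have ms p : p \in strip h K -> exists2 i, i < h & p.1 = K i.
  by case/mapP => i; rewrite mem_iota => hi ->; exists i; [lia|].
move: hr; elim: (strip h K) ms => [|p ps IH] ms; first by rewrite big_nil; lia.
rewrite big_cons leq_max => /orP[hp|]; last by apply: IH => q qp; apply: ms; rewrite inE qp orbT.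
by have [i ih pE] := ms p (mem_head _ _); exists i; rewrite // -pE.
Qed.
End Strip.

Lemma part_outer T a : 0 < a ->
  part (outer T) a = if a <= size T.2 then part T.1 a + size (trow T a) else 0.
Proof.
case: a => // a _; rewrite /outer /part /=; case: ltnP => h.
  by rewrite (nth_map 0) ?size_iota // nth_iota.
by rewrite nth_default // size_map size_iota.
Qed.

Lemma size_outer T : size (outer T) = size T.2.
Proof. by rewrite size_map size_iota. Qed.

Lemma is_part_intro u : (forall a, 0 < a -> part u a.+1 <= part u a) ->
  (forall a, 0 < a <= size u -> 0 < part u a) -> is_part u.
Proof.
move=> h1 h2; apply/andP; split; first by apply/(sortedP 0) => i hi; exact: (h1 i.+1).
by apply/negP => /(nthP 0)[i hi h0]; have := h2 i.+1 hi; rewrite /part /= h0.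
Qed.

(** A column of height h attached on the left of mu. *)
Definition stack (h : nat) (mu : seq nat) : seq nat := [seq (part mu i).+1 | i <- iota 1 h].

Lemma part_stack h mu i : 0 < i -> size mu <= h ->
  part (stack h mu) i = part mu i + (i <= h).
Proof.
case: i => // i _ hm; rewrite /stack /part /=; case: ltnP => ih.
  by rewrite (nth_map 0) ?size_iota // nth_iota // add1n addn1.
by rewrite !nth_default ?size_map ?size_iota //; lia.
Qed.

Lemma is_part_stack h mu : is_part mu -> size mu <= h -> is_part (stack h mu).
Proof.
move=> pm hm; apply: is_part_intro => a; first by move=> a0; rewrite !part_stack //; have := part_nonincr pm a0; lia.
by rewrite /stack size_map size_iota => ha; rewrite part_stack //; lia.
Qed.

Lemma sorted_rcons_leq w x : sorted leq w -> (forall v, v \in w -> v <= x) -> sorted leq (rcons w x).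
Proof. by case: w => //= a w; rewrite rcons_path => -> h; apply: h; exact: mem_last. Qed.

Section Add.
Variables (eta la mu : seq nat) (T : skewtab) (h : nat) (K : nat -> nat).
Hypothesis lr : LR eta la mu T.
Hypothesis hmu : size mu <= h.
Hypothesis Kinc : forall p q, p < q < h -> K p < K q.
Hypothesis Kpos : forall i, i < h -> 0 < K i.
Hypothesis Kfirst : forall i r, i < h -> 0 < cnt T r i.+1 -> K i <= r.
Hypothesis Kshape : forall a, 0 < a -> part eta a.+1 + hits h K a.+1 <= part eta a + hits h K a.

Local Notation T' := (add_boxes (strip h K) T).

Lemma part_outer_strip a : 0 < a -> part (outer T') a = part eta a + hits h K a.
Proof.
move=> a0; have [_ e sz _] := LR_rows lr; have [[pe pl Tla oe sle] _ _ _ _] := lr.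
rewrite part_outer // add_boxes_inner Tla size_trow_strip //.
case: leqP => ha; first by have := e a.-1; rewrite prednK //; lia.
have sT := size_strip T Kpos.
have -> : part eta a = 0.
  by apply/eqP; rewrite -leqn0 leqNgt (part_pos pe a0) sz; lia.
by rewrite hits_out // => i ih; have := size_strip_ge T Kpos ih; lia.
Qed.

Lemma strip_anti a b : 0 < a -> a <= b -> part eta b + hits h K b <= part eta a + hits h K a.
Proof.
move=> a0 /subnK <-; elim: (b - a) => // c IH; rewrite addSn.
by apply: leq_trans (Kshape _) IH; lia.
Qed.

Lemma is_part_outer_strip : is_part (outer T').
Proof.
have [_ e sz _] := LR_rows lr; have [[pe pl Tla oe sle] _ _ _ _] := lr.
apply: is_part_intro => a; first by move=> a0; rewrite !part_outer_strip //; exact: Kshape.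
rewrite size_outer => ha; rewrite part_outer_strip; last by lia.
case: (size_strip_cases Kpos ha) => [h1|[i ih aK]].
  by have := part_pos pe (a := a) ltac:(lia); rewrite sz; lia.
by have := strip_anti (a := a) ltac:(lia) aK; rewrite (hits_in Kinc ih); lia.
Qed.

(** [Kfirst] gives [K v.-1 <= r <= K i], and strict growth of [K] bounds v. *)
Lemma letter_above i r v : i < h -> r <= K i -> 0 < r -> v \in trow T r ->
  v <= i.+1 /\ (r < K i -> v <= i).
Proof.
move=> ih rK r0 vr; have [_ _ _ vb] := LR_rows lr; have v1 := vb r v vr.
have c1 := cnt_row r0 vr.
have := Kfirst (i := v.-1) (r := r); rewrite prednK; last by lia.
move=> /(_ ltac:(lia) c1) Kv.
split=> [|rK']; rewrite leqNgt; apply/negP => iv.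
  by have := Kinc (p := i) (q := v.-1) ltac:(lia); lia.
case: (eqVneq i v.-1) => [iE|ne]; first by rewrite -iE in Kv; lia.
by have := Kinc (p := i) (q := v.-1) ltac:(lia); lia.
Qed.

Lemma entry_old r c : 0 < r -> part la r < c <= part eta r -> entry T' r c = entry T r c.
Proof.
move=> r0 hc; have [_ e _ _] := LR_rows lr; have [[pe pl Tla oe sle] _ _ _ _] := lr.
rewrite /entry add_boxes_inner trow_add_boxes ?strip_pos // nth_cat Tla.
by have := e r.-1; rewrite prednK // => er; rewrite ifT //; lia.
Qed.

Lemma entry_new i : i < h -> entry T' (K i) (part eta (K i)).+1 = i.+1.
Proof.
move=> ih; have [_ e _ _] := LR_rows lr; have [[pe pl Tla oe sle] _ _ _ _] := lr.
rewrite /entry add_boxes_inner trow_strip_in // nth_rcons Tla.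
have := e (K i).-1; rewrite prednK ?Kpos // => er.
have -> : (part eta (K i)).+1 - (part la (K i)).+1 = size (trow T (K i)) by lia.
by rewrite ltnn eqxx.
Qed.

Lemma in_skew_strip r c : in_skew T' r c = (0 < r) && (part la r < c <= part eta r + hits h K r).
Proof.
have [_ e _ _] := LR_rows lr; have [[pe pl Tla oe sle] _ _ _ _] := lr.
rewrite /in_skew add_boxes_inner Tla; case: r => // r; rewrite size_trow_strip //.
by rewrite addnA -e.
Qed.

Lemma cnt_strip_first i r : i < h -> (0 < cnt T' r i.+1) = (K i <= r).
Proof.
move=> ih; rewrite cnt_strip //= ih /=.
case: (leqP (K i) r) => kr; first by rewrite addn1.
rewrite addn0; apply/negP => c0; have := Kfirst ih c0; lia.
Qed.

Lemma LR_add : LR (outer T') la (stack h mu) T'.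
Proof.
have [so e sz vb] := LR_rows lr; have [[pe pl Tla oe sle] pm ss [w0 w1] ya] := lr.
have yc := Yam_to so ya.
apply: LR_intro => //.
- by rewrite add_boxes_inner.
- by rewrite (size_strip T Kpos); lia.
- exact: is_part_outer_strip.
- exact: is_part_stack.
- suff pos r : 0 < r -> sorted leq (trow T' r).
    by case=> [|r]; [exact: (pos 1)|exact: pos].
  move=> r0; case: (strip_cases h K r) => [[i ih Ki]|hr]; last by rewrite trow_strip_out.
  rewrite -Ki trow_strip_in //; apply: sorted_rcons_leq => [//|v hv].
  by have [] := letter_above ih (leqnn _) (Kpos ih) hv.
- move=> r c; rewrite !in_skew_strip => /andP[r0 h1] /andP[_ h2].
  have eta_r := part_nonincr pe r0; have la_r := part_nonincr pl r0.
  have hits1 q : hits h K q <= 1.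
    by case: (strip_cases h K q) => [[i ih <-]|hq]; rewrite ?hits_in ?hits_out.
  (* Old or new box in row r, above an old or new box in row r.+1. A new box above an old one cannot
     occur, as eta is a partition. *)
  case: (leqP c (part eta r)) => c1; case: (leqP c (part eta r.+1)) => c2.
  + rewrite !entry_old //; try lia.
    by case: ss => _; apply; rewrite /in_skew Tla; have := e r.-1; have := e r; rewrite ?prednK //; lia.
  + case: (strip_cases h K r.+1) => [[i ih Ki]|hr]; last by move: h2; rewrite hits_out //; lia.
    have cE : c = (part eta r.+1).+1 by have := hits1 r.+1; lia.
    rewrite entry_old; try lia.
    rewrite cE -Ki entry_new // ltnS.
    have vr : entry T r (part eta (K i)).+1 \in trow T r.
      have er : part eta r = part la r + size (trow T r) by have := e r.-1; rewrite prednK.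
      have szr : c - (part la r).+1 < size (trow T r) by lia.
      by rewrite /entry Tla Ki -cE; apply: mem_nth.
    have rK : r <= K i by lia.
    by have [_ le] := letter_above ih rK r0 vr; apply: le; lia.
  + lia.
  + case: (strip_cases h K r.+1) => [[i ih Ki]|hr]; last by move: h2; rewrite hits_out //; lia.
    case: (strip_cases h K r) => [[i' ih' Ki']|hr']; last by move: h1; rewrite hits_out //; lia.
    have cE : c = (part eta r.+1).+1 by have := hits1 r.+1; lia.
    have cE' : c = (part eta r).+1 by have := hits1 r; lia.
    rewrite {1}cE' cE -Ki -Ki' !entry_new // ltnS.
    rewrite ltnNge; apply/negP; rewrite leq_eqVlt => /orP[/eqP ii|ii]; first by rewrite ii in Ki; lia.
    by have := Kinc (p := i) (q := i') ltac:(lia); lia.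
- move=> r v; case: r => [|r].
    by rewrite -[trow T' 0]/(trow T' 1) trow_add_boxes ?strip_pos // mem_cat => /orP[/vb|/mapP[p]]; [lia|rewrite mem_filter => /andP[_ /mapP[i _ ->]] ->].
  by rewrite trow_add_boxes ?strip_pos // mem_cat => /orP[/vb|/mapP[p]]; [lia|rewrite mem_filter => /andP[_ /mapP[i _ ->]] ->].
- move=> v v0; rewrite cnt_strip // part_stack //.
  rewrite cnt_all; last by rewrite (size_strip T Kpos); lia.
  rewrite w1 //; case: (leqP v h) => //= vh.
  by rewrite (size_strip_ge T Kpos) //; lia.
(* Lattice condition: the new i.+1 lies strictly below the new i. *)
move=> r i i1; rewrite !cnt_strip //=; have := yc r i i1.
case: (leqP i.+1 h) => ih /=; last by lia.
rewrite (ltnW ih) /=; have := Kinc (p := i.-1) (q := i) ltac:(lia).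
have := Kpos (i := i.-1) ltac:(lia); lia.
Qed.

End Add.

(** What remains of mu without its first j columns. *)
Definition cut (j : nat) (mu : seq nat) : seq nat := [seq b <- [seq x - j | x <- mu] | 0 < b].

Lemma part_cut j mu i : is_part mu -> 0 < i -> part (cut j mu) i = part mu i - j.
Proof.
case: i => // i /andP[so _] _; rewrite /part /cut /=.
elim: mu so i => [|x mu IH] so i; first by rewrite /= !nth_nil.
move: so => /= so; case: ltnP => h; first by case: i => //= i; rewrite IH // (path_sorted so).
have hall : [seq b <- [seq x - j | x <- mu] | 0 < b] = [::].
  apply/eqP; rewrite -(negbK (_ == _)) -has_filter; apply/hasP => -[b /mapP[y ymu ->]].
  by move/(order_path_min geq_trans)/allP/(_ y ymu): so => /=; lia.
rewrite hall nth_nil; case: i => [|i] /=; first by lia.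
case: (ltnP i (size mu)) => hi; last by rewrite nth_default.
by move/(order_path_min geq_trans)/allP/(_ _ (mem_nth 0 hi)): so => /=; lia.
Qed.

Lemma is_part_cut j mu : is_part mu -> is_part (cut j mu).
Proof.
move=> /andP[so _]; rewrite /is_part mem_filter andbT; apply: sorted_filter; first exact: geq_trans.
by rewrite sorted_map; apply: sub_sorted so => x y /=; lia.
Qed.

Lemma positive_prefix (f : nat -> nat) N : (forall r, 0 < r -> f r.+1 <= f r) ->
  (forall r, N < r -> f r = 0) -> exists2 m, m <= N & forall r, 0 < r -> (0 < f r) = (r <= m).
Proof.
move=> mono; elim: N => [|N IH] hN.
  by exists 0 => // r r0; rewrite hN //; lia.
have anti a b : 0 < a -> a <= b -> f b <= f a.
  move=> a0 /subnK <-; elim: (b - a) => // c IHc; rewrite addSn.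
  by apply: leq_trans (mono _ _) IHc; lia.
case: (posnP (f N.+1)) => f0.
  case: IH => [r hr|m mN hm]; last by exists m => //; lia.
  by case: (eqVneq r N.+1) => [->//|rN]; apply: hN; lia.
exists N.+1 => // r r0; case: (leqP r N.+1) => hr; last by rewrite hN.
by apply: leq_trans f0 (anti _ _ r0 hr).
Qed.

(** * Removing the first group from a tableau *)

Section Remove.
Variables (eta la mu : seq nat) (T : skewtab).
Hypothesis lr : LR eta la mu T.
Local Notation h := (size mu).

(** In an LR tableau the rightmost occurrence of a letter is the topmost one, so the first group can
    be found by rows. *)
Definition frow (i : nat) : nat := (find (fun w : seq nat => i.+1 \in w) T.2).+1.
Local Notation K := frow.

Lemma frow_cnt i r : i < h -> (0 < cnt T r i.+1) = (K i <= r).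
Proof.
move=> ih; have [[pe pl Tla oe sle] pm ss [w0 w1] ya] := lr.
have memE (ss' : seq (seq nat)) : (i.+1 \in flatten ss') = has (fun w : seq nat => i.+1 \in w) ss'.
  by apply/flattenP/hasP => -[w h1 h2]; exists w.
rewrite cnt_flatten -has_count has_pred1 memE has_take // -memE -has_pred1 has_count w1 //.
by rewrite part_pos.
Qed.

(** By the lattice condition an occurrence of a letter requires its predecessor in a strictly higher
    row. *)
Lemma frow_inc p q : p < q < h -> K p < K q.
Proof.
have [[pe pl Tla oe sle] pm ss [w0 w1] ya] := lr; have [so _ _ _] := LR_rows lr.
move=> /andP[/subnK <-]; elim: (q - p.+1) => [|c IH] qh.
  rewrite add0n in qh *; have := Yam_to so ya (K p.+1) (i := p.+1) isT.
  have := frow_cnt (K p.+1) qh; rewrite leqnn => c1 c2.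
  have := frow_cnt (K p.+1).-1 (ltnW qh); rewrite (leq_trans c1 c2) => /esym; rewrite /frow; lia.
rewrite addSn in qh *; have := IH (ltnW qh).
have := Yam_to so ya (K (c + p.+1).+1) (i := (c + p.+1).+1) isT.
have := frow_cnt (K (c + p.+1).+1) qh; rewrite leqnn => c1 c2.
have := frow_cnt (K (c + p.+1).+1).-1 (ltnW qh); rewrite (leq_trans c1 c2) => /esym; rewrite /frow; lia.
Qed.

Lemma frow_pos i : 0 < K i.
Proof. by []. Qed.

Lemma frow_size i : i < h -> K i <= size T.2.
Proof.
move=> ih; rewrite -frow_cnt // cnt_all //; have [[pe pl Tla oe sle] pm ss [w0 w1] ya] := lr.
by rewrite w1 // part_pos.
Qed.

(** A larger letter in this row would have its first row here or higher, against [frow_inc]. *)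
Lemma frow_last i : i < h -> exists w, trow T (K i) = rcons w i.+1.
Proof.
move=> ih; have [so _ _ vb] := LR_rows lr.
have c1 : 0 < cnt T (K i) i.+1 by rewrite frow_cnt.
have c0 : cnt T (K i).-1 i.+1 = 0.
  by apply/eqP; rewrite eqn0Ngt frow_cnt //; rewrite /frow; lia.
have im : i.+1 \in trow T (K i).
  by move: c1; rewrite -{1}(prednK (frow_pos i)) cntS prednK // c0 -has_count has_pred1.
have bd v : v \in trow T (K i) -> v <= i.+1.
  move=> vr; rewrite leqNgt; apply/negP => iv; have := vb _ v vr => vh.
  have := cnt_row (frow_pos i) vr; rewrite -(prednK (n := v)); last by lia.
  rewrite frow_cnt; last by lia.
  by have := @frow_inc i v.-1 ltac:(lia); lia.
have := so (K i); move: im bd; case/lastP: (trow T (K i)) => [//|w x] im bd sw; exists w.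
congr (rcons _ _); apply/eqP; rewrite eqn_leq bd ?mem_rcons ?mem_head //=.
move: im; rewrite mem_rcons inE => /orP[/eqP -> //|iw].
move: sw; rewrite -rev_sorted rev_rcons /= => /(order_path_min (fun a b c h1 h2 => leq_trans h2 h1)).
by move/allP/(_ i.+1); rewrite mem_rev; apply.
Qed.

Let f r := part eta r - hits h K r.

Lemma hits_le r : 0 < r -> part la r + hits h K r <= part eta r.
Proof.
move=> r0; have [_ e _ _] := LR_rows lr; have := e r.-1; rewrite prednK // => ->; rewrite leq_add2l.
case: (strip_cases h K r) => [[i ih Ki]|hr]; last by rewrite hits_out.
have [w wE] := frow_last ih.
by rewrite -Ki (hits_in frow_inc ih) wE size_rcons.
Qed.

(** The danger is a removed box above a box that stays. The letter of the lower box is larger, so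
    its first row is below r; since it occurs in row r.+1 it starts there, and row r.+1 loses its
    last box too. *)
Lemma remove_shape r : 0 < r -> f r.+1 <= f r.
Proof.
move=> r0; have [[pe pl Tla oe sle] pm [s1 s2] [w0 w1] ya] := lr; have [so e _ vb] := LR_rows lr.
have er := part_nonincr pe r0; have lar := part_nonincr pl r0.
have hle := hits_le r0; rewrite /f.
case: (strip_cases h K r) => [[i ih Ki]|hr]; last by rewrite (hits_out hr); lia.
have Hr : hits h K r = 1 by rewrite -Ki (hits_in frow_inc ih).
rewrite Hr in hle *; case: (strip_cases h K r.+1) => [[i' ih' Ki']|hr'].
  have -> : hits h K r.+1 = 1 by rewrite -Ki' (hits_in frow_inc ih').
  lia.
rewrite (hits_out hr') subn0.
case: (eqVneq (part eta r.+1) (part eta r)) => [ee|ne]; last by lia.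
exfalso; have e1 := e r.-1; have e2 := e r; rewrite prednK // in e1.
have [w wE] := frow_last ih; rewrite Ki in wE.
have := s2 r (part eta r); rewrite /in_skew Tla /entry Tla.
have -> : part eta r - (part la r).+1 = size w by rewrite e1 wE size_rcons; lia.
have nw : nth 0 (trow T r) (size w) = i.+1 by rewrite wE nth_rcons ltnn eqxx.
rewrite nw => /(_ ltac:(lia) ltac:(lia)).
have szr : part eta r - (part la r.+1).+1 < size (trow T r.+1) by lia.
set v := nth _ _ _ => iv; have vr : v \in trow T r.+1 by exact: mem_nth.
have vh := vb _ _ vr; have := cnt_row (ltn0Sn r) vr.
rewrite -(prednK (n := v)) ?frow_cnt; try lia.
have := @frow_inc i v.-1 ltac:(lia); rewrite Ki => k1 k2.
by have /negP := hr' v.-1 ltac:(lia); apply; apply/eqP; lia.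
Qed.

Lemma LR_remove : exists T0, [/\ LR (outer T0) la (cut 1 mu) T0,
  T = add_boxes (strip h K) T0 &
  forall a, 0 < a -> part eta a = part (outer T0) a + hits h K a].
Proof.
have [[pe pl Tla oe sle] pm [s1 s2] [w0 w1] ya] := lr; have [so e sz vb] := LR_rows lr.
(* Rows that become empty beyond the inner shape are dropped, as shapes list nonzero parts only; [m]
   rows remain. *)
have [|m mN hm] := @positive_prefix f (size eta) remove_shape.
  by move=> r hr; rewrite /f; case: r hr => // r hr; rewrite /part nth_default.
pose row r := take (size (trow T r) - hits h K r) (trow T r).
pose T0 : skewtab := (la, [seq row r | r <- iota 1 m]).
have szrow r : 0 < r -> size (row r) = size (trow T r) - hits h K r.
  by move=> r0; rewrite size_take; case: ltnP => //; lia.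
have tr r : 0 < r -> trow T0 r = row r.
  case: r => // r _; rewrite /trow /T0 /=; case: (ltnP r m) => rm.
    by rewrite (nth_map 0) ?size_iota // nth_iota.
  rewrite nth_default ?size_map ?size_iota //; apply/esym/nilP; rewrite /nilp szrow //.
  by have := hm r.+1 isT; rewrite /f; have := e r; have := hits_le (ltn0Sn r); lia.
have rowE r : 0 < r -> trow T r = row r ++ [seq p.2 | p <- strip h K & p.1 == r].
  move=> r0; rewrite /row; case: (strip_cases h K r) => [[i ih Ki]|hr].
    rewrite -Ki (iota_filter_inj frow_inc ih) (hits_in frow_inc ih).
    have [w ->] := frow_last ih.
    by rewrite size_rcons subn1 /= -cats1 take_size_cat.
  by rewrite hits_out // strip_out // subn0 take_size cats0.
have TE : T = add_boxes (strip h K) T0.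
  have Kp i : i < h -> 0 < K i by [].
  rewrite [LHS]surjective_pairing [RHS]surjective_pairing add_boxes_inner Tla; congr (_, _).
  have szE : size T.2 = size (add_boxes (strip h K) T0).2.
    apply/eqP; rewrite eqn_leq; apply/andP; split.
      case sT : (size T.2) => [//|q].
      have f1 : 0 < part eta q.+1 by rewrite part_pos // sz sT.
      case: (strip_cases h K q.+1) => [[i ih <-]|hr]; first exact: (size_strip_ge T0 Kp ih).
      have : 0 < f q.+1 by rewrite /f hits_out // subn0.
      by rewrite hm // (size_strip T0 Kp) /= size_map size_iota; lia.
    case sT : (size _) => [//|q].
    have [] := @size_strip_cases h K T0 Kp q.+1; first by rewrite sT ltnSn.
      by rewrite /= size_map size_iota; lia.
    by move=> [i ih hq]; have := frow_size ih; lia.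
  apply: (@eq_from_nth _ [::]) => // r _.
  have := @trow_add_boxes (strip h K) T0 r.+1 (strip_pos Kp) isT.
  by rewrite tr // -rowE // /trow /= => ->.
have cE r v : 0 < v -> cnt T r v = cnt T0 r v + ((v <= h) && (K v.-1 <= r)).
  by move=> v0; rewrite {1}TE; apply: cnt_strip => //; exact: frow_inc.
(* Each partial count drops by one exactly when it is positive; weight and lattice condition of [T0]
   follow from this form. *)
have cE2 r v : 0 < v -> cnt T0 r v = cnt T r v - (0 < cnt T r v).
  move=> v0; rewrite (cE r v v0); case: (leqP v h) => vh.
    have := frow_cnt (i := v.-1) r; rewrite prednK // => /(_ vh).
    by rewrite (cE r v v0) vh /=; case: (K v.-1 <= r) => /=; lia.
  rewrite addn0 /=; suff : cnt T r v = 0 by rewrite (cE r v v0); lia.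
  apply/eqP; rewrite -leqn0 -(_ : count_mem v (flatten T.2) = 0).
    by rewrite cnt_flatten -{2}(cat_take_drop r T.2) flatten_cat count_cat leq_addr.
  by rewrite w1 //; apply/eqP; rewrite eqn0Ngt part_pos // -ltnNge.
have po a : 0 < a -> part (outer T0) a = f a.
  move=> a0; rewrite part_outer //= size_map size_iota.
  case: leqP => am; last first.
    by apply/esym/eqP; rewrite eqn0Ngt hm //; lia.
  rewrite tr // szrow // /f; have := e a.-1; rewrite prednK // => ->.
  by have := hits_le a0; have := e a.-1; rewrite prednK //; lia.
have lr0 : LR (outer T0) la (cut 1 mu) T0.
  apply: LR_intro => //.
  - rewrite /= size_map size_iota; case sl : (size la) => [//|q].
    rewrite -hm // /f; have := hits_le (ltn0Sn q).
    by have := part_pos pl (ltn0Sn q); rewrite sl ltnSn; lia.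
  - apply: is_part_intro => a; first by move=> a0; rewrite !po //; exact: remove_shape.
    by rewrite size_outer /= size_map size_iota => /andP[a0 am]; rewrite po // hm.
  - exact: is_part_cut.
  - by case=> [|r]; [rewrite -[trow T0 0]/(trow T0 1)|]; rewrite tr //; exact: take_sorted.
  - move=> r c; rewrite /in_skew /entry => /andP[r0]; rewrite !tr // !szrow // => h1 /andP[_ h2].
    rewrite /row !nth_take; try by move: h1 h2 => /=; lia.
    have := s2 r c; rewrite /in_skew /entry Tla; apply; move: h1 h2 => /=; lia.
  - move=> r v; have [q [q0 ->]] : exists q, 0 < q /\ trow T0 r = row q.
      by case: r => [|r]; [exists 1; rewrite -[trow T0 0]/(trow T0 1)|exists r.+1]; rewrite tr.
    by move/mem_take/vb; lia.
  - move=> v v0; rewrite part_cut // -w1 // -[in RHS](@cnt_all T (size T.2 + m)); last by lia.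
    rewrite cnt_all // -(@cnt_all T0 (size T.2 + m)); last by rewrite /= size_map size_iota; lia.
    by rewrite cE2 //; lia.
  move=> r i i1; rewrite !cE2 //; have := Yam_to so ya r i1; lia.
exists T0; split=> // a a0; rewrite po // /f; have := hits_le a0; lia.
Qed.

End Remove.

(** * Groups of cells *)

(** Stated for every sufficient fuel, so that peeling a group reduces it to the smaller tableau. *)
Definition steps_ok (T : skewtab) (st : seq nat) : Prop := forall f, size (cells T) <= f ->
  flatten [seq [seq c.2.1 | c <- rev g] | g <- groups f (cells T)] = st.

Definition row_cells (T : skewtab) r : seq cell :=
  [seq (entry T r c, (r, c)) | c <- iota (part T.1 r).+1 (size (trow T r))].

Lemma cellsE T : cells T = flatten [seq row_cells T r | r <- iota 1 (size T.2)].
Proof. by []. Qed.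

Lemma mem_cells T v r c : ((v, (r, c)) \in cells T) = in_skew T r c && (v == entry T r c).
Proof.
apply/flattenP/andP => [[w /mapP[q hq ->] /mapP[e he [-> -> ->]]]|[hs /eqP ->]].
  move: hq he; rewrite !mem_iota /in_skew => hq he; split=> //; lia.
have rT : r <= size T.2.
  rewrite leqNgt; apply/negP => hr; move: hs; rewrite /in_skew trow_default //=; lia.
move: hs; rewrite /in_skew => /andP[r0 hc]; exists (row_cells T r).
  by apply: map_f; rewrite mem_iota; lia.
by apply/mapP; exists c => //; rewrite mem_iota; lia.
Qed.

Lemma entry_mem T r c : in_skew T r c -> entry T r c \in trow T r.
Proof.
rewrite /in_skew /entry => hs; have h : c - (part T.1 r).+1 < size (trow T r) by lia.
exact: mem_nth.
Qed.

Lemma head_sort_max (s : seq cell) (m x0 : cell) : m \in s ->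
  (forall c : cell, c \in s -> c != m -> c.2.2 < m.2.2) ->
  head x0 (sort (fun c c' : cell => c'.2.2 <= c.2.2) s) = m.
Proof.
move=> ms hm; set le := (fun c c' : cell => _).
have tot : total le by move=> a b; rewrite /le; lia.
have tr : transitive le by move=> a b c; rewrite /le; lia.
have so := sort_sorted tot s.
case sE : (sort le s) => [|a t]; first by move: ms; rewrite -(mem_sort le) sE.
rewrite /=; apply/eqP; apply/negPn/negP => am.
have as' : a \in s by rewrite -(mem_sort le) sE mem_head.
have := hm a as' am; have : m \in a :: t by rewrite -sE mem_sort.
rewrite inE eq_sym (negbTE am) /= => mt; move: so; rewrite sE /= => /(order_path_min tr)/allP/(_ m mt).
by rewrite /le; lia.
Qed.

Section Steps.
Variables (eta la mu : seq nat) (T : skewtab) (h : nat) (K : nat -> nat).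
Hypothesis lr : LR eta la mu T.
Hypothesis h0 : 0 < h.
Hypothesis hmu : size mu <= h.
Hypothesis Kinc : forall p q, p < q < h -> K p < K q.
Hypothesis Kpos : forall i, i < h -> 0 < K i.
Hypothesis Kfirst : forall i r, i < h -> 0 < cnt T r i.+1 -> K i <= r.
Hypothesis Kshape : forall a, 0 < a -> part eta a.+1 + hits h K a.+1 <= part eta a + hits h K a.

Local Notation T' := (add_boxes (strip h K) T).

Let corner i : cell := (i.+1, (K i, (part eta (K i)).+1)).

Lemma corner_mem i : i < h -> corner i \in cells T'.
Proof.
move=> ih; rewrite /corner mem_cells (entry_new lr) // eqxx andbT.
rewrite (in_skew_strip lr) // (hits_in Kinc ih) Kpos //=.
have [_ e _ _] := LR_rows lr; have := e (K i).-1; rewrite prednK ?Kpos //; lia.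
Qed.

(** Any other i.+1 is further left in the same row or in a lower row; the latter is not further
    right, and the same column is excluded by column strictness. *)
Lemma rightmost_strip i : i < h -> rightmost (cells T') i.+1 = corner i.
Proof.
move=> ih; rewrite /rightmost; apply: head_sort_max.
  by rewrite mem_filter corner_mem // eqxx.
move=> [v [r c]]; rewrite mem_filter => /andP[/= /eqP ->]; rewrite mem_cells => /andP[hs /eqP ve] ne.
have lr' := LR_add lr hmu Kinc Kpos Kfirst Kshape.
have hsk := hs; rewrite (in_skew_strip lr) // in hsk.
have r0 : 0 < r by case/andP: hsk.
have vr : i.+1 \in trow T' r.
  by rewrite ve; exact: entry_mem.
have Kr : K i <= r.
  by have := cnt_row r0 vr; rewrite (cnt_strip_first hmu Kinc Kpos Kfirst).
have hK := hits_in Kinc ih.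
have anti := strip_anti hmu Kshape (Kpos ih) Kr; rewrite hK in anti.
case: (eqVneq r (K i)) => [rK|rK].
  rewrite rK hK in hsk; rewrite ltn_neqAle; apply/andP; split; last by lia.
  by apply: contraNneq ne => ->; rewrite rK.
rewrite ltn_neqAle; apply/andP; split; last by lia.
apply/eqP => cE; have hc := corner_mem ih; rewrite mem_cells in hc.
case/andP: hc => hc /eqP hce.
have := col_lt (r := K i) (r' := r) lr' _ hc; rewrite -cE -ve cE -hce ltnn => hh.
by have := hh ltac:(have := Kpos ih; lia); rewrite -cE => /(_ hs).
Qed.

Lemma max_letter : \max_(c <- cells T') c.1 = h.
Proof.
apply/eqP; rewrite eqn_leq; apply/andP; split.
  apply/bigmax_leqP_seq => -[v [r c]]; rewrite mem_cells => /andP[hs /eqP ->] _ /=.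
  have lr' := LR_add lr hmu Kinc Kpos Kfirst Kshape; have [_ _ _ vb] := LR_rows lr'.
  have vr : entry T' r c \in trow T' r by exact: entry_mem.
  by have := vb _ _ vr; rewrite /stack size_map size_iota; lia.
have hc := @corner_mem h.-1 ltac:(lia).
have := @leq_bigmax_seq _ (cells T') (fun=> true) (fun c : cell => c.1) _ hc isT.
by rewrite /= prednK.
Qed.

Lemma first_group_strip : first_group (cells T') = [seq corner i | i <- iota 0 h].
Proof.
rewrite /first_group max_letter -[1]addn0 iotaDl -map_comp; apply/eq_in_map => i.
by rewrite mem_iota => hi /=; rewrite rightmost_strip //; lia.
Qed.

Lemma cells_strip : [seq c <- cells T' | c \notin first_group (cells T')] = cells T.
Proof.
have [_ e sz _] := LR_rows lr; have [[pe pl Tla oe sle] _ _ _ _] := lr.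
have notin v r c : c <= part eta r -> (v, (r, c)) \notin first_group (cells T').
  move=> hc; rewrite first_group_strip; apply/mapP => -[i _ [_ rE cE]]; move: hc; rewrite cE -rE.
  by rewrite ltnn.
have rowE r : 0 < r -> [seq c <- row_cells T' r | c \notin first_group (cells T')] = row_cells T r.
  move=> r0; have er : part eta r = part la r + size (trow T r) by have := e r.-1; rewrite prednK.
  have old : [seq c <- [seq (entry T' r c, (r, c)) | c <- iota (part la r).+1 (size (trow T r))]
      | c \notin first_group (cells T')] = row_cells T r.
    rewrite (_ : filter _ _ = [seq (entry T' r c, (r, c)) | c <- iota (part la r).+1 (size (trow T r))]); last first.
      apply/all_filterP/allP => x /mapP[c]; rewrite mem_iota => hc ->; apply: notin; lia.
    rewrite /row_cells Tla; apply/eq_in_map => c; rewrite mem_iota => hc.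
    by rewrite (entry_old lr) //; lia.
  rewrite /row_cells add_boxes_inner Tla (size_trow_strip T Kinc Kpos r0).
  rewrite iotaD map_cat filter_cat old.
  rewrite -[in RHS]Tla -/(row_cells T r).
  case: (strip_cases h K r) => [[i ih Ki]|hr]; last by rewrite (hits_out hr) /= cats0.
  have -> : hits h K r = 1 by rewrite -Ki (hits_in Kinc ih).
  have -> : (part la r).+1 + size (trow T r) = (part eta r).+1 by lia.
  rewrite -{}Ki /= (entry_new lr) // first_group_strip.
  have -> : (i.+1, (K i, (part eta (K i)).+1)) \in [seq corner i | i <- iota 0 h].
    by apply: map_f; rewrite mem_iota; lia.
  by rewrite cats0.
rewrite {1}cellsE filter_flatten -map_comp.
have -> : [seq ([eta filter (fun c : cell => c \notin first_group (cells T'))] \o row_cells T') r | r <- iota 1 (size T'.2)] =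
   [seq row_cells T r | r <- iota 1 (size T'.2)].
  by apply/eq_in_map => r; rewrite mem_iota /= => hr; rewrite rowE //; lia.
have -> : size T'.2 = size T.2 + (size T'.2 - size T.2).
  by rewrite subnKC // (size_strip T Kpos) leq_maxl.
rewrite iotaD map_cat flatten_cat -cellsE -[RHS]cats0; congr (_ ++ _).
apply/nilP; rewrite /nilp size_flatten /shape -map_comp sumnE big_map big1_seq // => r.
by rewrite mem_iota => hr /=; rewrite /row_cells trow_default //; lia.
Qed.

Lemma size_cells_lt : size (cells T) < size (cells T').
Proof.
rewrite -cells_strip -{2}(cat_take_drop 0 (cells T')) size_filter take0 drop0 /=.
rewrite ltn_neqAle count_size andbT -all_count -has_predC; apply/hasP.
exists (corner 0); first by apply: corner_mem.
rewrite /= negbK first_group_strip; apply: map_f; rewrite mem_iota; lia.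
Qed.

Lemma steps_add st : steps_ok T st -> steps_ok T' (rev [seq K i | i <- iota 0 h] ++ st).
Proof.
move=> hT f hf; have lt := size_cells_lt; case: f hf => [|f] hf; first by lia.
rewrite /=; case cE : (cells T') => [|c0 s]; first by rewrite cE in lt.
rewrite -cE /= cells_strip hT; last by lia.
by congr (_ ++ _); rewrite first_group_strip map_rev -map_comp.
Qed.

End Steps.

(** * Stability for large rank *)

Section Stability.
Variables (l A B : nat) (R : nat -> nat -> int).
Hypothesis lA : l <= A.
Hypothesis concave : forall a i, l < a <= A -> (R a.+1 i - R a i <= R a i - R a.-1 i)%R.
Hypothesis top : forall i, (R A i <= R A.+1 i)%R.
(** [R a i] will be the number of boxes of nu^(a) to the right of column i, the last nodes being
    joined into node A.+1; then [C a i] is the height of column i.+1. *)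
Let C a i : int := (R a i - R a i.+1)%R.
Hypothesis C_ge0 : forall a i, l <= a <= A.+1 -> (0 <= C a i)%R.
Hypothesis C_anti : forall a i, l <= a <= A.+1 -> (C a i.+1 <= C a i)%R.
Hypothesis R_large : forall a i, l <= a <= A.+1 -> B <= i -> R a i = 0%R.
Hypothesis top0 : R A.+1 0 = R A 0.
Hypothesis rank : (l%:Z + C A 0 <= A%:Z)%R.

Lemma incr_anti a b i : l < a -> a <= b <= A.+1 -> (R b i - R b.-1 i <= R a i - R a.-1 i)%R.
Proof.
move=> la /andP[/subnK <-]; elim: (b - a) => [|c IH] h; first by rewrite add0n.
have h1 := IH ltac:(lia); have := @concave (c + a) i ltac:(lia); rewrite addSn /=; lia.
Qed.

Lemma incr_top a i : l < a <= A -> (R A.+1 i - R A i <= R a i - R a.-1 i)%R.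
Proof. by move=> h; apply: (@incr_anti a A.+1 i); lia. Qed.

Lemma R_mono a b i : l <= a -> a <= b <= A -> (R a i <= R b i)%R.
Proof.
move=> la /andP[/subnK <-]; elim: (b - a) => [|c IH] h; first by rewrite add0n.
have h1 := IH ltac:(lia); have := @incr_top (c + a).+1 i ltac:(lia); have := top i.
by rewrite addSn /=; lia.
Qed.

(** A concave sequence, nondecreasing up to A, stays constant after a step without growth. *)
Lemma R_const a i : l <= a < A -> (R a.+1 i <= R a i)%R -> R a.+1 i = R A i.
Proof.
move=> ha h; have [c AE] : exists c, A = a.+1 + c by exists (A - a.+1); lia.
have {AE} : a.+1 + c <= A by lia.
suff gen e : a.+1 + e <= A -> R (a.+1 + e) i = R a.+1 i.
  by move=> _; rewrite -(gen (A - a.+1)) ?subnKC //; lia.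
elim: e => [|e IH] he; first by rewrite addn0.
have := @incr_anti a.+1 (a.+1 + e.+1) i ltac:(lia) ltac:(lia).
have := @R_mono (a.+1 + e) (a.+1 + e.+1) i ltac:(lia) ltac:(lia).
by rewrite !addnS /= IH; lia.
Qed.

Lemma C_le0 i j : i <= j -> (C A j <= C A i)%R.
Proof.
move=> /subnK <-; elim: (j - i) => [|c IH]; first by rewrite add0n.
by rewrite addSn; apply: le_trans IH; apply: C_anti; lia.
Qed.

(* Column i.+1 has reached its final height at node [l + C A i]. *)
Lemma stability_aux i :
  [/\ R A.+1 i = R A i,
      forall a, l <= a <= A -> (Num.min (a%:Z - l%:Z) (C A i) <= C a i)%R &
      forall a, l <= a <= A -> (l%:Z + C A i <= a%:Z)%R -> R a i = R A i].
Proof.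
(* Downward induction on the column: beyond B there are no boxes. *)
have [d] : exists d, B <= i + d by exists B; exact: leq_addl.
elim: d i => [|d IH] i hB.
  rewrite addn0 in hB; split; first by rewrite !R_large //; lia.
    by move=> a ha; rewrite /C !R_large; lia.
  by move=> a ha _; rewrite !R_large; lia.
have [E1 C1 S1] := IH i.+1 ltac:(lia).
have c0 : (0 <= C A i.+1)%R by apply: C_ge0; lia.
have cc : (C A i.+1 <= C A i)%R by apply: C_anti; lia.
have cr : (C A i <= C A 0)%R by exact: C_le0.
(* By induction [R a i.+1] is constant from node [a1] on, so growth of [R a i] there is growth of
   column i.+1. *)
have [a1 a1E] : exists a1 : nat, (a1%:Z = l%:Z + C A i.+1)%R.
  by exists (l + `|C A i.+1|%N); lia.
have a1A : l <= a1 <= A by lia.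
have C1a a : l <= a <= A -> (Num.min (a%:Z - l%:Z) (C A i.+1) <= C a i)%R.
  by move=> ha; apply: le_trans (C1 a ha) (C_anti _ _); lia.
(* Up to [a1], column i.+1 is at least as high as column i.+2; past it, column i.+1 gains at least
   one box per node until it is final. *)
have alpha a : l <= a <= A -> (Num.min (a%:Z - l%:Z) (C A i) <= C a i)%R.
  move=> ha; case: (leqP a a1) => aa1; first by have := C1a a ha; lia.
  have [e aE] : exists e, a = a1 + e by exists (a - a1); lia.
  rewrite {a}aE in ha aa1 *; elim: e ha {aa1} => [|e IHe] ha.
    by rewrite addn0; have := C1a a1 ltac:(lia); lia.
  have IH' := IHe ltac:(lia).
  have s1 := S1 (a1 + e) ltac:(lia) ltac:(lia); have s2 := S1 (a1 + e.+1) ltac:(lia) ltac:(lia).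
  rewrite addnS in ha s2 *.
  case: (lerP (R (a1 + e).+1 i) (R (a1 + e) i)) => hR.
    have rc := R_const (a := a1 + e) ltac:(lia) hR.
    rewrite /C rc s2; lia.
  by move: IH'; rewrite /C s1 s2; lia.
have beta a : l <= a <= A -> (l%:Z + C A i <= a%:Z)%R -> R a i = R A i.
  move=> ha hc; have := alpha a ha; have := @R_mono a A i ltac:(lia) ltac:(lia).
  rewrite /C (S1 a ha); first by rewrite /C in hc *; lia.
  by rewrite /C in cc hc *; lia.
split=> //.
(* Growth from A to A.+1 would, by concavity, make column i.+1 grow at every node from [a1] on, up
   to height at least A - l. *)
have tp := top i; apply/eqP; rewrite eq_le tp andbT leNgt; apply/negP => e1.
have grow e : a1 + e <= A -> (C A i.+1 + e%:Z <= C (a1 + e) i)%R.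
  elim: e => [|e IHe] he.
    by rewrite addn0 addr0; have := C1a a1 a1A; lia.
  have := IHe ltac:(lia); have := @incr_top (a1 + e).+1 i ltac:(lia).
  have s1 := S1 (a1 + e) ltac:(lia) ltac:(lia); have s2 := S1 (a1 + e.+1) ltac:(lia) ltac:(lia).
  rewrite addnS in s2 *; rewrite /C s1 s2 /=; lia.
have := grow (A - a1) ltac:(lia); rewrite subnKC; last by lia.
(* By the rank bound the columns up to i.+1 of node A are all equally high, while those of node A.+1
   are strictly higher; summing back to i = 0 contradicts [top0]. *)
move=> g; have cE : (C A i = C A 0)%R by lia.
have cj j : j <= i -> C A j = C A i.
  move=> ji; have := @C_le0 0 j isT; have := C_le0 ji; lia.
have Cend j : j <= i -> (C A i < C A.+1 j)%R.
  move=> ji; have ca : forall k, k <= i -> (C A.+1 i <= C A.+1 (i - k))%R.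
    elim=> [|k IHk] hk; first by rewrite subn0.
    apply: le_trans (IHk ltac:(lia)) _; have -> : i - k = (i - k.+1).+1 by lia.
    by apply: C_anti; lia.
  have := ca (i - j) ltac:(lia); have -> : i - (i - j) = j by lia.
  have : (C A i < C A.+1 i)%R by rewrite /C E1; lia.
  by move=> h1 h2; exact: lt_le_trans h1 h2.
have : forall k, k <= i -> (R A (i - k) < R A.+1 (i - k))%R.
  elim=> [|k IHk] hk; first by rewrite subn0.
  have := IHk ltac:(lia); have := Cend (i - k.+1) ltac:(lia); have := cj (i - k.+1) ltac:(lia).
  rewrite /C; have -> : (i - k.+1).+1 = i - k by lia.
  lia.
by move=> /(_ i (leqnn i)); rewrite subnn top0 ltxx.
Qed.

Lemma stability i : R A.+1 i = R A i.
Proof. by have [] := stability_aux i. Qed.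

End Stability.

Lemma Lsize_Lge (L : Ldata) m : (forall a, m < a -> Lge L a = 0) ->
  Lsize L = \sum_(1 <= a < m.+1) Lge L a.
Proof.
move=> h; transitivity (\sum_(1 <= a < m.+1) \sum_(x <- finsupp L) (if a <= x.1 then x.2 * L x else 0)).
  rewrite exchange_big /=; apply: eq_big_seq => x xL.
  have v0 : m < x.1 -> x.2 * L x = 0.
    by move=> mx; have := h _ mx; rewrite /Lge (big_rem x) //= leqnn; lia.
  case: (ltnP m x.1) => mx.
    rewrite -mulnA v0 // muln0 big1 // => a _; by case: ifP.
  rewrite -mulnA (big_cat_nat _ (n := x.1.+1)) //= [X in _ + X]big1_seq ?addn0; last first.
    by move=> a; rewrite mem_index_iota => /andP[_ ha]; rewrite leqNgt; case: ltnP => //; lia.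
  rewrite (eq_big_nat _ _ (F2 := fun=> x.2 * L x)); last by move=> a; case: ltnP => // ? /andP[_]; rewrite ltnS => ->.
  by rewrite sum_nat_const_nat subn1.
by apply: eq_bigr => a _; rewrite /Lge [RHS]big_mkcond.
Qed.

Lemma parts_filter (la : seq nat) m : is_part la -> size la <= m ->
  [seq b <- [seq part la a | a <- iota 1 m] | 0 < b] = la.
Proof.
move=> /andP[_ z] /subnKC <-; rewrite iotaD map_cat filter_cat.
have -> : [seq part la a | a <- iota 1 (size la)] = la.
  by rewrite -[1]addn0 iotaDl -map_comp -[RHS](mkseq_nth 0).
have -> : [seq b <- [seq part la a | a <- iota (1 + size la) (m - size la)] | 0 < b] = [::].
  apply/eqP; rewrite -(negbK (_ == _)) -has_filter; apply/hasP => -[b /mapP[a]].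
  rewrite mem_iota => ha ->; rewrite /part nth_default //; lia.
rewrite cats0; apply/all_filterP/allP => b bl; rewrite lt0n; by apply: contraNneq z => <-.
Qed.

Lemma sum_parts (la : seq nat) m : size la <= m -> \sum_(1 <= a < m.+1) part la a = sumn la.
Proof.
move=> hm; rewrite big_add1 /= /part /= sumnE [in RHS](big_nth 0) (big_cat_nat _ (n := size la)) //=.
rewrite [X in _ + X = _]big1_seq ?addn0 // => a.
by rewrite mem_index_iota => ha; rewrite nth_default //; lia.
Qed.

Lemma L_ok_Lsize d n L : L_ok (Some d) n L -> Lsize L = \sum_(1 <= a < (anode d n).+1) Lge L a.
Proof. by move=> Lo; apply: Lsize_Lge => a; exact: L_ok_Lge. Qed.

(** Telescoping: of the sizes of the nu^(a) only the last survives. *)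
Lemma wtcoef_sum L (x : rc) m :
  ((\sum_(1 <= a < m.+1) Lge L a)%N%:Z = \sum_(1 <= a < m.+1) wtcoef L x a + (nusize x m)%:Z)%R.
Proof.
elim: m => [|m IH]; first by rewrite !big_geq.
rewrite big_nat_recr //= [in RHS]big_nat_recr //= PoszD IH; move: (bigop _ _ _) => S.
by rewrite /wtcoef /=; lia.
Qed.

(** * Consequences of the rank condition for a rigged configuration *)

Section Init.
Variables (d : domino) (n : nat) (L : Ldata) (la : seq nat) (x : rc).
Local Notation A := (anode d n).
Hypothesis rcx : RC (Some d) n la L x.
Hypothesis rk : rank_ok d n la x.

Lemma init_L : L_ok (Some d) n L.
Proof. by case: rcx => _ _ []. Qed.

Lemma init_wt a : 1 <= a <= A -> (wtcoef L x a = (part la a)%:Z)%R.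
Proof.
case: rcx => _ _ _; rewrite /wt_cond /anode; case: (d) => [h|h|[h _ _]] ha; rewrite h //; lia.
Qed.

Lemma init_nu0 a : n < a -> nu x a = [::].
Proof. by case: rcx => _ _ [_ [sx _] _ _ _] _; case: a => // a h; rewrite /= nth_default // sx. Qed.

Lemma init_rpart a : is_rpart (nu x a).
Proof.
case: rcx => _ _ [_ [sx /allP ax] _ _ _] _; case: a => // a /=.
by case: (ltnP a (size x)) => h; [apply: ax; apply: mem_nth|rewrite nth_default].
Qed.

Definition endQ (y : rc) i : nat := if d is Vdom then Q y n.-1 i + Q y n i else Q y n i.

Lemma init_endsize : (if d is Vdom then nusize x n.-1 + nusize x n else nusize x n) = nusize x A.
Proof.
have Lg := @L_ok_Lge d n L n init_L; move: rcx Lg => [_ sl _]; rewrite /wt_cond /anode.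
have p0 m : m < n -> size la <= m -> part la n = 0.
  by move=> h1 h2; rewrite /part nth_default //; lia.
case: (d) sl => [sl|sl|_ [_ h _]] /=; last by lia.
  case: (posnP n) => [-> //|n0] h /(_ ltac:(lia)) Lg.
  have := h n ltac:(lia); rewrite (p0 n.-1) // ?prednK //; rewrite /wtcoef; lia.
case: (posnP n) => [-> //|n0] h /(_ ltac:(lia)) Lg.
have := h n ltac:(lia); rewrite (p0 n.-1) // ?prednK //; rewrite /wtcoef; lia.
Qed.

Lemma Q_gt a i : n < a -> Q x a i = 0.
Proof. by move=> h; rewrite /Q init_nu0. Qed.

Lemma Q0 (y : rc) a : Q y a 0 = 0.
Proof. by rewrite QE Ql0. Qed.

Lemma init_top_vac i : match d return Prop with
  | Vdom => 2 * Q x n.-1 i <= Q x A i /\ 2 * Q x n i <= Q x A i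
  | _ => Q x n i <= Q x n.-1 i
  end.
Proof.
have nn : n = 0 -> forall a i, Q x a i = 0.
  by move=> n0 [|a] j; rewrite // Q_gt // n0.
case: (posnP i) => [->|i0]; first by rewrite !Q0; case: (d).
move: rcx => [_ _ [_ _ ev vac _] _]; rewrite /anode.
case: (posnP n) => [/nn e|n0]; first by rewrite !e; case: (d).
move: ev vac; case: (d) => /= ev vac.
- by have := vac n i ltac:(lia) i0; rewrite /vacancy eqxx => /(_ ltac:(discriminate)); lia.
- have even j : 0 < j -> ~~ odd j -> Q x n j <= Q x n.-1 j.
    move=> j0 je; have := vac n j ltac:(lia) j0; rewrite /vacancy eqxx => /(_ (fun _ _ => je)); lia.
  case: (boolP (odd i)) => io; last exact: even.
  case: i i0 io => // i _ /= io.
  have := Q_sndiff x n i; have := Q_sndiff x n.-1 i.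
  have -> : count_mem i.+1 (lens (nu x n)) = 0.
    apply/count_memPn/mapP => -[r rx rE]; have := ev erefl r rx; rewrite -rE /= io //.
  have h1 : Q x n i <= Q x n.-1 i by case: (posnP i) => [->|ip]; [rewrite !Q0|apply: even].
  have h2 : Q x n i.+2 <= Q x n.-1 i.+2 by apply: even; rewrite //= negbK.
  lia.
split; last first.
  by have := vac n i ltac:(lia) i0; rewrite /vacancy eqxx => /(_ ltac:(discriminate)); lia.
case: (posnP n.-1) => [e|n1]; first by rewrite e.
have := vac n.-1 i ltac:(lia) i0; rewrite /vacancy eqxx; have -> : n.-1 == n = false by lia.
by move=> /(_ ltac:(discriminate)); lia.
Qed.

Lemma init_endQ_le i : endQ x i <= Q x A i.
Proof. by have := init_top_vac i; rewrite /endQ /anode; case: (d) => //= -[]; lia. Qed.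

Lemma size_la : size la <= A.
Proof. by case: rcx. Qed.

Lemma init_topQ : topQ d n x.
Proof.
suff h i : endQ x i = Q x A i by move=> i; have := h i; rewrite /endQ; case: (d).
have slA := size_la.
have es := init_endsize.
pose R a i : int := if a <= A then ((nusize x a)%:Z - (Q x a i)%:Z)%R else ((nusize x A)%:Z - (endQ x i)%:Z)%R.
have RA : forall i, R A i = ((nusize x A)%:Z - (Q x A i)%:Z)%R by move=> j; rewrite /R leqnn.
have RA1 : forall i, R A.+1 i = ((nusize x A)%:Z - (endQ x i)%:Z)%R by move=> j; rewrite /R ltnn.
suff : R A.+1 i = R A i by rewrite RA RA1; lia.
have endC j : exists u, endQ x j.+1 = endQ x j + colh u j.+1 /\ endQ x j.+2 = endQ x j.+1 + colh u j.+2.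
  rewrite /endQ !QE; case: (d).
  - by exists (lens (nu x n)); rewrite !Ql_colh.
  - by exists (lens (nu x n)); rewrite !Ql_colh.
  exists (lens (nu x n.-1) ++ lens (nu x n)); rewrite !Ql_colh /colh !count_cat; lia.
have RC a j : exists u, (R a j - R a j.+1 = (colh u j.+1)%:Z)%R /\ (R a j.+1 - R a j.+2 = (colh u j.+2)%:Z)%R.
  rewrite /R; case: leqP => _; last by have [u [-> ->]] := endC j; exists u; lia.
  by exists (lens (nu x a)); rewrite !QE !Ql_colh; lia.
pose B := \sum_(a < A.+2) nusize x a + nusize x n + nusize x n.-1.
have Bge a : a <= A -> nusize x a <= B.
  move=> ha; have aA : a < A.+2 by lia.
  rewrite /B (bigD1 (Ordinal aA)) //=; lia.
apply: (@stability (size la) A B R) => //.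
(* Concavity beyond l(lambda): the weight vanishes there, so the second difference of the sizes is
   minus the sum of the i L_i^(a), at most [- LQ]; that of Q is at least [- LQ] by nonnegative
   vacancy. *)
- move=> a j ha.
  have [_ _ [_ _ _ vac _] _] := rcx.
  have w1 := init_wt (a := a) ltac:(lia).
  have p1 : part la a = 0 by rewrite /part nth_default //; lia.
  have Lle := LQ_le L a j.
  have n0 : 0 < n by move: ha; rewrite /anode; case: (d); lia.
  have va : (0 <= vacancy (Some d) n L x a j)%R.
    case: (posnP j) => [->|j0].
      rewrite /vacancy !Q0 LQ0; by case: (d); do ?case: ifP => _; lia.
    by apply: vac => //; move: ha; rewrite /anode; case: (d); lia.
  have R1 : R a j = ((nusize x a)%:Z - (Q x a j)%:Z)%R by rewrite /R ifT //; lia.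
  have R0 : R a.-1 j = ((nusize x a.-1)%:Z - (Q x a.-1 j)%:Z)%R by rewrite /R ifT //; lia.
  rewrite R1 R0.
  case: (eqVneq a A) => aA.
    rewrite aA RA1; move: va w1 p1; rewrite aA /wtcoef => va w1 p1; rewrite p1 in w1.
    have Lg := @L_ok_Lge d n L A.+1 init_L (ltnSn A); rewrite -aA in Lg; rewrite aA in Lle Lg.
    move: va; rewrite /vacancy /endQ; move: ha w1 Lle Lg; rewrite aA /anode.
    case: (d) => /= ha w1 Lle Lg.
    + have -> : n.-1 == n = false by lia.
      by rewrite prednK //; lia.
    + have -> : n.-1 == n = false by lia.
      by rewrite prednK //; lia.
    have -> : n.-2 == n = false by lia.
    have -> : n.-2 == n.-1 = false by lia.
    rewrite eqxx; lia.
  have w2 := init_wt (a := a.+1) ltac:(lia).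
  have p2 : part la a.+1 = 0 by rewrite /part nth_default //; lia.
  have R2 : R a.+1 j = ((nusize x a.+1)%:Z - (Q x a.+1 j)%:Z)%R by rewrite /R ifT //; lia.
  rewrite R2; move: w1 w2; rewrite p1 p2 /wtcoef /= => w1 w2.
  move: va; rewrite /vacancy; move: ha aA; rewrite /anode.
  case: (d) => ha aA.
  + have -> : a == n = false by lia.
    lia.
  + have -> : a == n = false by lia.
    lia.
  have -> : a == n = false by lia.
  have -> : a == n.-1 = false by lia.
  rewrite (negbTE aA); lia.
- by move=> j; rewrite RA RA1; have := init_endQ_le j; lia.
- by move=> a j _; have [u [-> _]] := RC a j.
- by move=> a j _; have [u [-> ->]] := RC a j; have := @colh_homo u j.+1 j.+2 (leqnSn _); lia.
- move=> a j ha hj; rewrite /R; case: leqP => aA; first by rewrite Q_large ?subrr //; have := Bge a aA; lia.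
  rewrite -es /endQ; move: hj; rewrite /B; case: (d) => hj; rewrite ?Q_large; lia.
- rewrite RA RA1 Q0; suff -> : endQ x 0 = 0 by [].
  by rewrite /endQ !Q0; case: (d).
rewrite !RA !QE Ql_colh Ql0; move: rk; rewrite /rank_ok; have := colh_le (lens (nu x A)) 1.
have -> : size (lens (nu x A)) = size (nu x A) by rewrite size_map.
lia.
Qed.

(** [init_topQ] and [init_top_vac] make the vacancy numbers at the last nodes 0, which leaves only
    the rigging 0. *)
Lemma init_zr e : zr (nu x (topnode d n e)).
Proof.
split; first exact: init_rpart.
have tq := init_topQ; have tv := init_top_vac.
have [_ _ [_ [sx _] _ _ rig] _] := rcx.
move=> [m z] rx /=; suff : (0 <= z <= 0)%R by lia.
have i0 : 0 < topnode d n e <= n.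
  apply/andP; split; first by case: (topnode d n e) rx.
  by rewrite leqNgt; apply/negP => /init_nu0 h; rewrite h in rx.
have /andP[/= -> h] := rig (topnode d n e) _ i0 rx; apply: le_trans h _.
move: tq tv i0 {rx rig}; rewrite /topQ /vacancy /topnode /anode; case: (d) => tq tv i0.
- by rewrite eqxx; have := tq m; lia.
- by rewrite eqxx; have := tq m; lia.
have h1 := tq m; have h2 := tv m; case: e i0 => i0; rewrite eqxx; first by lia.
case: eqP => _; lia.
Qed.

(** The Q functions of the two last nodes are each at most half of Q^(A) and add up to it, so nu^(A)
    has the columns of nu^(n) doubled in height. *)
Lemma init_even : d = Vdom -> ~~ odd (nusize x A) /\ forall m, 0 < m -> ~~ odd (colh (lens (nu x A)) m).
Proof.
have tq := init_topQ; have tv := init_top_vac; have es := init_endsize.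
move=> dV; move: tq tv es; rewrite /topQ /anode dV => tq tv es.
have half i : Q x n.-2 i = 2 * Q x n i by have := tq i; have := tv i; lia.
have half' i : Q x n.-1 i = Q x n i by have := tq i; have := tv i; lia.
split.
  have := half (nusize x n.-2 + nusize x n); rewrite !Q_large; [|lia|lia].
  by move=> ->; rewrite mul2n odd_double.
case=> // m _; have := half m; have := half m.+1; rewrite !QE !Ql_colh => h1 h2.
have -> : colh (lens (nu x n.-2)) m.+1 = 2 * colh (lens (nu x n)) m.+1 by lia.
by rewrite mul2n odd_double.
Qed.

Lemma init_tops j : tops d n j x.
Proof.
split; last exact: init_zr.
have tq := init_topQ; have tv := init_top_vac; have ev := init_even.
have [_ _ [_ [sx _] _ _ _] _] := rcx.
split=> //; move: tq tv ev; rewrite /topQ /anode; case: (d) => // tq tv /(_ erefl)[ev _].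
by split=> // i; rewrite (negbTE ev) addn0; have := tq i; have := tv i; lia.
Qed.

Lemma init_valid : valid A L x.
Proof.
move=> a ha; have [_ _ [lo _ ev vac rig] _] := rcx.
have tq := init_topQ.
have an : 1 <= a <= n by move: ha; rewrite /anode; case: (d); lia.
split; first exact: init_rpart.
  move=> i; rewrite -(vacancyE lo) //; case: (posnP i) => [->|i0].
    by rewrite (vacancyE lo) // vac0.
  apply: vac => // dH aE; move: ha; rewrite /anode; case: (d) dH => //; lia.
move=> r rx; rewrite -(vacancyE lo) //; exact: rig.
Qed.

Lemma init_mu : partitions_of d ((Lsize L)%:Z - (sumn la)%:Z)%R (lens (nu x A)).
Proof.
split; first exact/is_rpart_lens/init_rpart.
  have lo := init_L; rewrite (L_ok_Lsize lo) (wtcoef_sum L x) -(sum_parts size_la).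
  rewrite (big_morph Posz PoszD (erefl _)) (@eq_big_nat _ _ _ 1 A.+1 (wtcoef L x) (fun a => Posz (part la a))).
    by rewrite addrAC subrr add0r.
  by move=> a ha; rewrite init_wt //; lia.
have tq := init_topQ; have ev := init_even; have [_ _ [_ _ he _ _] _] := rcx.
move: tq ev he; rewrite /topQ /tileable; case dE : (d) => // tq ev he.
  move=> b; rewrite (_ : lens _ = lens (nu x n)); first by case/mapP => r rx ->; apply: he.
  by apply: Ql_inj; [exact/is_rpart_lens/init_rpart|exact/is_rpart_lens/init_rpart|move=> i; rewrite -!QE tq].
by move=> j j1; have [_] := ev erefl; apply.
Qed.

Lemma init_wtE : la = wt (Some d) n L x.
Proof.
case: rcx => pl _ _ _; rewrite /wt -[LHS](parts_filter pl size_la); congr filter.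
by apply/eq_in_map => a; rewrite mem_iota => ha; rewrite init_wt //; lia.
Qed.

End Init.

(** * Iteration over the columns *)

Lemma colh_part mu i j : is_part mu -> 0 < i -> 0 < j -> (i <= colh mu j) = (j <= part mu i).
Proof.
move=> /andP[so _]; case: i => // i _ j0; rewrite /part /colh /=.
elim: mu so i => [|x mu IH] so i /=; first by rewrite nth_nil; lia.
case: (leqP j x) => jx /=.
  by case: i => [|i]; [rewrite jx|rewrite add1n ltnS IH // (path_sorted so)].
have hall b : b \in mu -> b < j.
  by move=> bm; move/(order_path_min geq_trans)/allP/(_ b bm): so => /=; lia.
have -> : count (leq j) mu = 0.
  by apply/eqP; rewrite eqn0Ngt -has_count; apply/hasP => -[b /hall]; lia.
case: i => [|i] /=; first by lia.
case: (ltnP i (size mu)) => hi; last by rewrite nth_default //; lia.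
have -> : j <= nth 0 mu i = false by rewrite leqNgt (hall _ (mem_nth 0 hi)).
lia.
Qed.

Lemma head_max mu b : is_part mu -> b \in mu -> b <= head 0 mu.
Proof.
move=> /andP[so _]; case: mu so => //= x mu so; rewrite inE => /orP[/eqP ->//|bm].
by move/(order_path_min geq_trans)/allP/(_ b bm): so.
Qed.

Lemma size_cut j mu : is_part mu -> size (cut j mu) = colh mu j.+1.
Proof.
by move=> pm; rewrite size_filter count_map; apply: eq_count => b /=; lia.
Qed.

Lemma cut0 mu : is_part mu -> cut 0 mu = mu.
Proof.
move=> pm; apply: part_eq => // [|a a0]; first exact: is_part_cut.
by rewrite part_cut // subn0.
Qed.

Lemma cut_head mu : is_part mu -> cut (head 0 mu) mu = [::].
Proof.
move=> pm; apply/nilP; rewrite /nilp size_cut // /colh -leqn0 leqNgt -has_count.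
by apply/hasP => -[b /(head_max pm)]; lia.
Qed.

Lemma stack_cut j mu : is_part mu -> stack (colh mu j.+1) (cut j.+1 mu) = cut j mu.
Proof.
move=> pm; have sc : size (cut j.+1 mu) <= colh mu j.+1 by rewrite size_cut // colh_homo.
apply: part_eq => [||a a0]; [exact/is_part_stack/sc/is_part_cut|exact: is_part_cut|].
by rewrite part_stack // !part_cut // colh_part //; lia.
Qed.

Lemma cut_cut j mu : is_part mu -> cut 1 (cut j mu) = cut j.+1 mu.
Proof.
move=> pm; apply: part_eq => [||a a0]; try by do ?apply: is_part_cut.
by rewrite !part_cut //; [lia|apply: is_part_cut].
Qed.

Lemma Ql_min u i m : (forall b, b \in u -> b <= m) -> Ql u (minn i m) = Ql u i.
Proof.
move=> h; rewrite /Ql; congr sumn; apply/eq_in_map => b /h; lia.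
Qed.

Lemma Ql_even u i : (forall m, 0 < m -> ~~ odd (colh u m)) -> ~~ odd (Ql u i).
Proof.
by move=> h; elim: i => [|i IH]; rewrite ?Ql0 // Ql_colh oddD (negbTE IH) (negbTE (h _ _)).
Qed.

Lemma Ql_eq0 u : is_part u -> (forall i, Ql u i = 0) -> u = [::].
Proof. by move=> pu h; apply: Ql_inj => // i; rewrite h. Qed.

Definition blank (la : seq nat) : skewtab := (la, nseq (size la) [::]).

Lemma trow_blank la r : trow (blank la) r = [::].
Proof. by rewrite /trow nth_nseq if_same. Qed.

Lemma cnt_blank la r v : cnt (blank la) r v = 0.
Proof. by rewrite /cnt big1 // => a _; rewrite trow_blank. Qed.

Lemma outer_blank la : is_part la -> outer (blank la) = la.
Proof.
move=> pl; rewrite /outer /= size_nseq -[RHS](mkseq_nth 0) -[1]addn0 iotaDl -map_comp.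
by apply: eq_map => a /=; rewrite trow_blank addn0.
Qed.

Lemma LR_blank la : is_part la -> LR la la [::] (blank la).
Proof.
move=> pl; rewrite -{1}(outer_blank pl); apply: LR_intro => //.
- by rewrite /= size_nseq.
- by rewrite outer_blank.
- by move=> r; rewrite trow_blank.
- by move=> r c; rewrite /in_skew trow_blank /= => h1 _; exfalso; lia.
- by move=> r v; rewrite trow_blank.
- by move=> v v0; rewrite cnt_blank /part nth_nil.
by move=> r i _; rewrite !cnt_blank.
Qed.

Lemma LR_nil eta la T : LR eta la [::] T -> eta = la /\ T = blank la.
Proof.
move=> lr; have [_ e sz vb] := LR_rows lr; have [[pe pl Tla oe sle] _ _ _ _] := lr.
have tr r : trow T r = [::].
  by case tE : (trow T r) => [//|v w]; have := vb r v; rewrite tE mem_head => /(_ isT) /= h; exfalso; lia.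
have eE : eta = la.
  by apply: part_eq => // -[//|a] _; rewrite e tr addn0.
split=> //; rewrite [LHS]surjective_pairing Tla /blank; congr (_, _).
apply: (@eq_from_nth _ [::]); first by rewrite size_nseq -sz eE.
by move=> i _; rewrite nth_nseq if_same -[LHS]/(trow T i.+1) tr.
Qed.

Lemma steps_blank la : steps_ok (blank la) [::].
Proof.
move=> f _; have -> : cells (blank la) = [::]; last by case: f.
apply/nilP; rewrite /nilp cellsE size_flatten /shape -map_comp sumnE big_map big1 // => r _.
by rewrite /= /row_cells trow_blank.
Qed.

Definition col_steps (mu : seq nat) a e : seq (nat * nat) :=
  flatten [seq [seq (j, i.+1) | i <- iota 0 (colh mu j)] | j <- rev (iota a e)].

Lemma col_stepsS mu a e : col_steps mu a e.+1 = col_steps mu a.+1 e ++ [seq (a, i.+1) | i <- iota 0 (colh mu a)].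
Proof. by rewrite /col_steps /= rev_cons map_rcons flatten_rcons. Qed.

Lemma PsiE d n L x : let mu := lens (nu x (anode d n)) in
  Psi d n L x = foldl (psi_step d n L) (Some (x, blank (wt (Some d) n L x))) (col_steps mu 1 (head 0 mu)).
Proof.
rewrite /Psi /Psi_steps /col_steps /=; congr foldl; congr flatten; apply: eq_map => j.
by rewrite -[1]addn0 iotaDl -map_comp.
Qed.

Lemma tPsiE d n L y T st : steps_ok T st -> tPsi d n L (y, T) = foldl (tpsi_step d n L) (Some y) st.
Proof. by move=> h; rewrite /tPsi /tPsi_steps /= h. Qed.

(** Between columns |nu^(A)| is even for vertical dominoes, so there is no odd box whose column j
    has to record, and j may be changed. *)
Lemma tops_shift d n j j' y : tops d n j y -> (d = Vdom -> ~~ odd (nusize y (anode d n))) -> tops d n j' y.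
Proof.
case=> -[sy ty] zy ev; split=> //; split=> //; move: ty ev; rewrite /anode; case: (d) => // -[h1 h2] ev.
by split=> // i; rewrite h2 (negbTE (ev erefl)).
Qed.

Lemma colh_head mu : is_part mu -> colh mu (head 0 mu).+1 = 0.
Proof.
move=> pm; apply/eqP; rewrite eqn0Ngt -has_count; apply/hasP => -[b /(head_max pm)]; lia.
Qed.

Section Forward.
Variables (d : domino) (n : nat) (L : Ldata) (la mu : seq nat) (x : rc).
Local Notation A := (anode d n).
Hypothesis Lok : L_ok (Some d) n L.
Hypothesis pl : is_part la.
Hypothesis pm : is_part mu.
Hypothesis rk : size la + size mu <= A.
Hypothesis even : d = Vdom -> forall m, 0 < m -> ~~ odd (colh mu m).

(** State when the columns up to j remain. [K] and [S] belong to column j.+1, removed last, and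
    [os_first] ties its chains to the first occurrences of the letters in [T]. *)
Record ostate (j : nat) (y : rc) (T : skewtab) (eta : seq nat) (st : seq nat)
    (K : nat -> nat) (S : nat -> nat -> nat) : Prop := OState {
  os_valid : valid A L y;
  os_tops : tops d n j y;
  os_Q : forall i, Q y A i = Ql mu (minn i j);
  os_inter : inter A K S 0 (colh mu j.+1);
  os_mono : mono A K S 0 (colh mu j.+1);
  os_K : forall i, i < colh mu j.+1 -> 1 <= K i <= size la + colh mu j.+1 /\ K i <= A;
  os_S : forall i a, i < colh mu j.+1 -> K i <= a <= A -> 0 < S i a;
  os_SA : forall i, i < colh mu j.+1 -> S i A = j.+1;
  os_avail : avail A L 1 K S 0 (colh mu j.+1) y;
  os_shape : forall a, size la + colh mu j.+1 < a <= A -> wtcoef L y a = 0%R;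
  os_LR : LR eta la (cut j mu) T;
  os_eta : forall a, 1 <= a <= A -> ((part eta a)%:Z = wtcoef L y a)%R;
  os_size : size eta <= A;
  os_first : forall i r, i < colh mu j.+1 -> (0 < cnt T r i.+1) = (K i <= r);
  os_steps : steps_ok T st;
  os_tpsi : foldl (tpsi_step d n L) (Some y) st = Some x;
  os_psi : foldl (psi_step d n L) (Some (x, blank la)) (col_steps mu j.+1 (head 0 mu - j)) = Some (y, T) }.

Lemma ostep j y T eta st K S : j < head 0 mu -> ostate j.+1 y T eta st K S ->
  exists y' T' eta' st' K' S', ostate j y' T' eta' st' K' S'.
Proof.
move=> jm [vy ty Qy il mo Kb Sp SA av sh lr et se first ok tp ps].
have A1 : 1 <= A by case: (mu) jm rk => //= b u _; lia.
have hc : colh mu j.+2 <= colh mu j.+1 by exact: colh_homo.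
have hm : colh mu j.+1 <= size mu by exact: colh_le.
have h0 : 0 < colh mu j.+1.
  by rewrite colh_part // /part /= nth0.
have cyE : forall m, 0 < m <= j.+1 -> colh (lens (nu y A)) m = colh mu m.
  case=> // m hm'; have := Qy m; have := Qy m.+1; rewrite !QE Ql_colh.
  have -> : minn m j.+1 = m by lia.
  have -> : minn m.+1 j.+1 = m.+1 by lia.
  by rewrite Ql_colh; lia.
have cy0 : colh (lens (nu y A)) j.+2 = 0.
  have := Qy j.+1; have := Qy j.+2; rewrite !QE Ql_colh.
  have -> : minn j.+2 j.+1 = j.+1 by lia.
  have -> : minn j.+1 j.+1 = j.+1 by lia.
  lia.
have [z [K' [S' fs]]] := fgroup Lok A1 (ltn0Sn j) hc hm rk (cyE j.+1 ltac:(lia)) cy0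
  il mo Kb Sp SA vy ty av sh.
case: fs => vz tz Qz _ cu il' mo' Kb' Sp' SA' le _ _ sh' wt' ps' tp'.
set h := colh mu j.+1 in h0 hc hm cu il' mo' Kb' Sp' SA' le sh' wt' ps' tp' *.
have hmax : maxn h (colh mu j.+2) = h by lia.
rewrite hmax in Kb' sh'.
have Kinc p q : p < q < h -> K' p < K' q.
  by move=> hpq; have [] := il' p q ltac:(lia) ltac:(lia).
have Kpos p : p < h -> 0 < K' p by move=> hp; have := Kb' p hp; lia.
have sc : size (cut j.+1 mu) <= h by rewrite size_cut.
(* A letter i.+1 already in [T] first occurs in row [K i], and the new chain ends weakly above it;
   letters beyond the height of column j.+2 have not occurred yet. *)
have Kfirst i r : i < h -> 0 < cnt T r i.+1 -> K' i <= r.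
  move=> ih c0; case: (ltnP i (colh mu j.+2)) => ic.
    by rewrite first // in c0; apply: leq_trans (le i ih ic) c0.
  have [_ _ _ vb] := LR_rows lr; exfalso.
  move: c0; rewrite cnt_flatten -has_count has_pred1 => /flattenP[w wt iw].
  have /(nthP [::])[q hq qE] := mem_take wt.
  by have := vb q.+1 i.+1; rewrite /trow /= qE iw size_cut // => /(_ isT); lia.
have et0 a : A < a -> part eta a = 0 by move=> ha; rewrite /part nth_default //; lia.
have hits0 a : A < a -> hits h K' a = 0.
  by move=> ha; apply: hits_out => i ih; have := Kb' i ih; lia.
(* The outer shape follows the weight, which is a partition after the column. *)
have Kshape a : 0 < a -> part eta a.+1 + hits h K' a.+1 <= part eta a + hits h K' a.
  move=> a0; case: (ltnP a A) => aA; last by rewrite et0 // hits0.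
  have := wtc_mono Lok vz (a := a) ltac:(lia).
  rewrite !wt'; try lia.
  by rewrite -!et; try lia; rewrite /hits; lia.
have lr' := LR_add lr sc Kinc Kpos Kfirst Kshape.
have pE := part_outer_strip lr sc Kinc Kpos.
rewrite stack_cut // in lr'.
exists z, (add_boxes (strip h K') T), (outer (add_boxes (strip h K') T)).
exists (rev [seq K' i | i <- iota 0 h] ++ st), K', S'.
have QzE i : Q z A i = Ql mu (minn i j).
  have := Qz i; rewrite Qy; case: (leqP i j) => ij.
    have -> : minn i j.+1 = i by lia.
    by rewrite muln0; lia.
  have -> : minn i j.+1 = j.+1 by lia.
  rewrite muln1 Ql_colh -/h; lia.
split=> //.
- apply: tops_shift tz _ => dV; have := Q_large (leqnn (nusize z A)).
  by rewrite QzE => <-; apply: Ql_even; exact: even.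
- by move=> a ha; rewrite pE ?wt' ?PoszD ?et //; lia.
- case sE : (size _) => [//|q]; have [[po _ _ _ _] _ _ _ _] := lr'.
  have := part_pos po (ltn0Sn q); rewrite sE ltnSn pE // => hq.
  by rewrite leqNgt; apply/negP => hA; move: hq; rewrite et0 // hits0.
- by move=> i r ih; rewrite (cnt_strip_first sc Kinc Kpos Kfirst).
- exact: (steps_add lr h0 sc Kinc Kpos Kfirst Kshape).
- by rewrite foldl_cat tp' tp.
- have -> : head 0 mu - j = (head 0 mu - j.+1).+1 by lia.
  by rewrite col_stepsS foldl_cat ps ps'.
Qed.

End Forward.

Lemma forward_ex d n L la mu x :
  L_ok (Some d) n L -> is_part la -> is_part mu -> size la + size mu <= anode d n ->
  (d = Vdom -> forall m, 0 < m -> ~~ odd (colh mu m)) ->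
  valid (anode d n) L x -> (forall j, tops d n j x) -> lens (nu x (anode d n)) = mu ->
  (forall a, 1 <= a <= anode d n -> (wtcoef L x a = (part la a)%:Z)%R) ->
  exists y T eta st K S, ostate d n L la mu x 0 y T eta st K S.
Proof.
move=> Lok pl pm rk ev vx tx lm wx.
suff ex e : e <= head 0 mu -> exists y T eta st K S, ostate d n L la mu x (head 0 mu - e) y T eta st K S.
  by have := ex _ (leqnn _); rewrite subnn.
elim: e => [|e IH] he.
  rewrite subn0; exists x, (blank la), la, [::], id, (fun=> id).
  (* No chain is recorded yet: the column to the right of mu has height 0. *)
  have c0 := colh_head pm.
  split=> //; rewrite ?c0 //; try by move=> *; exfalso; lia.
  - by move=> i; rewrite QE lm Ql_min // => b; exact: head_max.
  - by move=> a ha; rewrite wx ?/part ?nth_default //; lia.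
  - by rewrite cut_head //; exact: LR_blank.
  - by move=> a ha; rewrite wx.
  - lia.
  - exact: steps_blank.
  - by rewrite subnn.
have [y [T [eta [st [K [S os]]]]]] := IH (ltnW he).
have e1 : head 0 mu - e = (head 0 mu - e.+1).+1 by lia.
by rewrite e1 in os; apply: (ostep Lok pl pm rk ev _ os); lia.
Qed.

(** * Configurations empty from node A on *)

Section Final.
Variables (d : domino) (n : nat) (L : Ldata) (y : rc).
Local Notation A := (anode d n).
Hypothesis Lok : L_ok (Some d) n L.

Lemma L_ok_None : L_ok None n L.
Proof. by move=> a i /Lok[h1 h2 h3]; split=> //; move: h3; case: (d); lia. Qed.

Hypothesis emp : forall a, A <= a -> nu y a = [::].

Lemma vacancy_None a i : 1 <= a <= n ->
  vacancy None n L y a i = if a <= A then vac A L y a i else 0%R.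
Proof.
move=> ha; have Q0 b : A <= b -> Q y b i = 0 by move=> hb; rewrite /Q emp.
have An : A < n by rewrite /anode; case: (d); lia.
rewrite /vacancy /vac /qq; case: (leqP a A) => aA.
  have -> : a == n = false by lia.
  have e : minn a.-1 A = a.-1 by lia.
  rewrite ?e; case: (eqVneq a A) => [->|ne]; last by have -> : minn a.+1 A = a.+1 by lia.
  have -> : minn A.+1 A = A by lia.
  by rewrite (Q0 A) // (Q0 A.+1) //; lia.
case: (eqVneq a n) => [aE|ne]; first by rewrite (Q0 n) ?(Q0 n.-1) //; lia.
rewrite (Q0 a) ?(Q0 a.-1) ?(Q0 a.+1) ?LQ_eq0 //; try lia.
move=> j; apply/eqP/negPn/negP => /Lok[_ _ h]; move: h aA; rewrite /anode; case: (d); lia.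
Qed.

Lemma wt_None a : A < a -> wtcoef L y a = 0%R.
Proof.
move=> ha; rewrite /wtcoef (L_ok_Lge Lok ha) /nusize !emp //; lia.
Qed.

Lemma RC_None eta : size y = n -> valid A L y -> is_part eta -> size eta <= A ->
  (forall a, 1 <= a <= A -> ((part eta a)%:Z = wtcoef L y a)%R) ->
  [/\ RC None n eta L y, eta = wt None n L y & sumn eta = Lsize L].
Proof.
move=> sy vy pe se et.
have An : A <= n by rewrite /anode; case: (d); lia.
have etE a : 1 <= a -> ((part eta a)%:Z = wtcoef L y a)%R.
  move=> a1; case: (leqP a A) => aA; first by apply: et; lia.
  by rewrite wt_None // /part nth_default //; lia.
have sum : sumn eta = Lsize L.
  have := wtcoef_sum L y A; rewrite -(L_ok_Lsize Lok) /nusize emp //= addr0.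
  rewrite (@eq_big_nat _ _ _ 1 A.+1 (wtcoef L y) (fun a => Posz (part eta a))); last first.
    by move=> a ha; rewrite etE //; lia.
  by rewrite -(big_morph Posz PoszD (erefl _)) (sum_parts se) => -[->].
split=> //.
- split=> //; last by move=> a ha; apply: etE; lia.
  split=> //; first exact: L_ok_None.
  + split=> //; apply/(all_nthP [::]) => i hi; change (is_true (is_rpart (nu y i.+1))).
    case: (leqP i.+1 A) => iA; first by case: (vy i.+1 ltac:(lia)).
    by rewrite emp // ltnW.
  + move=> a i ha i1 _; rewrite vacancy_None //; case: ifP => // aA.
    by have [_ p _] := vy a ltac:(lia).
  + move=> a r ha rx; have aA : a <= A.
      by rewrite leqNgt; apply/negP => aA; rewrite emp // ltnW in rx.
    by rewrite vacancy_None // aA; have [_ _ q] := vy a ltac:(lia); apply: q.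
rewrite /wt -[LHS](@parts_filter eta n.+1 pe); last by lia.
congr filter; apply/eq_in_map => a; rewrite mem_iota => ha.
by rewrite -etE //; lia.
Qed.

End Final.

Lemma tops_empty d n j y : tops d n j y -> nu y (anode d n) = [::] ->
  forall a, anode d n <= a -> nu y a = [::].
Proof.
move=> [[sy ty] zy] nA a; rewrite leq_eqVlt => /orP[/eqP <- //|ha].
case: (ltnP n a) => na; first by case: a {ha} na => // a na; rewrite /= nth_default // sy.
have Q0 i : Q y (anode d n) i = 0 by rewrite /Q nA.
have nil0 u : zr u -> (forall i, Ql (lens u) i = 0) -> u = [::].
  by move=> zu hu; apply: zr_eq.
have s0 : nusize y (anode d n) = 0 by rewrite /nusize nA.
move: (zy true) (zy false) ty ha Q0 s0; rewrite /topnode /anode; case: (d) => z1 z2 ty ha Q0 s0.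
- have -> : a = n by lia.
  by apply: nil0 => // i; rewrite -QE ty Q0.
- have -> : a = n by lia.
  by apply: nil0 => // i; rewrite -QE ty Q0.
case: ty => h1 h2; have [->|->] : a = n \/ a = n.-1 by lia.
  by apply: nil0 => // i; rewrite -QE; have := h1 i; rewrite Q0; lia.
by apply: nil0 => // i; rewrite -QE; have := h1 i; rewrite Q0; lia.
Qed.

Lemma avail_prefix A L e K S h c y : h <= c -> avail A L e K S 0 c y -> avail A L e K S 0 h y.
Proof.
move=> hc av a m ha m0; apply: leq_trans (av a m ha m0).
by rewrite /need /index_iota !subn0 -(subnKC hc) iotaD count_cat leq_addr.
Qed.

Section Backward.
Variables (d : domino) (n : nat) (L : Ldata) (la mu : seq nat).
Local Notation A := (anode d n).
Hypothesis Lok : L_ok (Some d) n L.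
Hypothesis pl : is_part la.
Hypothesis pm : is_part mu.
Hypothesis rk : size la + size mu <= A.
Hypothesis even : d = Vdom -> forall m, 0 < m -> ~~ odd (colh mu m).

(** State after the columns up to j have been inserted, [T] being the part of the tableau still to
    be read. [bo_first] compares the chains of the last inserted column with the letters left in
    [T]. *)
Record bostate (j : nat) (y : rc) (T : skewtab) (eta : seq nat)
    (K : nat -> nat) (S : nat -> nat -> nat) : Prop := BOState {
  bo_valid : valid A L y;
  bo_tops : tops d n j.+1 y;
  bo_Q : forall i, Q y A i = Ql mu (minn i j);
  bo_chain : 0 < j -> [/\ inter A K S 0 (colh mu j), mono A K S 0 (colh mu j),
    forall p, p < colh mu j -> 1 <= K p /\ forall a, K p <= a <= A -> 0 < S p a,
    forall p, p < colh mu j -> S p A = j & avail A L 0 K S 0 (colh mu j) y];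
  bo_first : 0 < j -> forall p r, p < colh mu j.+1 -> 0 < cnt T r p.+1 -> K p <= r;
  bo_LR : LR eta la (cut j mu) T;
  bo_eta : forall a, 1 <= a <= A -> ((part eta a)%:Z = wtcoef L y a)%R;
  bo_size : size eta <= A }.

(** Each step takes the first group off [T] and inserts it as column j.+1. The equation for [Psi]
    starts at the final configuration, so it is assembled on the way back. *)
Lemma backward_ex e j y T eta K S : j + e = head 0 mu -> bostate j y T eta K S ->
  exists x st, [/\ steps_ok T st, foldl (tpsi_step d n L) (Some y) st = Some x,
    valid A L x /\ forall j', tops d n j' x, forall i, Q x A i = Ql mu i &
    (forall a, 1 <= a <= A -> ((part la a)%:Z = wtcoef L x a)%R) /\
    foldl (psi_step d n L) (Some (x, blank la)) (col_steps mu j.+1 e) = Some (y, T)].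
Proof.
elim: e j y T eta K S => [|e IH] j y T eta K S je [vy ty Qy ch first lr et se].
  rewrite addn0 in je; have e0 : cut j mu = [::] by rewrite je cut_head.
  rewrite e0 in lr; have [eE TE] := LR_nil lr; rewrite eE in et; rewrite TE.
  have QE' i : Q y A i = Ql mu i by rewrite Qy je Ql_min // => b; exact: head_max.
  exists y, [::]; split=> //; first exact: steps_blank.
  split=> // j'; apply: tops_shift ty _ => dV; have := Q_large (leqnn (nusize y A)).
  by rewrite QE' => <-; apply: Ql_even; exact: even.
have mu0 : 0 < size mu by case: (mu) je => //=; lia.
have A1 : 1 <= A by lia.
set h := colh mu j.+1.
have sc : size (cut j mu) = h by exact: size_cut.
have h0 : 0 < h by rewrite /h colh_part // /part /= nth0; lia.
have hc : h <= colh mu j by apply: colh_homo.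
have cy0 : colh (lens (nu y A)) j.+1 = 0.
  have := Qy j; have := Qy j.+1; rewrite !QE Ql_colh.
  have -> : minn j.+1 j = j by lia.
  have -> : minn j j = j by lia.
  lia.
pose F := frow T.
have Fcnt i r : i < h -> (0 < cnt T r i.+1) = (F i <= r) by rewrite -sc; exact: (frow_cnt lr).
have Finc p q : p < q < h -> F p < F q by rewrite -sc; exact: (frow_inc lr).
have [_ _ sz _] := LR_rows lr.
have Fb p : p < h -> 1 <= F p <= A.
  by rewrite -sc => hp; have := frow_size lr hp; rewrite -/F -sz; rewrite /F /frow; lia.
have [T0 [lr0 TE eE]] := LR_remove lr.
rewrite sc -/F in TE eE.
have hit a : count (fun p => F p == a) (iota 0 h) = hits h F a by [].
have w0 a : 1 <= a <= A -> (wtcoef L y a - (hits h F a)%:Z = (part (outer T0) a)%:Z)%R.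
  by move=> ha; rewrite -et // eE //; lia.
have [po0 _ _ _ _] := lr0; have [po _ _ _ _] := po0.
have [] := @bgroup d n L Lok y j.+1 h (colh mu j) K S F A1 (ltn0Sn j) cy0 Finc Fb _ _ _ _ vy ty _.
- rewrite ltnS => j0; have [c1 c2 c3 c4 c5] := ch j0; split=> // p hp.
  by apply: first => //; rewrite Fcnt.
- by rewrite ltnS => j0; have [c1 c2 c3 c4 c5] := ch j0.
- move=> a ha; rewrite !hit !w0; try lia.
  by have := part_nonincr po (a := a) ltac:(lia); lia.
- by rewrite hit w0; lia.
- by rewrite ltnS => j0; have [c1 c2 c3 c4 c5] := ch j0; apply: avail_prefix c5.
move=> x [S' [vx tx Qx _ cu il mo Sp SA _ wt ps tp]].
rewrite /index_iota subn0 in wt ps tp; rewrite subn0 in Qx.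
have QxE i : Q x A i = Ql mu (minn i j.+1).
  rewrite Qx Qy; case: (leqP i j) => ij.
    have -> : minn i j.+1 = i by lia.
    by rewrite muln0 addn0.
  have -> : minn i j.+1 = j.+1 by lia.
  by rewrite muln1 Ql_colh.
have Fpos p : p < h -> 0 < F p by [].
have c0 r v : 0 < v -> cnt T r v = cnt T0 r v + ((v <= h) && (F v.-1 <= r)).
  by move=> v0; rewrite {1}TE; apply: cnt_strip.
have Ffirst p r : p < h -> 0 < cnt T0 r p.+1 -> F p <= r.
  by move=> hp hc0; rewrite -Fcnt // c0 //; lia.
have part0 a : 0 < a -> part eta a = part (outer T0) a + hits h F a by move=> a0; exact: eE.
have sle : size (cut 1 (cut j mu)) <= h by rewrite cut_cut // size_cut // colh_homo.
have bo : bostate j.+1 x T0 (outer T0) F S'.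
  split=> //.
  - apply: tops_shift tx _ => dV; have := Q_large (leqnn (nusize x A)).
    by rewrite QxE => <-; apply: Ql_even; exact: even.
  - by move=> _; split=> // p hp; have := Fb p hp; split; [lia|move=> a; apply: Sp].
  - by move=> _ p r hp; apply: Ffirst; apply: leq_trans hp (colh_homo _ _).
  - by rewrite -cut_cut.
  - move=> a ha; have := w0 a ha; have := wt a ha; rewrite hit; lia.
  - case sE : (size (outer T0)) => [//|q].
    have := part_pos po (ltn0Sn q); rewrite sE ltnSn => hq.
    apply: leq_trans se; rewrite -part_pos //; last by case: lr => -[].
    by rewrite part0 //; lia.
have [xf [st [ok tpf [vf tf] Qf [wf psf]]]] := IH j.+1 x T0 (outer T0) F S' ltac:(lia) bo.
exists xf, (rev [seq F i | i <- iota 0 h] ++ st); split=> //.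
- rewrite TE; apply: (steps_add lr0 h0 sle Finc Fpos Ffirst) ok => a a0.
  by rewrite -!part0 //; apply: part_nonincr => //; case: lr => -[].
- by rewrite foldl_cat tp tpf.
split=> //; rewrite col_stepsS foldl_cat psf -/h ps.
by rewrite TE.
Qed.

End Backward.

(** Below row l(lambda) the first column increases strictly, with letters at most l(mu). This
    carries the rank condition over to eta. *)
Lemma LR_size eta la mu T : LR eta la mu T -> size eta <= size la + size mu.
Proof.
move=> lr; rewrite leqNgt; apply/negP => hs.
have [so e sz vb] := LR_rows lr; have [[pe pl Tla oe sle] _ [_ s2] _ _] := lr.
have sk k : size la + k.+1 <= size eta -> in_skew T (size la + k.+1) 1.
  move=> hk; rewrite addnS (in_skewE _ _ lr) -addnS part_pos // ?hk ?andbT; last by lia.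
  by rewrite /part nth_default //; lia.
have grow k : size la + k.+1 <= size eta -> k.+1 <= entry T (size la + k.+1) 1.
  elim: k => [|k IH] hk.
    by have := vb _ _ (entry_mem (sk 0 hk)); lia.
  have hk' : size la + k.+1 <= size eta by lia.
  have sk' := sk k.+1 hk; rewrite addnS in sk' *.
  exact: leq_ltn_trans (IH hk') (s2 _ _ (sk k hk') sk').
have hk : size la + (size mu).+1 <= size eta by lia.
have := grow _ hk; have := vb _ _ (entry_mem (sk _ hk)); lia.
Qed.

Section Start.
Variables (d : domino) (n : nat) (L : Ldata) (eta : seq nat) (y : rc).
Local Notation A := (anode d n).
Hypothesis Lok : L_ok (Some d) n L.
Hypothesis rcy : RC None n eta L y.
Hypothesis se : size eta <= A.

(** The sizes telescope: eta has at most A parts and total |L|, so no box is left at nodes from A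
    on. *)
Lemma none_empty a : A <= a -> nu y a = [::].
Proof.
move=> ha; case: rcy => pe sume [_ [sy /allP ay] _ _ _] wt.
case: (ltnP n a) => na; first by case: a {ha} na => // a na; rewrite /= nth_default // sy.
have s0 : nusize y a = 0.
  have := wtcoef_sum L y a; rewrite -(Lsize_Lge (m := a)); last by move=> b hb; apply: (L_ok_Lge Lok); lia.
  rewrite (@eq_big_nat _ _ _ 1 a.+1 (wtcoef L y) (fun b => Posz (part eta b))); last first.
    by move=> b hb; rewrite -wt //; lia.
  rewrite -(big_morph Posz PoszD (erefl _)) (sum_parts (leq_trans se ha)) sume; lia.
case: a ha na s0 => // a ha na s0.
have := ay (nu y a.+1); rewrite /= mem_nth ?sy // => /(_ isT)/andP[_ pos].
move: s0 pos; rewrite /nusize /=; case: (nth _ _ _) => //= r u; lia.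
Qed.

Lemma none_valid : valid A L y.
Proof.
case: rcy => pe sume [_ [sy /allP ay] _ vc rig] wt a ha.
have an : 1 <= a <= n by move: ha; rewrite /anode; case: (d); lia.
have vE i : vacancy None n L y a i = vac A L y a i.
  by rewrite (vacancy_None Lok none_empty) //; have -> : a <= A by lia.
split.
- case: a {ha vE} an => // a an; apply: ay; rewrite /= mem_nth // sy; lia.
- by move=> i; case: (posnP i) => [->|i0]; [rewrite vac0|rewrite -vE; apply: vc].
by move=> r rx; rewrite -vE; apply: rig.
Qed.

Lemma none_tops j : tops d n j y.
Proof.
have Q0 b i : A <= b -> Q y b i = 0 by move=> hb; rewrite /Q none_empty.
have sy : size y = n by case: rcy => _ _ [_ []].
split; last first.
  move=> e; have -> : nu y (topnode d n e) = [::].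
    by apply: none_empty; rewrite /topnode /anode; case: (d); case: e; lia.
  by split.
have s0 : nusize y A = 0 by rewrite /nusize none_empty.
split=> //; move: Q0 s0; rewrite /anode; case: (d) => Q0 s0.
- by move=> i; rewrite !Q0 //; lia.
- by move=> i; rewrite !Q0 //; lia.
by rewrite s0; split=> i; rewrite !Q0 //; lia.
Qed.

End Start.

(** Converse of the analysis under the rank condition: the tiling of nu^(A) makes the last nodes
    equal halves or copies, with vacancy numbers exactly 0. *)
Lemma RC_intro d n L la x : L_ok (Some d) n L -> is_part la -> size la <= anode d n ->
  valid (anode d n) L x -> (forall j, tops d n j x) ->
  tileable d (lens (nu x (anode d n))) ->
  (forall a, 1 <= a <= anode d n -> ((part la a)%:Z = wtcoef L x a)%R) ->
  RC (Some d) n la L x.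
Proof.
move=> Lok pl sl vx tx til wx.
have [[sx tQ] zx] := tx 0.
have tq := topsQ_topQ (tx 0).1.
have low a : 1 <= a <= n -> a <= anode d n \/ exists e, a = topnode d n e.
  move=> ha; rewrite /topnode /anode; case: (d).
  - by case: (leqP a n.-1) => h; [left|right; exists true; lia].
  - by case: (leqP a n.-1) => h; [left|right; exists true; lia].
  case: (leqP a n.-2) => h; [by left|right].
  by case: (eqVneq a n) => an; [exists true|exists false; lia].
have halves : d = Vdom -> nusize x n.-1 = nusize x n /\ forall i, Q x n.-1 i = Q x n i.
  move=> dV; have ev : ~~ odd (nusize x (anode d n)).
    have := Q_large (leqnn (nusize x (anode d n))); rewrite QE => <-; apply: Ql_even.
    by move: til; rewrite {1}dV.
  have := tops_size dV (tx 0).1; move: tQ ev; rewrite /anode dV => -[h1 h2] ev.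
  by rewrite (negbTE ev) addn0 => ->; split=> // i; rewrite h2 (negbTE ev) addn0.
have top0 e i : 1 <= topnode d n e <= n -> vacancy (Some d) n L x (topnode d n e) i = 0%R.
  move: tq halves; rewrite /topQ /vacancy /topnode /anode; case: (d) => t hv h.
  - by rewrite eqxx t; lia.
  - by rewrite eqxx t; lia.
  have [_ hv'] := hv erefl; have := t i; have := hv' i; case: e h => h; rewrite eqxx; first by lia.
  case: eqP => _; lia.
split=> //.
  split=> //.
  - split=> //; apply/(all_nthP [::]) => i hi; change (is_true (is_rpart (nu x i.+1))).
    have hi' : i < n by rewrite -sx.
    have [h|[e ->]] := low i.+1 ltac:(lia); last by case: (zx e).
    by case: (vx i.+1 ltac:(lia)).
  - case=> dH r rx; move: til tq tQ; rewrite dH /= => til tq tQ; apply: til.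
    have -> : lens (nu x n.-1) = lens (nu x n); last exact: map_f.
    apply: Ql_inj => [||i]; last by rewrite -!QE tQ.
      case: (posnP n.-1) => [->//|n1]; apply: is_rpart_lens.
      by have [] := vx n.-1 ltac:(rewrite dH /=; lia).
    by apply: is_rpart_lens; have := zx true; rewrite /topnode dH => -[].
  - move=> a i ha i1 _; have [h|[e aE]] := low a ha; last by rewrite aE top0 // -aE.
    by rewrite vacancyE //; [have [_ p _] := vx a ltac:(lia)|lia].
  - move=> a r ha rx; have [h|[e aE]] := low a ha.
      by rewrite vacancyE //; [have [_ _ q] := vx a ltac:(lia); apply: q|lia].
    rewrite aE top0 -?aE //; rewrite aE in rx; case: (zx e) => _ /(_ r rx) ->; exact: lexx.
have pn m : size la <= m -> m < n -> part la n = 0.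
  by move=> h1 h2; rewrite /part nth_default //; lia.
have Lg := L_ok_Lge Lok (a := n).
have box : (d <> Vdom) -> 0 < n -> ((part la n)%:Z = wtcoef L x n)%R.
  move=> dV n0; have nA : anode d n = n.-1 by rewrite /anode; case: (d) dV.
  rewrite nA in sl Lg; rewrite (pn n.-1) //; last by lia.
  have tz : nusize x n = nusize x n.-1.
    have h i : Q x n i = Q x n.-1 i by move: tQ dV; case: (d) => //.
    by rewrite -(Q_large (leq_addr (nusize x n.-1) (nusize x n))) h Q_large // leq_addl.
  by rewrite /wtcoef Lg; lia.
move: wx box halves tq sl; rewrite /wt_cond /anode; case: (d) => wx box halves tq sl.
- move=> a ha; case: (leqP a n.-1) => an; first by apply: wx; lia.
  by have -> : a = n by [lia]; apply: box => //; lia.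
- move=> a ha; case: (leqP a n.-1) => an; first by apply: wx; lia.
  by have -> : a = n by [lia]; apply: box => //; lia.
have [hs _] := halves erefl; split=> //.
have := tq (nusize x n + nusize x n.-1 + nusize x n.-2); rewrite /anode !Q_large; lia.
Qed.

(** * The two maps on whole configurations *)

Lemma Psi_forward d n L la x : RC (Some d) n la L x -> rank_ok d n la x ->
  exists y T, let mu := lens (nu x (anode d n)) in let eta := wt None n L y in
  [/\ Psi d n L x = Some (y, T), tPsi d n L (y, T) = Some x,
      partitions_of Box (Lsize L)%:Z eta, RC None n eta L y & LR eta la mu T].
Proof.
move=> rcx rk; have [pl sl _ _] := rcx.
have lo := init_L rcx; have vx := init_valid rcx rk.
set mu := lens (nu x (anode d n)).
have [pm _ _] := init_mu rcx rk; rewrite -/mu in pm.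
have rk' : size la + size mu <= anode d n by rewrite size_map.
have ev : d = Vdom -> forall m, 0 < m -> ~~ odd (colh mu m).
  by move=> dV; have [] := init_even rcx rk dV.
have [y [T [eta [st [K [S os]]]]]] :=
  forward_ex lo pl pm rk' ev vx (init_tops rcx rk) erefl (init_wt rcx).
case: os => vy ty Qy _ _ _ _ _ _ _ lr et se _ ok tp ps.
have nA : nu y (anode d n) = [::].
  case: (posnP (anode d n)) => [->//|A0].
  have [/is_rpart_lens py _ _] := vy (anode d n) ltac:(lia).
  have : lens (nu y (anode d n)) = [::].
    by apply: Ql_eq0 => // i; rewrite -QE Qy minn0 Ql0.
  by rewrite /lens; case: (nu y _).
have emp := tops_empty ty nA.
have [sy _] := ty.1.
have [[pe _ _ _ _] _ _ _ _] := lr.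
have [rcy etaE sume] := RC_None lo emp sy vy pe se et.
exists y, T; rewrite /= -etaE; split=> //.
- by rewrite PsiE -/mu -(init_wtE rcx) //; move: ps; rewrite subn0.
- by rewrite (tPsiE _ _ _ _ ok).
- by split=> //; rewrite sume.
by move: lr; rewrite cut0.
Qed.

Lemma tPsi_backward d n L la y : L_ok (Some d) n L -> is_part la -> size la <= anode d n ->
  rank_ok_all d n la L -> target d n la L y ->
  exists x, [/\ RC (Some d) n la L x, tPsi d n L y = Some x & Psi d n L x = Some y].
Proof.
case: y => y T Lok pl sl [_ rk] [mu [eta [[pm smu til] [pe se _] rcy lr]]] /=.
have rk' := rk mu (And3 pm smu til).
have sA : size eta <= anode d n by apply: leq_trans (LR_size lr) rk'.
have ev : d = Vdom -> forall m, 0 < m -> ~~ odd (colh mu m).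
  by move=> dV; move: til; rewrite dV.
have emp := none_empty Lok rcy sA.
have vy := none_valid Lok rcy sA.
have bo : bostate d n L la mu 0 y T eta id (fun=> id).
  split=> //.
  - exact: (none_tops Lok rcy sA).
  - by move=> i; rewrite minn0 Ql0 /Q emp.
  - by rewrite cut0.
  move=> a ha; case: rcy => _ _ _; apply; move: ha; rewrite /anode; case: (d); lia.
have [x [st [ok tp [vx tx] Qx [wx ps]]]] := backward_ex Lok pl pm rk' ev (e := head 0 mu) (add0n _) bo.
have lm : lens (nu x (anode d n)) = mu.
  apply: Ql_inj => // [|i]; last by rewrite -QE Qx.
  case: (posnP (anode d n)) => [->//|A0]; apply: is_rpart_lens.
  by have [] := vx (anode d n) ltac:(lia).
have rcx : RC (Some d) n la L x by apply: RC_intro => //; rewrite lm.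
exists x; split=> //; first by rewrite (tPsiE _ _ _ _ ok).
by rewrite PsiE lm -(init_wtE rcx).
Qed.

Lemma size_le_sumn (mu : seq nat) : 0 \notin mu -> size mu <= sumn mu.
Proof. elim: mu => //= b mu IH; rewrite inE negb_or => /andP[b0 /IH]; lia. Qed.

(** |nu^(A)| and |mu| are at most |L|, and a partition has no more rows than boxes. The maximum
    keeps the support of L below the last nodes, and 4 absorbs the shifts from n to A. *)
Lemma rank_large d (L : Ldata) (la : seq nat) : (forall a i, L (a, i) <> 0 -> 1 <= a /\ 1 <= i) -> is_part la ->
  exists n0, forall n, n0 <= n ->
    [/\ L_ok (Some d) n L, size la <= anode d n & rank_ok_all d n la L].
Proof.
move=> hL pl; exists (\max_(x <- finsupp L) x.1 + size la + Lsize L + 4) => n hn.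
have An : size la + Lsize L <= anode d n by rewrite /anode; case: (d); lia.
split; last 1 first.
- split=> [x rcx|mu [/andP[_ z] smu _]]; last by have := size_le_sumn z; lia.
  rewrite /rank_ok; apply: leq_trans An; rewrite leq_add2l.
  have -> : size (nu x (anode d n)) = size (lens (nu x (anode d n))) by rewrite size_map.
  have /andP[_ z] := is_rpart_lens (init_rpart rcx (anode d n)).
  apply: leq_trans (size_le_sumn z) _.
  have := wtcoef_sum L x (anode d n); rewrite -(L_ok_Lsize (init_L rcx)).
  rewrite (@eq_big_nat _ _ _ 1 (anode d n).+1 (wtcoef L x) (fun b => Posz (part la b))); last first.
    by move=> b hb; rewrite (init_wt rcx).
  by rewrite -(big_morph Posz PoszD (erefl _)) /nusize; lia.
- move=> a i /eqP La; have [h1 h2] := hL a i La; split=> //.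
  have : a <= \max_(x <- finsupp L) x.1.
    have hin : (a, i) \in finsupp L by rewrite mem_finsupp; apply/eqP.
    exact: (@leq_bigmax_seq _ _ (fun=> true) (fun x : nat * nat => x.1) (a, i) hin isT).
  by case: (d); lia.
lia.
Qed.

Theorem theorem3p3 :
  (* a single rigged configuration satisfying the rank condition *)
  (forall (d : domino) (n : nat) (L : Ldata) (la : seq nat) (x : rc),
     RC (Some d) n la L x ->
     rank_ok d n la x ->
     la = wt (Some d) n L x /\
     exists (x' : rc) (T : skewtab),
       let mu := lens (nu x (anode d n)) in
       let eta := wt None n L x' in
       [/\ Psi d n L x = Some (x', T),
           partitions_of d ((Lsize L)%:Z - (sumn la)%:Z)%R mu,
           partitions_of Box (Lsize L)%:Z eta,
           RC None n eta L x'
         & LR eta la mu T])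
  /\
  (* fixed la and L *)
  (forall (d : domino) (n : nat) (L : Ldata) (la : seq nat),
     L_ok (Some d) n L -> is_part la -> size la <= anode d n ->
     rank_ok_all d n la L ->
     [/\ partial_bij (RC (Some d) n la L) (target d n la L) (Psi d n L),
         partial_bij (target d n la L) (RC (Some d) n la L) (tPsi d n L),
         forall x y, RC (Some d) n la L x -> Psi d n L x = Some y ->
           tPsi d n L y = Some x
       & forall x y, target d n la L y -> tPsi d n L y = Some x ->
           Psi d n L x = Some y])
  /\
  (* the rank conditions hold for all large n *)
  (forall (d : domino) (L : Ldata) (la : seq nat),
     (forall a i, L (a, i) <> 0 -> 1 <= a /\ 1 <= i) -> is_part la ->
     exists n0, forall n, n0 <= n ->
       [/\ L_ok (Some d) n L, size la <= anode d n & rank_ok_all d n la L]).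
Proof.
split; last split; last exact: rank_large.
  move=> d n L la x rcx rk; split; first exact: (init_wtE rcx).
  have [y [T [h1 _ h2 h3 h4]]] := Psi_forward rcx rk.
  by exists y, T; split=> //; exact: (init_mu rcx rk).
move=> d n L la Lok pl sl rka.
(* Each direction yields a value together with the equation of the reverse map; injectivity and
   surjectivity on both sides follow. *)
have fwd x : RC (Some d) n la L x ->
    exists y, [/\ Psi d n L x = Some y, tPsi d n L y = Some x & target d n la L y].
  move=> rcx; have rk := rka.1 x rcx.
  have [y [T [h1 h2 h3 h4 h5]]] := Psi_forward rcx rk.
  exists (y, T); split=> //; exists (lens (nu x (anode d n))), (wt None n L y).
  by split=> //; exact: (init_mu rcx rk).
have bwd y : target d n la L y ->
    exists x, [/\ RC (Some d) n la L x, tPsi d n L y = Some x & Psi d n L x = Some y].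
  exact: tPsi_backward.
have inv1 x y : RC (Some d) n la L x -> Psi d n L x = Some y -> tPsi d n L y = Some x.
  by move=> /fwd[z [-> h _]] [<-].
have inv2 x y : target d n la L y -> tPsi d n L y = Some x -> Psi d n L x = Some y.
  by move=> /bwd[z [_ -> h]] [<-].
split=> //; split.
- by move=> x /fwd[y [h _ hy]]; exists y.
- move=> x x' /fwd[y [h hx _]] rx' e; rewrite h in e.
  by have := inv1 x' y rx' (esym e); rewrite hx => -[].
- by move=> y /bwd[x [h1 _ h2]]; exists x.
- by move=> y /bwd[x [h1 h2 _]]; exists x.
- move=> y y' /bwd[x [_ h hx]] ty' e; rewrite h in e.
  by have := inv2 x y' ty' (esym e); rewrite hx => -[].
by move=> x /fwd[y [_ h hy]]; exists y.
Qed.
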